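(* Let $n\ge 2$. A subset $A\subseteq\mathfrak{S}_n$ is cyclic Schur-positive if and only if it is Schur-positive and $\mathrm{cDes}$-invariant.
   Context: For $\pi\in\mathfrak{S}_n$ (one-line notation), $\mathrm{Des}(\pi)=\{i\in[n-1]:\pi(i)>\pi(i+1)\}$ and $\mathrm{cDes}(\pi)=\{i\in[n]:\pi(i)>\pi(i+1)\}$ with $\pi(n+1):=\pi(1)$. For $J\subseteq[n]$, $\mathbf{x}^J=\prod_{i\in J}x_i$, and $i+J=\{i+j\bmod n:j\in J\}\subseteq[n]$. Schur-positive: with $\mathcal{F}_{n,D}=\sum x_{i_1}\cdots x_{i_n}$ over $i_1\le\cdots\le i_n$ with $i_j<i_{j+1}$ whenever $j\in D$ (Gessel's fundamental quasisymmetric function), $A$ is Schur-positive if $\sum_{\pi\in A}\mathcal{F}_{n,\mathrm{Des}(\pi)}$ is symmetric with nonnegative coefficients in the Schur basis. $\mathrm{cDes}$-invariant: there is a bijection $\psi:A\to A$ with $\mathrm{cDes}(\psi\pi)=1+\mathrm{cDes}(\pi)$ for all $\pi\in A$. Cyclic Schur-positive: for a skew shape $\lambda/\mu$ with $n$ cells, $\mathrm{Des}(T)$ of $T\in\mathrm{SYT}(\lambda/\mu)$ is the set of $i\in[n-1]$ with $i+1$ in a strictly lower row than $i$. A cyclic descent extension on $\mathrm{SYT}(\lambda/\mu)$ is a pair $(\mathrm{cDes},\psi)$, $\mathrm{cDes}:\mathrm{SYT}(\lambda/\mu)\to2^{[n]}$, $\psi$ a bijection, with $\mathrm{cDes}(T)\cap[n-1]=\mathrm{Des}(T)$,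 $\mathrm{cDes}(\psi T)=1+\mathrm{cDes}(T)$, $\emptyset\ne\mathrm{cDes}(T)\ne[n]$; it exists iff $\lambda/\mu$ is not a connected ribbon, and $\sum_T\mathbf{x}^{\mathrm{cDes}(T)}$ is then independent of the choice. $A$ is cyclic Schur-positive if there are nonnegative integers $m_{\lambda/\mu}$ (over skew shapes with $n$ cells that are not connected ribbons) with $\sum_{\pi\in A}\mathbf{x}^{\mathrm{cDes}(\pi)}=\sum m_{\lambda/\mu}\sum_{T\in\mathrm{SYT}(\lambda/\mu)}\mathbf{x}^{\mathrm{cDes}(T)}$. *)

(* Defs.v *)
From HB Require Import structures.
From mathcomp Require Import all_boot all_fingroup.
Set Implicit Arguments. Unset Strict Implicit. Unset Printing Implicit Defensive.

(* Conventions: positions 1..n of the paper are 0..n-1 here (type 'I_n);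
   paper's i in [n] corresponds to index i-1.  [n-1] = {i : 'I_n | i.+1 < n}. *)

Definition shiftset n (J : {set 'I_n}) : {set 'I_n} := [set ordS j | j in J].

Definition Des n (p : {perm 'I_n}) : {set 'I_n} :=
  [set i : 'I_n | (i.+1 < n) && (p (ordS i) < p i)].
Definition cDes n (p : {perm 'I_n}) : {set 'I_n} :=
  [set i : 'I_n | p (ordS i) < p i].

(** Coefficient of the monomial x_{w_0} x_{w_1} ... x_{w_{n-1}}
    (w weakly increasing of length n, variables indexed by nat) in Gessel's
    fundamental quasisymmetric function F_{n,D}. *)
Definition Fcoef n (D : {set 'I_n}) (w : seq nat) : nat :=
  [&& size w == n, sorted leq w &
      [forall i : 'I_n, ((i.+1 < n) && (i \in D)) ==> (nth 0 w i < nth 0 w i.+1)]].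

(** Partitions and skew shapes (English notation, rows indexed from 0 top). *)
Definition is_partition (la : seq nat) : bool := sorted geq la && all (fun x => 0 < x) la.

Definition is_skew n (la mu : seq nat) : bool :=
  [&& is_partition la, is_partition mu, size mu <= size la,
      all (fun i => nth 0 mu i <= nth 0 la i) (iota 0 (size la)) &
      sumn la - sumn mu == n].

Definition Kb (la : seq nat) : nat := (sumn la).+1.
Definition cellT (la : seq nat) := ('I_(Kb la) * 'I_(Kb la))%type.

Definition inskew (la mu : seq nat) (r c : nat) : bool :=
  (r < size la) && (nth 0 mu r <= c < nth 0 la r).
Definition cellb (la mu : seq nat) (x : cellT la) : bool := inskew la mu x.1 x.2.
Arguments cellb la mu x : clear implicits.

Definition adjc (la mu : seq nat) : rel (cellT la) :=
  fun x y => [&& cellb la mu x, cellb la mu y &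
    ((x.1 == y.1 :> nat) && ((x.2.+1 == y.2 :> nat) || (y.2.+1 == x.2 :> nat))) ||
    ((x.2 == y.2 :> nat) && ((x.1.+1 == y.1 :> nat) || (y.1.+1 == x.1 :> nat)))].

Arguments adjc la mu : clear implicits.

Definition connected_shape (la mu : seq nat) : bool :=
  [forall x : cellT la, forall y : cellT la,
     (cellb la mu x && cellb la mu y) ==> connect (adjc la mu) x y].

Definition has_2x2 (la mu : seq nat) : bool :=
  [exists r : 'I_(Kb la), exists c : 'I_(Kb la),
     [&& inskew la mu r c, inskew la mu r c.+1, inskew la mu r.+1 c
       & inskew la mu r.+1 c.+1]].

Definition connected_ribbon (la mu : seq nat) : bool :=
  connected_shape la mu && ~~ has_2x2 la mu.

(** Standard Young tableaux of shape la/mu with n cells, encoded by the map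
    sending entry i (the paper's i+1) to its cell; it is a bijection onto the
    cells, increasing along rows (left to right) and columns (top to bottom). *)
Definition is_syt n (la mu : seq nat) (g : {ffun 'I_n -> cellT la}) : bool :=
  [&& [forall i, cellb la mu (g i)],
      [forall x : cellT la, cellb la mu x ==> [exists i, g i == x]],
      injectiveb g,
      [forall i, forall j, ((g i).1 == (g j).1) && ((g i).2 < (g j).2) ==> (i < j)] &
      [forall i, forall j, ((g i).2 == (g j).2) && ((g i).1 < (g j).1) ==> (i < j)]].

Arguments is_syt n la mu g : clear implicits.

Definition SYT n (la mu : seq nat) := {g : {ffun 'I_n -> cellT la} | is_syt n la mu g}.

Definition DesT n (la mu : seq nat) (T : SYT n la mu) : {set 'I_n} :=
  [set i : 'I_n | (i.+1 < n) &&
     [exists j : 'I_n, (j == i.+1 :> nat) && ((val T i).1 < (val T j).1)]].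

Definition cyclic_descent_ext n (la mu : seq nat)
    (cD : SYT n la mu -> {set 'I_n}) (psi : {perm SYT n la mu}) : Prop :=
  forall T : SYT n la mu,
    [/\ [set i in cD T | i.+1 < n] = DesT T,
        cD (psi T) = shiftset (cD T),
        cD T != set0 & cD T != setT].

Definition maxw (w : seq nat) : nat := (foldr maxn 0 w).+1.

Definition is_ssyt (la w : seq nat) (f : {ffun cellT la -> 'I_(maxw w)}) : bool :=
  [&& [forall x, ~~ cellb la [::] x ==> (val (f x) == 0)],
      [forall x, forall y, [&& cellb la [::] x, cellb la [::] y,
          x.1 == y.1 & x.2 < y.2] ==> (f x <= f y)],
      [forall x, forall y, [&& cellb la [::] x, cellb la [::] y,
          x.2 == y.2 & x.1 < y.1] ==> (f x < f y)] &
      [forall v : 'I_(maxw w),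
          #|[set x | cellb la [::] x & f x == v]| == count_mem (val v) w]].

Arguments is_ssyt la w f : clear implicits.

(** coefficient of the monomial x_{w_0}...x_{w_{n-1}} in the Schur function s_la *)
Definition schur_coef (la w : seq nat) : nat :=
  #|[set f : {ffun cellT la -> 'I_(maxw w)} | is_ssyt la w f]|.

(** Schur-positivity: sum_{p in A} F_{n,Des p} equals a nonnegative integer
    combination (multiset L of partitions of n) of Schur functions,
    compared coefficientwise on all monomials of degree n. *)
Definition schur_positive n (A : {set {perm 'I_n}}) : Prop :=
  exists L : seq (seq nat),
    all (fun la => is_partition la && (sumn la == n)) L /\
    forall w : seq nat, size w = n -> sorted leq w ->
      \sum_(p in A) Fcoef (Des p) w = \sum_(la <- L) schur_coef la w.

Definition cDes_invariant n (A : {set {perm 'I_n}}) : Prop :=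
  exists psi phi : {perm 'I_n} -> {perm 'I_n},
    [/\ {in A, forall p, psi p \in A}, {in A, forall p, phi p \in A},
        {in A, cancel psi phi}, {in A, cancel phi psi} &
        {in A, forall p, cDes (psi p) = shiftset (cDes p)}].

(** cyclic Schur-positivity: multiset L of skew shapes with n cells that are
    not connected ribbons, with chosen cyclic descent extensions, such that the
    coefficients of x^J agree for every J. *)
Definition cyclic_schur_positive n (A : {set {perm 'I_n}}) : Prop :=
  exists (L : seq (seq nat * seq nat))
         (cD : forall la mu : seq nat, SYT n la mu -> {set 'I_n}),
    [/\ all (fun s => is_skew n s.1 s.2 && ~~ connected_ribbon s.1 s.2) L,
        (forall s, s \in L -> exists psi, cyclic_descent_ext (cD s.1 s.2) psi) &
        forall J : {set 'I_n},
          #|[set p in A | cDes p == J]| =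
          \sum_(s <- L) #|[set T : SYT n s.1 s.2 | cD s.1 s.2 T == J]|].

(* Main.v *)
Require Import Defs.
From HB Require Import structures.
From mathcomp Require Import all_boot all_fingroup.
From mathcomp Require Import ssralg ssrnum rat vector.
From mathcomp Require Import zify ring lra.

Set Implicit Arguments.
Unset Strict Implicit.
Unset Printing Implicit Defensive.

(** A rotation-invariant count [a] on subsets of [n] vanishing on the empty set
    is determined by the sums [a(J) + a(J u {n})], so cyclic descent
    distributions are determined by ordinary ones.  The forward implication then
    reduces to the Schur-positivity of skew Schur functions: a skew tableau,
    read as a word of cells, stays a tableau under Knuth moves, so
    Robinson-Schensted splits the tableaux of a skew shape into full sets of
    straight ones with the same descents.

    Conversely, a hook [(n-k,1^k)] has one tableau for each descent set of size
    [k], a non-hook has none with descent set [{1..k}], so the numbers of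
    permutations in [A] with cyclic descent set [{1..p}] are the multiplicities
    with which consecutive hooks pair up to the disconnected shapes "column of
    length p plus row of length n-p".  What remains is a cyclic descent
    extension for every non-hook shape [nu].  Let [s_1, ..., s_(n-1)] act on
    functions on the tableaux of [nu] by Young's seminormal form, let [s_n] be the
    conjugate of [s_(n-1)] by the Coxeter element, and let [U_J] be the common
    fixed space of the [s_i] with [i] not in [J].  The spaces [U_J] with [n] in
    [J] have a common adapted basis, indexed by tableaux and their descent sets,
    hence so do those with [l] in [J] for any fixed [l].  The count
    [a(J) = dim U_J / sum_(i in J) U_(J-i)] satisfies the recursion as soon as
    [U_J] meets [sum_(i in J) U_(J+j-i)] in [sum_(i in J) U_(J-i)] only.  This is
    clear for an arc [J], where [a(J) = 0] because [nu] is not a hook, and the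
    exchange of one element of [J] carries it to all [J]. *)

(** * Subspace families with local distributivity *)

(** The recursion forces the cyclic counts to be alternating sums of ordinary descent counts; what
    is not visible is that these integers are nonnegative and consistent under rotation. Realizing
    them as dimensions of quotients gives nonnegativity, and rotation invariance comes from an
    operator that permutes the spaces [U_J]: conjugation by the Coxeter element moves each generator
    to the next one, and its square takes the last ordinary generator back to the first, so the one
    added generator closes the cycle. The obstacle is that the adapted bases for different [l] do
    not coincide, so the lattice of all [U_J] need not be distributive; distributivity is available
    only among sets that share an element. This is why the argument proceeds by exchanging single
    elements, and why some set of each size is needed where the quotient is known to vanish. The
    seminormal form is taken in a normalization without square roots, so that everything lives over
    the rationals. *)

Section SubspaceFamily.
Import GRing.Theory.
Local Open Scope ring_scope.
Variables (F : fieldType) (V : vectType F) (X : finType).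
Variable U : {set X} -> {vspace V}.
Hypothesis Umono : forall I I' : {set X}, I \subset I' -> (U I <= U I')%VS.
Hypothesis Udist : forall (l j : X) (Y J : {set X}),
  l \in Y -> j != l -> j \notin J -> l \notin J -> J \subset Y ->
  (U (Y :\ j) :&: \sum_(i in J) U (Y :\ i) <= \sum_(i in J) U (Y :\ i :\ j))%VS.

Definition Ubelow (J : {set X}) : {vspace V} := (\sum_(i in J) U (J :\ i))%VS.

Lemma sub_Ubelow (J : {set X}) i : i \in J -> (U (J :\ i) <= Ubelow J)%VS.
Proof. by move=> iJ; apply: (sumv_sup i). Qed.

Lemma Ubelow_sub (J : {set X}) : (Ubelow J <= U J)%VS.
Proof. by apply/subv_sumP=> i _; apply: Umono; apply: subsetDl. Qed.

(** Together with [U J] this sum makes up [Ubelow (j |: J)]: its sets arise from [J] by exchanging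
    one element for [j]. *)
Definition Unear (J : {set X}) (j : X) : {vspace V} :=
  (\sum_(i in J) U ((j |: J) :\ i))%VS.

(* One exchange step: J and J' = j0 |: J :\ m have the same union Y with one
   more element, and the m-component of a relation for J is a relation for J'. *)
Lemma near_below_exchange (J : {set X}) (j0 m : X) :
    m \in J -> j0 \notin J ->
    (U (j0 |: J :\ m) :&: Unear (j0 |: J :\ m) m <= Ubelow (j0 |: J :\ m))%VS ->
  (U J :&: Unear J j0 <= Ubelow J)%VS.
Proof.
move=> mJ j0J IH; set J' := j0 |: J :\ m.
have j0m : j0 != m by apply: contraNneq j0J => ->.
have YE : m |: J' = j0 |: J.
  by rewrite /J' setUCA setD1K.
have J'E : J' = (j0 |: J) :\ m.
  apply/setP=> z; rewrite !inE; case: (z =P m) => [->|]; last by rewrite andTb.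
  by rewrite eq_sym (negPf j0m).
apply/subvP=> x /memv_capP[xJ /memv_sumP[x_ x_in xE]].
(* Solving the relation for [x_ m] turns [x] into the term of index [j0] of [Unear J' m], so the
   hypothesis applies to [x_ m]. *)
have xm : x_ m \in Ubelow J'.
  apply: (subvP IH); apply/memv_capP; split.
    by rewrite -/J' J'E; apply: x_in.
  have -> : x_ m = x - \sum_(i in J | i != m) x_ i.
    by rewrite xE (bigD1 m) //= addrK.
  rewrite /Unear -/J' YE memvB //.
    apply: (subvP (sumv_sup j0 _ (subvv _))); first by rewrite !inE eqxx.
    by rewrite setU1K.
  apply: memv_suml => i /andP[iJ im].
  apply: (subvP (sumv_sup i _ (subvv _))); last exact: x_in.
  by rewrite !inE im iJ orbT.
case/memv_sumP: xm => z_ z_in zE.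
have j0J' : j0 \in J' by rewrite !inE eqxx.
have zj0 : z_ j0 \in U (J :\ m).
  by have := z_in _ j0J'; rewrite /J' setU1K // !inE negb_and j0J orbT.
have J'D : forall i, (i \in J') && (i != j0) = (i \in J) && (i != m).
  move=> i; rewrite !inE; case: (i =P j0) => [->|]; first by rewrite (negPf j0J) andbF.
  by rewrite /= andbT andbC.
(* Once [z_ j0] is moved to the left, every set involved contains [m], which is where [Udist] is
   available. *)
have key : x - z_ j0 = \sum_(i in J :\ m) (x_ i + z_ i).
  rewrite big_split /= xE (bigD1 m) //= zE (bigD1 j0) //=.
  rewrite (eq_bigl _ _ J'D).
  rewrite [X in X + _ - _]addrC -!addrA [RHS]addrC; congr (_ + _).
    by apply: eq_bigl => i; rewrite !inE andbC.
  rewrite addrC subrK.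
  by apply: eq_bigl => i; rewrite !inE andbC.
have mem1 : x - z_ j0 \in (\sum_(i in J :\ m) U ((j0 |: J) :\ i :\ j0))%VS.
  apply: (subvP (@Udist m j0 _ _ _ j0m _ _ _)).
  - by rewrite !inE mJ orbT.
  - by rewrite !inE negb_and j0J orbT.
  - by rewrite !inE eqxx.
  - by apply/subsetP=> i; rewrite !inE => /andP[_ ->]; rewrite orbT.
  apply/memv_capP; split.
    rewrite setU1K // memvB //.
    by apply: (subvP (Umono _)) zj0; apply: subsetDl.
  rewrite key; apply: memv_suml => i; rewrite !inE => /andP[im iJ].
  apply: (subvP (sumv_sup i _ (subvv _))); first by rewrite !inE im iJ.
  rewrite memvD ?x_in //.
  have iJ' : i \in J' by rewrite !inE im iJ orbT.
  apply: (subvP (Umono _)) (z_in _ iJ').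
  by rewrite J'E; apply: setSD; apply: subsetDl.
rewrite -(subrK (z_ j0) x) memvD //; last exact: (subvP (sub_Ubelow mJ)).
apply: (subvP _ _ mem1); apply/subv_sumP=> i; rewrite !inE => /andP[im iJ].
apply: subv_trans (sub_Ubelow iJ).
apply: Umono; apply/subsetP=> z; rewrite !inE.
by case/and3P=> /negPf-> -> /= ->.
Qed.

(** Enlarging all sets by [j] brings them into the range of [Udist] with base [j]; removing [l]
    again moves the relation from [Unear J l] into [Unear J j]. *)
Lemma near_below_change (J : {set X}) (j l : X) :
    j \notin J -> l \notin J ->
    (U J :&: Unear J j <= Ubelow J)%VS ->
  (U J :&: Unear J l <= Ubelow J)%VS.
Proof.
move=> jJ lJ IH; case: (eqVneq l j) => [->//|lj].
apply: subv_trans IH; apply/subvP=> x /memv_capP[xJ xn].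
apply/memv_capP; split=> //.
have := @Udist j l (l |: (j |: J)) J; rewrite !inE eqxx orbT => /(_ isT lj lJ jJ).
have -> : J \subset l |: (j |: J) by apply/subsetP=> z zJ; rewrite !inE zJ !orbT.
move=> /(_ isT) /subvP /(_ x).
have lN : l \notin j |: J by rewrite !inE negb_or lj.
rewrite setU1K // => H.
have {}H : x \in (\sum_(i in J) U ((l |: (j |: J)) :\ i :\ l))%VS.
  apply: H; apply/memv_capP; split.
    by apply: (subvP (Umono _)) xJ; apply: subsetUr.
  apply: (subvP _ _ xn); apply/subv_sumP=> i iJ.
  apply: (sumv_sup i) => //; apply: Umono; apply: setSD.
  by apply/subsetP=> z; rewrite !inE => /orP[->|->]; rewrite ?orbT.
apply: (subvP _ _ H); apply/subv_sumP=> i iJ.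
apply: (sumv_sup i) => //; apply: Umono; apply/subsetP=> z; rewrite !inE.
by case/and3P=> /negPf-> -> /=.
Qed.

(** Each exchange brings [J] one element closer to [B], where the inclusion is immediate because
    [U B] lies in the sum below it. *)
Lemma near_below (B J : {set X}) (j : X) :
    #|B| = #|J| -> (U B <= Ubelow B)%VS -> j \notin J ->
  (U J :&: Unear J j <= Ubelow J)%VS.
Proof.
move=> + UB; have [N] := ubnP #|J :\: B|; elim: N J j => // N IHN J j; rewrite ltnS => leN BJ jJ.
case: (set_0Vmem (J :\: B)) => [/eqP|[m]].
  rewrite setD_eq0 => sJB; have -> : J = B by apply/eqP; rewrite eqEcard sJB BJ /=.
  exact: subv_trans (capvSl _ _) UB.
rewrite !inE => /andP[mB mJ].
have [j0 j0B j0J] : exists2 j0, j0 \in B & j0 \notin J.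
  apply/subsetPn; apply: contra mB => sBJ.
  by have -> : B = J by apply/eqP; rewrite eqEcard sBJ BJ /=.
apply: (near_below_change j0J jJ); apply: (near_below_exchange mJ j0J).
apply: IHN.
- apply: leq_trans leN; apply: proper_card; apply/properP; split; last first.
    exists m; rewrite !inE ?mB ?mJ // eqxx /= orbF.
    by apply: contraNN j0J => /eqP<-.
  by apply/subsetP=> z; rewrite !inE; case: eqP => [->|_]; rewrite ?j0B //= => /and3P[-> _ ->].
- by rewrite cardsU1 !inE negb_and j0J orbT /= (cardsD1 m J) mJ in BJ *.
- by rewrite !inE eqxx /= orbF; apply: contraNneq j0J => <-.
Qed.

Definition qdim (J : {set X}) : nat := (\dim (U J) - \dim (Ubelow J))%N.

(** By [near_below] the two parts [U J] and [Unear J j] of [Ubelow (j |: J)] meet exactly in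
    [Ubelow J], so the dimension formula cancels the middle terms. *)
Lemma qdim_add (B J : {set X}) (j : X) :
    #|B| = #|J| -> (U B <= Ubelow B)%VS -> j \notin J ->
  (qdim J + qdim (j |: J) = \dim (U (j |: J)) - \dim (Unear J j))%N.
Proof.
move=> BJ UB jJ; have K := near_below BJ UB jJ.
have E : (U J :&: Unear J j = Ubelow J)%VS.
  apply/eqP; rewrite eqEsubv K subv_cap Ubelow_sub /=.
  apply/subv_sumP=> i iJ; apply: (sumv_sup i) => //; apply: Umono.
  by apply: setSD; apply: subsetUr.
have E2 : Ubelow (j |: J) = (U J + Unear J j)%VS.
  rewrite /Ubelow big_setU1 //= setU1K //.
have := dimv_sum_cap (U J) (Unear J j); rewrite E -E2 /qdim.
have := dimvS (Ubelow_sub J); have := dimvS (Ubelow_sub (j |: J)).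
have : (Unear J j <= Ubelow (j |: J))%VS by rewrite E2 addvSr.
by move/dimvS; lia.
Qed.

End SubspaceFamily.

(** * Standard tableaux of skew shape *)

Lemma sorted_nth (w : seq nat) i j : sorted leq w -> i <= j -> j < size w -> nth 0 w i <= nth 0 w j.
Proof.
move=> srt ij jw; apply: (sorted_leq_nth leq_trans leqnn 0 srt) => //.
by rewrite inE; apply: leq_ltn_trans jw.
Qed.

Lemma nth_partition (la : seq nat) i j :
  is_partition la -> i <= j -> nth 0 la j <= nth 0 la i.
Proof.
case/andP=> srt _ ij; case: (ltnP j (size la)) => [jl|/(nth_default _)->//].
have geq_trans : transitive geq by move=> a b c /= ab bc; apply: leq_trans bc ab.
apply: (sorted_leq_nth geq_trans leqnn 0 srt) => //.
by rewrite inE; apply: leq_ltn_trans jl.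
Qed.

Lemma inskew_convex (la mu : seq nat) r c r' c' r1 c1 :
    is_partition la -> is_partition mu ->
    inskew la mu r c -> inskew la mu r' c' ->
    r <= r1 <= r' -> c <= c1 <= c' ->
  inskew la mu r1 c1.
Proof.
move=> pla pmu /and3P[_ h1 _] /and3P[h2 _ h3] /andP[r1l r1r] /andP[c1l c1r].
rewrite /inskew (leq_ltn_trans r1r h2) /=; apply/andP; split.
  by apply: leq_trans c1l; apply: leq_trans h1; apply: nth_partition.
by apply: leq_ltn_trans c1r _; apply: leq_trans h3 _; apply: nth_partition.
Qed.

Lemma sumn_nth_leq (la : seq nat) i : nth 0 la i <= sumn la.
Proof.
elim: la i => [|x la IH] [|i] //=; first exact: leq_addr.
by apply: leq_trans (IH i) _; apply: leq_addl.
Qed.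

Lemma size_leq_sumn (la : seq nat) : is_partition la -> size la <= sumn la.
Proof.
case/andP=> _; elim: la => //= x la IH /andP[x0 /IH h]; lia.
Qed.

Section SkewTableaux.
Variables (n : nat) (la mu : seq nat).
Hypotheses (pla : is_partition la) (pmu : is_partition mu).

Lemma inskew_bound r c : inskew la mu r c -> (r < Kb la) && (c < Kb la).
Proof.
case/and3P=> rl _ cl; rewrite /Kb !ltnS; apply/andP; split.
  by apply: leq_trans (ltnW rl) (size_leq_sumn pla).
exact: leq_trans (ltnW cl) (sumn_nth_leq _ _).
Qed.

Definition mkcell (r c : nat) : cellT la := (inord r, inord c).

Lemma mkcell1 r c : inskew la mu r c -> (mkcell r c).1 = r :> nat.
Proof. by case/inskew_bound/andP=> h _; rewrite inordK. Qed.

Lemma mkcell2 r c : inskew la mu r c -> (mkcell r c).2 = c :> nat.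
Proof. by case/inskew_bound/andP=> _ h; rewrite inordK. Qed.

Lemma cellb_mkcell r c : inskew la mu r c -> cellb la mu (mkcell r c).
Proof. by move=> h; rewrite /cellb mkcell1 // mkcell2. Qed.

Lemma cell_eq (x y : cellT la) : (x.1 = y.1 :> nat) -> (x.2 = y.2 :> nat) -> x = y.
Proof. by case: x y => [a b] [c d] /= /val_inj-> /val_inj->. Qed.

Section OneTableau.
Variable g : {ffun 'I_n -> cellT la}.

Lemma sytP : reflect
  [/\ forall i, cellb la mu (g i),
      forall x, cellb la mu x -> exists i, g i = x,
      injective g,
      forall i j, (g i).1 = (g j).1 :> nat -> (g i).2 < (g j).2 -> i < j &
      forall i j, (g i).2 = (g j).2 :> nat -> (g i).1 < (g j).1 -> i < j]
  (is_syt n la mu g).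
Proof.
apply: (iffP and5P).
  case=> /forallP h1 /forallP h2 /injectiveP h3 /forallP h4 /forallP h5; split=> //.
  - by move=> x cx; have /implyP/(_ cx)/existsP[i /eqP] := h2 x; exists i.
  - by move=> i j e l; have /forallP/(_ j)/implyP := h4 i; apply; rewrite l andbT; apply/eqP/val_inj.
  - by move=> i j e l; have /forallP/(_ j)/implyP := h5 i; apply; rewrite l andbT; apply/eqP/val_inj.
case=> h1 h2 h3 h4 h5; split.
- exact/forallP.
- by apply/forallP=> x; apply/implyP=> /h2[i <-]; apply/existsP; exists i.
- exact/injectiveP.
- by apply/forallP=> i; apply/forallP=> j; apply/implyP=> /andP[/eqP e l]; apply: h4; rewrite ?e.
- by apply/forallP=> i; apply/forallP=> j; apply/implyP=> /andP[/eqP e l]; apply: h5; rewrite ?e.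
Qed.

Hypothesis sg : is_syt n la mu g.

Lemma syt_cellb i : cellb la mu (g i). Proof. by case/sytP: sg. Qed.

Lemma syt_inj : injective g. Proof. by case/sytP: sg. Qed.

Lemma syt_onto r c : inskew la mu r c -> exists i, (g i).1 = r :> nat /\ (g i).2 = c :> nat.
Proof.
move=> h; have [_ /(_ _ (cellb_mkcell h)) [i gi] _ _ _] := sytP sg.
by exists i; rewrite gi mkcell1 // mkcell2.
Qed.

Lemma syt_row_lt i j : (g i).1 = (g j).1 :> nat -> (g i).2 < (g j).2 -> i < j.
Proof. by case/sytP: sg => _ _ _ h _; apply: h. Qed.

Lemma syt_col_lt i j : (g i).2 = (g j).2 :> nat -> (g i).1 < (g j).1 -> i < j.
Proof. by case/sytP: sg => _ _ _ _; apply. Qed.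

(** The cell in the row of [i] and the column of [j] belongs to the shape by convexity, and its
    entry lies in between. *)
Lemma syt_mono (i j : 'I_n) :
  (g i).1 <= (g j).1 -> (g i).2 <= (g j).2 -> i != j -> i < j.
Proof.
move=> r c ij; rewrite leq_eqVlt in r; rewrite leq_eqVlt in c.
have [/eqP r'|r'] := orP r; have [/eqP c'|c'] := orP c.
- by rewrite (syt_inj (cell_eq r' c')) eqxx in ij.
- exact: syt_row_lt.
- exact: syt_col_lt.
have [k [k1 k2]] : exists k, (g k).1 = (g i).1 :> nat /\ (g k).2 = (g j).2 :> nat.
  apply: syt_onto; apply: (inskew_convex pla pmu (syt_cellb i) (syt_cellb j)).
    by rewrite leqnn ltnW.
  by rewrite leqnn andbT ltnW.
apply: (@ltn_trans k); [apply: syt_row_lt; rewrite ?k1 ?k2 //|].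
by apply: syt_col_lt; rewrite ?k1 ?k2.
Qed.

(** Two cells of one diagonal span a rectangle whose other two corners hold distinct entries
    strictly between [i] and [j]. Hence entries at distance at most two have different contents,
    which keeps the denominators of the seminormal form nonzero. *)
Lemma syt_diag (i j : 'I_n) : i < j -> (g i).1 + (g j).2 = (g j).1 + (g i).2 -> i.+2 < j.
Proof.
move=> ij e.
have [r c] : (g i).1 < (g j).1 /\ (g i).2 < (g j).2.
  case: (ltngtP (g i).1 (g j).1) => r; first by split=> //; lia.
    have : j < i by apply: syt_mono; [exact: ltnW|lia|rewrite neq_ltn ij orbT].
    by rewrite ltnNge (ltnW ij).
  have c : (g i).2 = (g j).2 :> nat by lia.
  by rewrite (syt_inj (cell_eq r c)) ltnn in ij.
have [k [k1 k2]] : exists k, (g k).1 = (g i).1 :> nat /\ (g k).2 = (g j).2 :> nat.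
  apply: syt_onto; apply: (inskew_convex pla pmu (syt_cellb i) (syt_cellb j));
  by rewrite leqnn ?andbT ltnW.
have [l [l1 l2]] : exists k, (g k).1 = (g j).1 :> nat /\ (g k).2 = (g i).2 :> nat.
  apply: syt_onto; apply: (inskew_convex pla pmu (syt_cellb i) (syt_cellb j));
  by rewrite leqnn ?andbT ltnW.
have ik : i < k by apply: syt_row_lt; rewrite ?k1 ?k2.
have kj : k < j by apply: syt_col_lt; rewrite ?k1 ?k2.
have il : i < l by apply: syt_col_lt; rewrite ?l1 ?l2.
have lj : l < j by apply: syt_row_lt; rewrite ?l1 ?l2.
have kl : k != l by apply/eqP=> kl; rewrite kl l1 in k1; rewrite k1 ltnn in r.
have : val k != val l by [].
move: ik kj il lj; rewrite /=; lia.
Qed.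

Lemma syt_row_adj (i j : 'I_n) : (g i).1 = (g j).1 :> nat -> j = i.+1 :> nat -> (g j).2 = (g i).2.+1 :> nat.
Proof.
move=> r ji; case: (ltngtP (g i).2 (g j).2) => c; first last.
- by have ? := syt_inj (cell_eq r c); subst j; lia.
- by have := syt_row_lt (esym r) c; lia.
case: (ltngtP (g j).2 (g i).2.+1) => // c'; first by lia.
have [k [k1 k2]] : exists k, (g k).1 = (g i).1 :> nat /\ (g k).2 = (g i).2.+1 :> nat.
  apply: syt_onto; apply: (inskew_convex pla pmu (syt_cellb i) (syt_cellb j));
  by rewrite ?r ?leqnn // leqnSn ltnW.
have := @syt_row_lt i k; rewrite k1 k2 => /(_ erefl (ltnSn _)).
have := @syt_row_lt k j; rewrite k1 k2 => /(_ r c').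
lia.
Qed.

Lemma syt_col_adj (i j : 'I_n) : (g i).2 = (g j).2 :> nat -> j = i.+1 :> nat -> (g j).1 = (g i).1.+1 :> nat.
Proof.
move=> r ji; case: (ltngtP (g i).1 (g j).1) => c; first last.
- by have ? := syt_inj (cell_eq c r); subst j; lia.
- by have := syt_col_lt (esym r) c; lia.
case: (ltngtP (g j).1 (g i).1.+1) => // c'; first by lia.
have [k [k1 k2]] : exists k, (g k).1 = (g i).1.+1 :> nat /\ (g k).2 = (g i).2 :> nat.
  apply: syt_onto; apply: (inskew_convex pla pmu (syt_cellb i) (syt_cellb j));
  by rewrite ?r ?leqnn // leqnSn ltnW.
have := @syt_col_lt i k; rewrite k1 k2 => /(_ erefl (ltnSn _)).
have := @syt_col_lt k j; rewrite k1 k2 => /(_ r c').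
lia.
Qed.

End OneTableau.

Lemma val_ordS (i : 'I_n) : i.+1 < n -> ordS i = i.+1 :> nat.
Proof. by move=> h; rewrite /= modn_small. Qed.

Lemma DesTE (T : SYT n la mu) (i : 'I_n) :
  (i \in DesT T) = (i.+1 < n) && ((val T i).1 < (val T (ordS i)).1).
Proof.
rewrite inE; case: (boolP (i.+1 < n)) => //= lin.
apply/existsP/idP => [[j /andP[/eqP ji]]|h].
  by rewrite (_ : j = ordS i) //; apply: ord_inj; rewrite ji val_ordS.
by exists (ordS i); rewrite val_ordS // eqxx.
Qed.

Definition sw (i : 'I_n) (g : {ffun 'I_n -> cellT la}) : {ffun 'I_n -> cellT la} :=
  [ffun k => g (tperm i (ordS i) k)].

Lemma sw_sw i g : sw i (sw i g) = g.
Proof. by apply/ffunP=> k; rewrite !ffunE tpermK. Qed.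

Lemma swL i g : sw i g i = g (ordS i).
Proof. by rewrite ffunE tpermL. Qed.

Lemma swR i g : sw i g (ordS i) = g i.
Proof. by rewrite ffunE tpermR. Qed.

Lemma swD i g k : k != i -> k != ordS i -> sw i g k = g k.
Proof. by move=> h1 h2; rewrite ffunE tpermD // eq_sym. Qed.

Lemma tperm_adj_lt (i p q : 'I_n) : i.+1 < n ->
  tperm i (ordS i) p < tperm i (ordS i) q ->
  ~ (p = ordS i /\ q = i) -> p < q.
Proof.
move=> lin; have e := val_ordS lin.
have vne (a b : 'I_n) : a <> b -> (a : nat) <> b by move=> h /ord_inj.
case: tpermP => [->|->|/vne p1 /vne p2]; case: tpermP => [->|->|/vne q1 /vne q2] h N;
  move: h; rewrite ?e; try lia.
by case: N.
Qed.

(** Consecutive entries in one row or column occupy adjacent cells, so exchanging them destroys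
    standardness; in any other position no order relation between cells involves the exchanged
    pair. *)
Lemma is_syt_sw (i : 'I_n) g : is_syt n la mu g -> i.+1 < n ->
  is_syt n la mu (sw i g) = ((g i).1 != (g (ordS i)).1 :> nat) && ((g i).2 != (g (ordS i)).2 :> nat).
Proof.
move=> sg lin; have e := val_ordS lin; apply/idP/andP => [ssg|[r c]].
  split; apply/eqP => E.
    have := syt_row_adj sg E e; have := @syt_row_adj (sw i g) ssg i (ordS i).
    by rewrite swL swR E => /(_ erefl e); lia.
  have := syt_col_adj sg E e; have := @syt_col_adj (sw i g) ssg i (ordS i).
  by rewrite swL swR E => /(_ erefl e); lia.
have [h1 h2 h3 h4 h5] := sytP _ sg; apply/sytP; split.
- by move=> k; rewrite ffunE.
- by move=> x /h2[k <-]; exists (tperm i (ordS i) k); rewrite ffunE tpermK.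
- by move=> k l; rewrite !ffunE => /h3 /perm_inj.
- move=> p q; rewrite !ffunE => E /(h4 _ _ E) /(tperm_adj_lt lin); apply; case=> pE qE; subst p q.
  by move: E r; rewrite tpermL tpermR => -> /eqP.
- move=> p q; rewrite !ffunE => E /(h5 _ _ E) /(tperm_adj_lt lin); apply; case=> pE qE; subst p q.
  by move: E c; rewrite tpermL tpermR => -> /eqP.
Qed.

End SkewTableaux.

(** * Young's seminormal representation *)

(* A word in involutive braid generators u_0, ..., u_(m-1): the "Coxeter element"
   w = u_0 ... u_(m-1) conjugates u_k to u_(k+1), and closes up after one more step. *)
Section CoxeterElement.
Variables (M : Type) (op : M -> M -> M) (e : M) (u : nat -> M) (m : nat).
Local Notation "x ** y" := (op x y) (at level 40, left associativity).
Hypotheses (opA : associative op) (op1x : left_id e op) (opx1 : right_id e op).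
Hypothesis uu : forall k, k < m -> u k ** u k = e.
Hypothesis braid : forall k, k.+1 < m -> u k ** u k.+1 ** u k = u k.+1 ** u k ** u k.+1.
Hypothesis comm : forall k l, k.+1 < l < m -> u k ** u l = u l ** u k.

Fixpoint cox j k := if k is k'.+1 then u j ** cox j.+1 k' else e.

Lemma coxD j k l : cox j (k + l) = cox j k ** cox (j + k) l.
Proof. by elim: k j => [|k IH] j /=; rewrite ?op1x ?addn0 // IH opA addSnnS. Qed.

Lemma cox_comm_lo i j k : i.+1 < j -> j + k <= m -> u i ** cox j k = cox j k ** u i.
Proof.
elim: k j => [|k IH] j ij jk /=; first by rewrite op1x opx1.
rewrite opA comm; last lia.
by rewrite -!opA IH //; lia.
Qed.

Lemma cox_comm_hi i j k : j + k < i < m -> cox j k ** u i = u i ** cox j k.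
Proof.
elim: k j => [|k IH] j h /=; first by rewrite op1x opx1.
rewrite -opA IH; last lia.
by rewrite !opA comm //; lia.
Qed.

Lemma cox_shift k : k.+1 < m -> cox 0 m ** u k = u k.+1 ** cox 0 m.
Proof.
move=> km; have -> : m = k + (2 + (m - k - 2)) by lia.
rewrite !coxD /= opx1 add0n opA.
rewrite -!opA -cox_comm_lo; try lia.
rewrite (opA (u k.+1) (u k)) (opA (u k)) (opA (u k)) braid // !opA; congr (_ ** _).
congr (_ ** _); congr (_ ** _); apply: cox_comm_hi; lia.
Qed.

Fixpoint rcox j k := if k is k'.+1 then rcox j.+1 k' ** u j else e.

Lemma cox_rcox j k : j + k <= m -> cox j k ** rcox j k = e.
Proof.
elim: k j => [|k IH] j jk /=; first by rewrite op1x.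
rewrite -opA (opA (cox _ _)) IH; last lia.
by rewrite op1x uu //; lia.
Qed.

Lemma rcox_cox j k : j + k <= m -> rcox j k ** cox j k = e.
Proof.
elim: k j => [|k IH] j jk /=; first by rewrite op1x.
rewrite -opA (opA (u j)) uu; last lia.
by rewrite op1x IH //; lia.
Qed.

(** Conjugation by the square of the Coxeter element takes the last generator to [u 0]; hence one
    further conjugate of the last generator closes the chain into a cycle. *)
Lemma cox_close : 0 < m -> u 0 ** (cox 0 m ** cox 0 m) = cox 0 m ** cox 0 m ** u m.-1.
Proof.
move=> m0.
(* The generators of a prefix are moved across the Coxeter element one at a time by [cox_shift]. *)
have key k : k < m -> cox 0 m ** cox 0 k = cox 1 k ** cox 0 m.
  elim: k => [|k IH] km; first by rewrite op1x opx1.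
  rewrite -[k.+1]addn1 !coxD /= !opx1 opA IH ?(ltnW km) // -!opA; congr (_ ** _).
  by rewrite add0n add1n cox_shift.
have E : cox 0 m ** cox 0 m = cox 1 m.-1 ** cox 0 m ** u m.-1.
  have {2}-> : m = m.-1 + 1 by lia.
  by rewrite coxD opA key /= ?opx1 // prednK.
have E0 : u 0 ** cox 1 m.-1 = cox 0 m by rewrite -{2}(prednK m0).
by rewrite {1}E 2!opA E0.
Qed.

End CoxeterElement.

Lemma ordS_neq n (i : 'I_n) : (i.+1 < n)%N -> i != ordS i.
Proof. by move=> h; apply/eqP=> /(congr1 val); rewrite /= modn_small //; lia. Qed.

Lemma ordS_val_neq n (i j : 'I_n) : (i : nat) <> j -> i != j.
Proof. by move=> h; apply/eqP=> /(congr1 val). Qed.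

Section Seminormal.
Import GRing.Theory Num.Theory.
Local Open Scope ring_scope.
Variables (n : nat) (la mu : seq nat).
Hypotheses (pla : is_partition la) (pmu : is_partition mu).
Local Notation G := {ffun 'I_n -> cellT la}.
Local Notation Tab := (SYT n la mu).
Local Notation V := {ffun Tab -> rat^o}.
Local Notation std := (is_syt n la mu).

Definition content (x : cellT la) : rat := (x.2 : nat)%:R - (x.1 : nat)%:R.
Definition lexlt (x y : cellT la) : bool :=
  ((x.1 < y.1) || (x.1 == y.1 :> nat) && (x.2 < y.2))%N.

Lemma lexlt_total (x y : cellT la) : x != y -> lexlt y x = ~~ lexlt x y.
Proof.
move=> xy; rewrite /lexlt; case: (ltngtP x.1 y.1) => //= r.
case: (ltngtP x.2 y.2) => //= c; by rewrite (cell_eq r c) eqxx in xy.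
Qed.

Lemma content_eq (x y : cellT la) : (content x == content y) = (x.1 + y.2 == y.1 + x.2)%N.
Proof. rewrite /content subr_eq addrAC eq_sym subr_eq -!natrD eqr_nat /=; apply/eqP/eqP; lia. Qed.

Definition axial (x y : cellT la) : rat := (content y - content x)^-1.
(** The product over the two orders of a pair is [1 - axial x y ^+ 2]. Splitting it as one times the
    rest, instead of evenly, avoids square roots. *)
Definition swcoef (x y : cellT la) : rat :=
  if lexlt x y then 1 else 1 - axial x y ^+ 2.

Lemma axialN x y : axial y x = - axial x y.
Proof. by rewrite /axial -[content x - _]opprB invrN. Qed.

Lemma swcoefM x y : x != y -> swcoef x y * swcoef y x = 1 - axial x y ^+ 2.
Proof.
move=> xy; rewrite /swcoef (lexlt_total xy); case: (lexlt x y) => /=.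
  by rewrite mul1r axialN sqrrN.
by rewrite mulr1.
Qed.

(* the rational Yang-Baxter equation *)
Lemma axial_YB x y z : content x != content y -> content y != content z -> content x != content z ->
  axial x y * axial y z = axial x z * (axial x y + axial y z).
Proof.
rewrite /axial; move: (content x) (content y) (content z) => a b c ab bc ac.
by field; rewrite !subr_eq0 ![_ == a]eq_sym ?[c == b]eq_sym ab bc ac.
Qed.

Definition ext (f : V) (g : G) : rat := if insub g is Some T then f T else 0.

Lemma ext_val f (T : Tab) : ext f (val T) = f T.
Proof. by rewrite /ext valK. Qed.

Lemma ext_std f g (sg : std g) : ext f g = f (Sub g sg : Tab).
Proof. by rewrite /ext (insubT _ sg). Qed.

Lemma ext_nstd f g : ~~ std g -> ext f g = 0.
Proof. by move=> ng; rewrite /ext insubN. Qed.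

Definition tau (i : 'I_n) (f : V) : V :=
  [ffun T : Tab => axial (val T i) (val T (ordS i)) * f T
                  + swcoef (val T i) (val T (ordS i)) * ext f (sw i (val T))].

Lemma extD (f h : V) g : ext (f + h) g = ext f g + ext h g.
Proof. by rewrite /ext; case: insub => [T|]; rewrite ?addr0 // ffunE. Qed.

Lemma extZ (c : rat) (f : V) g : ext (c *: f) g = c * ext f g.
Proof. by rewrite /ext; case: insub => [T|]; rewrite ?mulr0 // ffunE. Qed.

Lemma tau_linear i : linear (tau i).
Proof.
move=> c f h; apply/ffunP=> T; rewrite !ffunE extD extZ.
rewrite /GRing.scale /=; ring.
Qed.

HB.instance Definition _ i := GRing.isLinear.Build rat V V _ (tau i) (tau_linear i).

Lemma syt_neq g i j : std g -> i != j -> g i != g j.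
Proof. by move=> sg; apply: contraNneq => /(syt_inj sg)->. Qed.

(** If [g] is not standard but [sw i g] is, the two entries sit in adjacent cells, the axial term is
    1 or -1, and the coefficient vanishes. So the defining formula survives extension by zero, and
    compositions of the operators expand without case distinctions. *)
Lemma ext_tau (i : 'I_n) f g : (i.+1 < n)%N ->
  ext (tau i f) g = axial (g i) (g (ordS i)) * ext f g
                  + swcoef (g i) (g (ordS i)) * ext f (sw i g).
Proof.
move=> lin; case: (boolP (std g)) => [sg|ng].
  by rewrite !(ext_std _ sg) ffunE /=.
rewrite !(ext_nstd _ ng) mulr0 add0r.
case: (boolP (std (sw i g))) => [sh|nh]; last by rewrite (ext_nstd _ nh) mulr0.
suff -> : swcoef (g i) (g (ordS i)) = 0 by rewrite mul0r.
set h := sw i g in sh; have gE : g = sw i h by rewrite sw_sw.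
have := is_syt_sw pla pmu sh lin; rewrite -gE (negPf ng) gE swL swR => /esym/negbT.
rewrite negb_and !negbK /swcoef /lexlt; have e := val_ordS lin.
case/orP=> /eqP E.
  have c := syt_row_adj pla pmu sh E e.
  rewrite E ltnn eqxx c ltnNge leqnSn /=.
  rewrite /axial /content E c -natr1.
  rewrite (_ : _ - _ - _ = -1) ?invrN1 ?sqrrN ?expr1n ?subrr //; ring.
have c := syt_col_adj pla pmu sh E e.
rewrite c ltnNge leqnSn /= gtn_eqF //=.
rewrite /axial /content E c -natr1.
rewrite (_ : _ - _ - _ = 1) ?invr1 ?expr1n ?subrr //; ring.
Qed.

Lemma tau_inv (i : 'I_n) f : (i.+1 < n)%N -> tau i (tau i f) = f.
Proof.
move=> lin; apply/ffunP=> T; rewrite -[LHS]ext_val -[RHS]ext_val.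
rewrite !ext_tau // sw_sw swL swR.
have := swcoefM (syt_neq (valP T) (ordS_neq lin)).
rewrite (axialN (val T i)); move: (axial _ _) (swcoef _ _) (swcoef _ _) => a b b' bb.
have bb' : a ^+ 2 = 1 - b * b' by rewrite mulrC bb; ring.
rewrite mulrDr !mulrA -expr2 bb'; ring.
Qed.

Lemma tau_comm (i j : 'I_n) f : (i.+1 < j)%N -> (j.+1 < n)%N -> tau i (tau j f) = tau j (tau i f).
Proof.
move=> ij ljn; have lin : (i.+1 < n)%N by lia.
have ei := val_ordS lin; have ej := val_ordS ljn.
have d1 : i != j by apply: ordS_val_neq; lia.
have d2 : i != ordS j by apply: ordS_val_neq; lia.
have d3 : ordS i != j by apply: ordS_val_neq; lia.
have d4 : ordS i != ordS j by apply: ordS_val_neq; lia.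
apply/ffunP=> T; rewrite -[LHS]ext_val -[RHS]ext_val; set g := val T.
rewrite (ext_tau (tau j f) g lin) (ext_tau f g ljn) (ext_tau f (sw i g) ljn).
rewrite (ext_tau (tau i f) g ljn) (ext_tau f g lin) (ext_tau f (sw j g) lin).
rewrite (swD g d1 d2) (swD g d3 d4) (@swD _ _ i g j) 1?eq_sym // (@swD _ _ i g (ordS j)) 1?eq_sym //.
have -> : sw j (sw i g) = sw i (sw j g).
  apply/ffunP=> k; case: (eqVneq k i) => [->|ki].
    by rewrite (swD _ d1 d2) !swL swD.
  case: (eqVneq k (ordS i)) => [->|ki'].
    by rewrite (swD _ d3 d4) !swR swD.
  rewrite [RHS]swD //; case: (eqVneq k j) => [->|kj].
    by rewrite !swL swD 1?eq_sym.
  case: (eqVneq k (ordS j)) => [->|kj'].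
    by rewrite !swR swD 1?eq_sym.
  by rewrite !swD.
ring.
Qed.

(** Both sides expand over the six arrangements of three consecutive entries; the coefficients agree
    by the Yang-Baxter equation and the product rule [swcoefM]. *)
Lemma tau_braid (i j : 'I_n) f : j = i.+1 :> nat -> (j.+1 < n)%N ->
  tau i (tau j (tau i f)) = tau j (tau i (tau j f)).
Proof.
move=> ji ljn; have lin : (i.+1 < n)%N by lia.
have ei := val_ordS lin; have ej := val_ordS ljn.
have jE : ordS i = j by apply: ord_inj; rewrite ei.
apply/ffunP=> T; rewrite -[LHS]ext_val -[RHS]ext_val.
set g := val T; have sg : std g := valP T.
have d1 : i != j by apply: ordS_val_neq; lia.
have d2 : i != ordS j by apply: ordS_val_neq; lia.
have d3 : j != ordS j by apply: ordS_val_neq; lia.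
set k := ordS j.
have iL (h : G) : sw i h i = h j by rewrite swL jE.
have iR (h : G) : sw i h j = h i by rewrite -jE swR.
have iD (h : G) : sw i h k = h k by rewrite swD // ?jE eq_sym.
have jL (h : G) : sw j h j = h k by rewrite swL.
have jR (h : G) : sw j h k = h j by rewrite swR.
have jD (h : G) : sw j h i = h i by rewrite swD.
have w0 : sw i (sw j (sw i g)) = sw j (sw i (sw j g)).
  apply/ffunP=> z; case: (eqVneq z i) => [->|zi]; first by rewrite !(iL, iR, iD, jL, jR, jD).
  case: (eqVneq z j) => [->|zj]; first by rewrite !(iL, iR, iD, jL, jR, jD).
  case: (eqVneq z k) => [->|zk]; first by rewrite !(iL, iR, iD, jL, jR, jD).
  by rewrite !swD // ?jE.
have ti F h : ext (tau i F) h = axial (h i) (h j) * ext F h + swcoef (h i) (h j) * ext F (sw i h).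
  by rewrite ext_tau // jE.
have tj F h : ext (tau j F) h = axial (h j) (h k) * ext F h + swcoef (h j) (h k) * ext F (sw j h).
  by rewrite ext_tau.
have ii (h : G) : sw i (sw i h) = h := sw_sw i h.
have jj (h : G) : sw j (sw j h) = h := sw_sw j h.
have c1 : content (g i) != content (g j).
  by rewrite content_eq; apply/eqP=> /(syt_diag pla pmu sg); lia.
have c2 : content (g j) != content (g k).
  by rewrite content_eq; apply/eqP=> /(syt_diag pla pmu sg); rewrite /k; lia.
have c3 : content (g i) != content (g k).
  by rewrite content_eq; apply/eqP=> /(syt_diag pla pmu sg); rewrite /k; lia.
have YB := axial_YB c1 c2 c3.
have b1 := swcoefM (syt_neq sg d1); have b2 := swcoefM (syt_neq sg d3); rewrite -/k in b2.
have a1 := axialN (g i) (g j); have a2 := axialN (g j) (g k).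
clear d2 d3.
move: k (sw i) (sw j) (tau i) (tau j) iL iR iD jL jR jD w0 ti tj ii jj c1 c2 c3 YB b1 b2 a1 a2.
move=> k si sj Ti Tj iL iR iD jL jR jD w0 ti tj ii jj _ _ _ YB b1 b2 a1 a2.
rewrite ti !tj !ti !tj.
rewrite ?jL ?jR ?jD ?iL ?iR ?iD ?jL ?jR ?jD ?iL ?iR ?iD ii jj w0 a1 a2.
move: YB b1 b2 {a1 a2 ti tj w0}.
move: (axial (g i) (g j)) (axial (g j) (g k)) (axial (g i) (g k)) => a b c.
move: (ext f _) (ext f _) (ext f _) (ext f (sj g)) (ext f (si g)) (ext f g) => e1 e2 e3 e4 e5 e6.
move: (swcoef (g i) (g j)) (swcoef (g j) (g i)) (swcoef (g j) (g k)) (swcoef (g k) (g j)).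
move: (swcoef _ _) => r p p' q q' YB /eqP + /eqP.
rewrite -subr_eq0 => /eqP P; rewrite -subr_eq0 => /eqP Q.
apply/eqP; rewrite -subr_eq0; apply/eqP.
(* Explicit cofactors: the difference of the two sides lies in the ideal generated by the
   Yang-Baxter relation and the two product relations. *)
match goal with |- ?L = 0 => have -> : L =
  e6 * ((a - b) * (a * b - c * (a + b)) + c * (p * p' - (1 - a ^+ 2)) - c * (q * q' - (1 - b ^+ 2)))
  + (e5 * p - e4 * q) * (a * b - c * (a + b)) by ring end.
by rewrite P Q YB; ring.
Qed.

End Seminormal.

(** * Ranks in a finite totally ordered set *)

Section Rank.
Variables (X : finType) (C : {set X}) (lt : rel X).
Hypothesis lt_irr : irreflexive lt.
Hypothesis lt_trans : transitive lt.
Hypothesis lt_total : {in C &, forall x y, x != y -> lt x y || lt y x}.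

Definition rank (x : X) : nat := #|[set y in C | lt y x]|.

Lemma rank_lt x y : x \in C -> lt x y -> rank x < rank y.
Proof.
move=> xC xy; apply: proper_card; apply/properP; split.
  by apply/subsetP=> z; rewrite !inE => /andP[-> /lt_trans]; apply.
by exists x; rewrite !inE xC ?xy // lt_irr.
Qed.

Lemma rank_bound x : x \in C -> rank x < #|C|.
Proof.
move=> xC; apply: proper_card; apply/properP; split.
  by apply/subsetP=> z; rewrite inE => /andP[].
by exists x; rewrite // inE lt_irr andbF.
Qed.

Lemma rank_ltE : {in C &, forall x y, (rank x < rank y) = lt x y}.
Proof.
move=> x y xC yC; apply/idP/idP; last exact: rank_lt.
move=> r; have [E|xy] := eqVneq x y; first by rewrite E ltnn in r.
by case/orP: (lt_total xC yC xy) => // /(rank_lt yC); lia.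
Qed.

Lemma rank_inj : {in C &, injective rank}.
Proof.
move=> x y xC yC E; apply/eqP; apply: contraT => xy.
by case/orP: (lt_total xC yC xy) => /rank_lt; rewrite E ltnn => ->.
Qed.

Lemma rank_onto k : k < #|C| -> exists2 x, x \in C & rank x = k.
Proof.
move=> kC; have C0 : 0 < #|C| by apply: leq_ltn_trans kC.
pose f x : 'I_#|C|.-1.+1 := inord (rank x).
have fE x : x \in C -> f x = rank x :> nat by move=> xC; rewrite inordK // prednK // rank_bound.
have f_inj : {in C &, injective f}.
  by move=> x y xC yC /(congr1 val); rewrite /= !fE //; apply: rank_inj.
have /setP/(_ (inord k)) : [set f i | i in C] = setT.
  by apply/eqP; rewrite eqEcard subsetT /= card_in_imset // cardsT card_ord prednK.
rewrite inE => /imsetP[x xC /(congr1 val)] /=; rewrite fE // inordK ?prednK // => E.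
by exists x.
Qed.

End Rank.

Lemma increasing_ord_id n (s : 'I_n -> 'I_n) :
  {homo s : i j / i < j} -> forall i, s i = i.
Proof.
move=> s_inc.
have ge k : forall i : 'I_n, i = k :> nat -> k <= s i.
  elim: k => // k IH i ik; have kn : k < n by have := ltn_ord i; lia.
  have := IH (Ordinal kn) erefl; have := @s_inc (Ordinal kn) i; rewrite ik ltnSn => /(_ isT); lia.
have le k : forall i : 'I_n, i + k = n.-1 -> s i <= i.
  elim: k => [|k IH] i ik; first by have := ltn_ord (s i); lia.
  have kn : i.+1 < n by lia.
  have := IH (Ordinal kn); have := @s_inc i (Ordinal kn); rewrite /= ltnSn => /(_ isT); lia.
move=> i; apply: ord_inj; apply/eqP; rewrite eqn_leq (ge i) // (le (n.-1 - i)) //.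
by have := ltn_ord i; lia.
Qed.

(** * Interval blocks of entries and the row potential *)

Section Blocks.
Variables (n : nat) (la : seq nat).

(* [blk D k] numbers the block of [k] in the interval partition cut out by [D]. *)
Definition blk (D : {set 'I_n}) (k : 'I_n) : nat := #|[set d in D | d < k]|.

Lemma blk_le D (i j : 'I_n) : i <= j -> blk D i <= blk D j.
Proof.
move=> ij; apply: subset_leq_card; apply/subsetP=> d; rewrite !inE => /andP[-> di] /=.
exact: leq_trans ij.
Qed.

Lemma blk_ordS D (i : 'I_n) : i.+1 < n -> blk D (ordS i) = (i \in D) + blk D i.
Proof.
move=> lin; rewrite /blk; have -> : [set d in D | d < ordS i] = [set d in D | d < i] :|: (D :&: [set i]).
  apply/setP=> d; rewrite !inE val_ordS // ltnS leq_eqVlt -val_eqE /=.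
  by case: (d \in D) => //=; rewrite orbC.
rewrite cardsU (_ : [set d in D | d < i] :&: _ = set0) ?cards0 ?subn0; last first.
  by apply/setP=> d; rewrite !inE; apply/negP=> /andP[/andP[_ h] /andP[_ /eqP e]]; rewrite e ltnn in h.
rewrite addnC; congr (_ + _); case: (boolP (i \in D)) => iD.
  by rewrite (setIidPr _) ?cards1 // sub1set.
rewrite (_ : _ :&: _ = set0) ?cards0 //; apply/setP=> d; rewrite !inE.
by apply/negP=> /andP[+ /eqP dE]; rewrite dE (negPf iD).
Qed.

Lemma blk_in D (i j d : 'I_n) : blk D i = blk D j -> d \in D -> i <= d -> d < j -> False.
Proof.
move=> e dD id dj; suff : blk D i < blk D j by rewrite e ltnn.
apply: proper_card; apply/properP; split.
  apply/subsetP=> z; rewrite !inE => /andP[-> zi] /=; lia.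
by exists d; rewrite !inE dD /= ?dj // -leqNgt.
Qed.

(** For tableaux of one shape: merging the entries of each block of [D] into a single letter makes
    the two fillings equal. *)
Definition agree (D : {set 'I_n}) (g h : {ffun 'I_n -> cellT la}) : bool :=
  [forall i, forall j, (g i == h j) ==> (blk D i == blk D j)].

Lemma agreeP (D : {set 'I_n}) (g h : {ffun 'I_n -> cellT la}) : reflect (forall i j, g i = h j -> blk D i = blk D j) (agree D g h).
Proof.
apply: (iffP forallP) => H i => [j e|].
  by have /forallP/(_ j)/implyP := H i; rewrite e => /(_ (eqxx _))/eqP.
by apply/forallP=> j; apply/implyP=> /eqP/H->.
Qed.

Lemma agree_sw (D : {set 'I_n}) g h (k : 'I_n) : k.+1 < n -> k \notin D -> agree D g (sw k h) = agree D g h.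
Proof.
move=> lk kD; have bk : blk D (ordS k) = blk D k by rewrite blk_ordS // (negPf kD).
have bt j : blk D (tperm k (ordS k) j) = blk D j by case: tpermP => [->|->|].
apply/agreeP/agreeP => H i j.
  move=> e; rewrite -(bt j); apply: H.
  by rewrite ffunE tpermK.
by rewrite ffunE => /H; rewrite bt.
Qed.

(** An induction measure: it drops when [k] and [k+1] are exchanged while [k+1] lies lower, by
    [rowpot_sw]. *)
Definition rowpot (g : {ffun 'I_n -> cellT la}) : nat := \sum_(i < n) i * (g i).1.

Lemma rowpot_sw (g : {ffun 'I_n -> cellT la}) (k : 'I_n) : k.+1 < n -> (g k).1 < (g (ordS k)).1 ->
  rowpot (sw k g) < rowpot g.
Proof.
move=> lk h; have kk := ordS_neq lk; have e := val_ordS lk.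
rewrite /rowpot (bigD1 k) //= (bigD1 (ordS k)) 1?eq_sym //=.
rewrite [X in _ < X](bigD1 k) //= [X in _ < _ + X](bigD1 (ordS k)) 1?eq_sym //=.
rewrite swL swR addnA [X in _ < X]addnA.
rewrite (eq_bigr (fun i : 'I_n => i * (g i).1)) => [|i /andP[ik ik']]; last by rewrite swD.
by rewrite ltn_add2r modn_small //; nia.
Qed.

End Blocks.

(** * Blocks of a tableau as horizontal strips *)

Section BlocksOfTableaux.
Variables (n : nat) (la mu : seq nat).
Hypotheses (pla : is_partition la) (pmu : is_partition mu).
Local Notation Tab := (SYT n la mu).

(** Without a descent inside a block its entries never move down, and then monotonicity forces them
    to move right: each block fills a horizontal strip. *)
Lemma syt_strip (T : Tab) (D : {set 'I_n}) (i j : 'I_n) : DesT T \subset D -> i < j -> blk D i = blk D j ->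
  (val T j).1 <= (val T i).1 /\ (val T i).2 < (val T j).2.
Proof.
move=> sD ij e.
have row : (val T j).1 <= (val T i).1.
  have [k jE] : exists k, j = i + k :> nat by exists (j - i); lia.
  elim: k j jE {ij} e => [|k IH] j jE e; first by rewrite (_ : j = i) //; apply: ord_inj; lia.
  have kn : i + k < n by have := ltn_ord j; lia.
  set j' := Ordinal kn; have jj : j = ordS j'.
    by apply: ord_inj; rewrite val_ordS /=; have := ltn_ord j; lia.
  have lj : j'.+1 < n by have := ltn_ord j; rewrite /= jE; lia.
  have b1 : blk D i <= blk D j' by apply: blk_le; rewrite /=; lia.
  have b2 : blk D j' <= blk D j by apply: blk_le; rewrite /=; lia.
  apply: leq_trans (IH j' erefl _); last by apply/eqP; rewrite eqn_leq b1 /=; lia.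
  rewrite leqNgt; apply/negP=> h.
  have j'D : j' \in D by apply: (subsetP sD); rewrite DesTE lj -jj.
  by apply: (@blk_in _ D i j j') => //=; lia.
split=> //; rewrite ltnNge; apply/negP=> c.
have : j < i by apply: (syt_mono pla pmu (valP T)) => //; rewrite neq_ltn ij orbT.
by lia.
Qed.

Lemma agree_refl (D : {set 'I_n}) (T : Tab) : agree D (val T) (val T).
Proof. by apply/agreeP=> i j /(syt_inj (valP T)) ->. Qed.

(** The cells of [k] and [k+1] in [T'] belong to one block of [T], hence to one horizontal strip,
    which has at most one cell in each column. *)
Lemma agree_diff_col (T T' : Tab) (D : {set 'I_n}) (k : 'I_n) : DesT T \subset D -> k.+1 < n -> k \notin D ->
  agree D (val T) (val T') -> (val T' k).2 != (val T' (ordS k)).2 :> nat.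
Proof.
move=> sD lk kD /agreeP ag.
have [_ onto _ _ _] := sytP _ _ (valP T).
have [i iE] := onto _ (syt_cellb (valP T') k).
have [j jE] := onto _ (syt_cellb (valP T') (ordS k)).
have bij : blk D i = blk D j.
  by rewrite (ag _ _ iE) (ag _ _ jE) blk_ordS // (negPf kD).
rewrite -iE -jE; case: (ltngtP i j) => ij.
- by have [_] := syt_strip sD ij bij; rewrite neq_ltn => ->.
- by have [_] := syt_strip sD ij (esym bij); rewrite neq_ltn orbC => ->.
move/ord_inj: ij => ij; subst j; have := syt_inj (valP T') (etrans (esym iE) jE).
by move/(congr1 val); rewrite /= modn_small //; lia.
Qed.

(** Both tableaux fill every strip from left to right, so the map matching their entries cell by
    cell is increasing, hence the identity. *)
Lemma agree_unique (T T' : Tab) (D : {set 'I_n}) : DesT T \subset D -> DesT T' \subset D ->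
  agree D (val T) (val T') -> T' = T.
Proof.
move=> sD sD' /agreeP ag.
have [_ onto _ _ _] := sytP _ _ (valP T').
have sx i : exists j, val T' j == val T i.
  by have [j jE] := onto _ (syt_cellb (valP T) i); exists j; apply/eqP.
pose s i := xchoose (sx i); have sE i : val T' (s i) = val T i by apply/eqP/(xchooseP (sx i)).
have bs i : blk D i = blk D (s i) by apply: ag; rewrite sE.
have sid : forall i, s i = i.
  apply: increasing_ord_id => i j ij; rewrite ltnNge; apply/negP=> ji.
  have bji : blk D (s j) <= blk D (s i) by apply: blk_le.
  have bij : blk D i <= blk D j by apply: blk_le; exact: ltnW.
  have be : blk D i = blk D j by have := bs i; have := bs j; lia.
  have [_ c] := syt_strip sD ij be.
  have se : s j != s i.
    apply/eqP=> e; have := sE i; rewrite -e sE => /(syt_inj (valP T)) e'.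
    by rewrite e' ltnn in ij.
  have lt : s j < s i by rewrite ltn_neqAle ji andbT; apply: contra se => /eqP/ord_inj->.
  have [_] := syt_strip sD' lt (etrans (esym (bs j)) (etrans (esym be) (bs i))).
  by rewrite !sE; lia.
by apply: val_inj; apply/ffunP=> i; rewrite -[i in LHS]sid sE.
Qed.

(** Exchanging a descent of [T'] that is not in [D] preserves the blocks and lowers the potential;
    the process can only stop at [T]. *)
Lemma agree_rowpot (T T' : Tab) (D : {set 'I_n}) : DesT T \subset D ->
  agree D (val T) (val T') -> T' != T -> rowpot (val T) < rowpot (val T').
Proof.
move=> sD; have [N] := ubnP (rowpot (val T')); elim: N T' => // N IH T' /ltnSE leN ag TT.
have /subsetPn[k kT' kD] : ~~ (DesT T' \subset D).
  by apply: contra TT => sD'; apply/eqP; apply: agree_unique sD sD' ag.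
move: kT'; rewrite DesTE => /andP[lk h].
have ss : is_syt n la mu (sw k (val T')).
  rewrite (is_syt_sw pla pmu (valP T') lk) (agree_diff_col sD lk kD ag) andbT.
  by rewrite neq_ltn h.
have lt := rowpot_sw lk h; pose T2 : Tab := Sub _ ss.
have v2 : val T2 = sw k (val T') by [].
case: (eqVneq T2 T) => [<-|T2T]; first by rewrite v2.
apply: (ltn_trans _ lt); rewrite -v2; apply: IH => //; last by rewrite v2 agree_sw.
by rewrite v2; apply: leq_trans lt leN.
Qed.

End BlocksOfTableaux.

(** * Vectors fixed by prescribed seminormal generators *)

Section AdaptedVectors.
Import GRing.Theory Num.Theory.
Local Open Scope ring_scope.
Variables (n : nat) (la mu : seq nat).
Hypotheses (pla : is_partition la) (pmu : is_partition mu).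
Local Notation G := {ffun 'I_n -> cellT la}.
Local Notation Tab := (SYT n la mu).
Local Notation V := {ffun Tab -> rat^o}.
Local Notation std := (is_syt n la mu).

Definition invw (b : bool) (x y : cellT la) : rat := if b && lexlt y x then 1 - axial y x else 1.
(** A product over the pairs of entries inverted with respect to [lexlt]. The factors are dictated
    by invariance: an exchange of [k] and [k+1] changes the weight by exactly what [tau k] needs in
    order to fix [bvec]. *)
Definition wt (h : G) : rat := \prod_(p : 'I_n * 'I_n) invw (p.1 < p.2)%N (h p.1) (h p.2).

Lemma lexlt_asym (x y : cellT la) : lexlt x y -> lexlt y x = false.
Proof. by rewrite /lexlt; case: (ltngtP x.1 y.1) => //= _; case: ltngtP. Qed.

(** Relabelling pairs by the transposition permutes all factors except that of the pair [k], [k+1],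
    the one inversion created. *)
Lemma wt_sw (h : G) (k : 'I_n) : (k.+1 < n)%N -> lexlt (h k) (h (ordS k)) ->
  wt (sw k h) = (1 - axial (h k) (h (ordS k))) * wt h.
Proof.
have vne (a b : 'I_n) : a != b -> (a : nat) <> b by move=> /eqP ab /ord_inj.
move=> lk lx; have e := val_ordS lk; rewrite /wt; set t := tperm k (ordS k).
rewrite (reindex_inj (h := fun p : 'I_n * 'I_n => (t p.1, t p.2))) /=; last first.
  by move=> [a b] [c d] [/perm_inj-> /perm_inj->].
rewrite (eq_bigr (fun p : 'I_n * 'I_n => invw (t p.1 < t p.2)%N (h p.1) (h p.2))); last first.
  by move=> p _; rewrite !ffunE !tpermK.
rewrite (bigD1 (ordS k, k)) //= [in RHS](bigD1 (ordS k, k)) //=.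
rewrite /t tpermR tpermL {1 3}/invw lx andbT.
have -> : (k < ordS k)%N by rewrite e.
have -> : (ordS k < k)%N = false by rewrite e; lia.
rewrite /= mul1r; congr (_ * _); apply: eq_bigr => -[p q] /= pq.
case: (eqVneq p k) => [->|pk].
  case: (eqVneq q (ordS k)) => [->|qk].
    by rewrite tpermL tpermR /invw (lexlt_asym lx) !andbF.
  case: (eqVneq q k) => [->|qk']; first by rewrite !ltnn.
  rewrite tpermL tpermD 1?eq_sym //; congr invw.
  by have := vne _ _ qk; have := vne _ _ qk'; rewrite e; lia.
case: (eqVneq p (ordS k)) => [pE|pk'].
  subst p; have qk : q != k by apply: contra pq => /eqP->.
  case: (eqVneq q (ordS k)) => [->|qk']; first by rewrite !ltnn.
  rewrite tpermR tpermD 1?eq_sym //; congr invw.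
  by have := vne _ _ qk; have := vne _ _ qk'; rewrite e; lia.
rewrite [tperm _ _ p]tpermD 1?eq_sym //; congr invw.
by have := vne _ _ pk; have := vne _ _ pk'; rewrite e; case: tpermP => [->|->|//]; rewrite ?e; lia.
Qed.

(** In a standard filling, the larger entry of an inverted pair lies strictly above and strictly to
    the right, so its axial term is negative and the factor exceeds 1. *)
Lemma wt_neq0 h : std h -> wt h != 0.
Proof.
move=> sh; rewrite /wt prodf_seq_neq0; apply/allP=> -[i j] _ /=.
rewrite /invw; case: (boolP (_ && _)) => [|_]; last exact: oner_neq0.
case/andP=> ij lx; rewrite /axial subr_eq0 eq_sym invr_eq1.
have ji : ~ (j < i)%N by lia.
have r : ((h j).1 < (h i).1)%N.
  move: lx; rewrite /lexlt => /orP[//|/andP[/eqP r c]].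
  by case: ji; apply: (syt_row_lt sh).
have c : ((h i).2 < (h j).2)%N.
  rewrite ltnNge; apply/negP=> c; case: ji; apply: (syt_mono pla pmu sh) => //; first exact: ltnW.
  by rewrite eq_sym neq_ltn ij.
move: r c; rewrite -!(ltr_nat rat) /content => r c; apply/eqP; lra.
Qed.

(** A weighted sum over the tableaux obtained from [T] by permuting entries inside the blocks of its
    own descent set. Among these [T] has the least [rowpot], whence the triangularity in
    [bmap_inj]. *)
Definition bvec (T : Tab) : V :=
  [ffun T' : Tab => if agree (DesT T) (val T) (val T') then wt (val T') else 0].

Lemma bvec_fix (T : Tab) (k : 'I_n) : (k.+1 < n)%N -> k \notin DesT T -> tau k (bvec T) = bvec T.
Proof.
move=> lk kD; have e := val_ordS lk; apply/ffunP=> T'; rewrite ffunE.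
set h := val T'; set a := axial _ _.
have sh : std h := valP T'.
case: (boolP (std (sw k h))) => [ss|ns].
  rewrite (ext_std _ ss) !ffunE /= agree_sw // -/h.
  case: ifP => ag; last by rewrite !mulr0 addr0.
  rewrite /swcoef -/a; case: (boolP (lexlt _ _)) => lx.
    by rewrite wt_sw // -/a; ring.
  have lx' : lexlt (sw k h k) (sw k h (ordS k)).
    by rewrite swL swR lexlt_total // (syt_neq sh) // ordS_neq.
  have := wt_sw lk lx'; rewrite sw_sw swL swR axialN -/a => ->; ring.
(* When the exchange is not allowed, the two entries share a row, a common column being excluded by
   [agree_diff_col]; then the diagonal coefficient is 1. *)
rewrite (ext_nstd _ ns) mulr0 addr0 !ffunE -/h; case: ifP => ag; last by rewrite mulr0.
have := ns; rewrite (is_syt_sw pla pmu sh lk).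
rewrite (agree_diff_col pla pmu (subxx _) lk kD ag) andbT negbK => /eqP r.
have c := syt_row_adj pla pmu sh r e.
suff -> : a = 1 by rewrite mul1r.
rewrite /a /axial /content r c -natr1 (_ : _ - _ - _ = 1) ?invr1 //; ring.
Qed.

(** At a descent the axial term [a] is negative, so the fixed-point equation, which equates
    [(1 - a) * f T] with the value after the exchange, forces that value to be nonzero. *)
Lemma fix_step (f : V) (T : Tab) (k : 'I_n) : tau k f = f -> k \in DesT T -> f T != 0 ->
  exists2 T' : Tab, val T' = sw k (val T) & f T' != 0.
Proof.
rewrite DesTE => fk /andP[lk r] fT; set h := val T; have sh : std h := valP T.
have e := val_ordS lk.
have c : ((h (ordS k)).2 <= (h k).2)%N.
  rewrite leqNgt; apply/negP=> c.
  have [j [j1 j2]] : exists j, (h j).1 = (h k).1 :> nat /\ (h j).2 = (h (ordS k)).2 :> nat.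
    apply: (syt_onto pla sh); apply: (inskew_convex pla pmu (syt_cellb sh k) (syt_cellb sh (ordS k))).
      by rewrite leqnn ltnW.
    by rewrite leqnn andbT ltnW.
  have := @syt_row_lt _ _ _ _ sh k j; rewrite j1 j2 => /(_ erefl c).
  have := @syt_col_lt _ _ _ _ sh j (ordS k); rewrite j1 j2 => /(_ erefl r).
  lia.
have lx : lexlt (h k) (h (ordS k)) by rewrite /lexlt r.
have : f T = axial (h k) (h (ordS k)) * f T + ext f (sw k h).
  by rewrite -[LHS](congr1 (fun F : V => F T) fk) ffunE /swcoef -/h lx mul1r.
move=> /eqP; rewrite addrC -subr_eq -[X in X - _]mul1r -mulrBl => /eqP E.
have a1 : 1 - axial (h k) (h (ordS k)) != 0.
  rewrite subr_eq0 eq_sym invr_eq1; move: r c.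
  by rewrite -(ltr_nat rat) -(ler_nat rat) /content => r c; apply/eqP; lra.
have : ext f (sw k h) != 0 by rewrite -E mulf_neq0.
case: (boolP (std (sw k h))) => [ss|ns]; last by rewrite (ext_nstd _ ns) eqxx.
by rewrite (ext_std _ ss); exists (Sub _ ss).
Qed.

(** Exchanging a descent outside [I] lowers [rowpot] and keeps the value nonzero, so the support of
    a nonzero fixed [f] reaches a tableau with descents inside [I]. This bounds the dimension of the
    fixed space from above. *)
Lemma fix_vanish (I : {set 'I_n}) (f : V) :
    (forall k : 'I_n, k \notin I -> (k.+1 < n)%N -> tau k f = f) ->
    (forall T, DesT T \subset I -> f T = 0) -> f = 0.
Proof.
move=> fI f0; apply/ffunP=> T; rewrite [RHS]ffunE; apply/eqP; apply: contraT.
have [N] := ubnP (rowpot (val T)); elim: N T => // N IH T /ltnSE leN fT.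
have /subsetPn[k kT kI] : ~~ (DesT T \subset I) by apply: contra fT => /f0->.
have lk : (k.+1 < n)%N by move: kT; rewrite DesTE => /andP[].
have r : ((val T k).1 < (val T (ordS k)).1)%N by move: kT; rewrite DesTE => /andP[].
have [T' T'E fT'] := fix_step (fI _ kI lk) kT fT.
by apply: (IH T') => //; rewrite T'E; apply: leq_trans (rowpot_sw lk r) leN.
Qed.

Definition delta (T : Tab) : V := [ffun T' => (T' == T)%:R].
Definition Esp (S : {set Tab}) : {vspace V} := (\sum_(T in S) <[delta T]>)%VS.

Lemma delta_decomp (v : V) : v = \sum_T v T *: delta T.
Proof.
apply/ffunP=> T; rewrite sum_ffunE (bigD1 T) //= big1 ?addr0 => [|T' T'T].
  by rewrite !ffunE eqxx /GRing.scale /= mulr1.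
by rewrite !ffunE eq_sym (negPf T'T) /GRing.scale /= mulr0.
Qed.

Lemma EspP (S : {set Tab}) (v : V) : reflect (forall T, T \notin S -> v T = 0) (v \in Esp S).
Proof.
apply: (iffP idP) => [/memv_sumP[u uS ->] T TS|H].
  rewrite sum_ffunE big1 // => T' T'S; have /vlineP[c ->] := uS _ T'S.
  rewrite !ffunE; case: eqP => [E|_]; last by rewrite /GRing.scale /= mulr0.
  by rewrite E T'S in TS.
rewrite (delta_decomp v); apply: memv_suml => T _; case: (boolP (T \in S)) => TS.
  by apply: memvZ; apply: (subvP (sumv_sup T TS (subvv _))); apply: memv_line.
by rewrite H // scale0r mem0v.
Qed.

Lemma dim_Esp (S : {set Tab}) : \dim (Esp S) = #|S|.
Proof.
have [N] := ubnP #|S|; elim: N S => // N IH S /ltnSE leN.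
case: (set_0Vmem S) => [->|[T TS]]; first by rewrite /Esp big_set0 dimv0 cards0.
have ES : Esp S = (<[delta T]> + Esp (S :\ T))%VS.
  by rewrite /Esp (big_setD1 T).
have cS := cardsD1 T S; rewrite TS in cS.
rewrite ES dimv_disjoint_sum ?IH; last 1 first.
- apply/eqP; rewrite -subv0; apply/subvP=> v /memv_capP[/vlineP[c ->] /EspP/(_ T)].
  rewrite !inE eqxx => /(_ isT) c0; suff -> : c = 0 by rewrite scale0r mem0v.
  by move: c0; rewrite !ffunE eqxx /GRing.scale /= mulr1.
- rewrite dim_vline (_ : delta T != 0) ?cS //.
  apply/eqP=> /ffunP/(_ T); rewrite !ffunE eqxx => /eqP; by rewrite oner_eq0.
- by rewrite cS in leN.
Qed.

End AdaptedVectors.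

(** * The cyclic family of fixed spaces *)

Lemma shiftset_inj n : injective (@shiftset n).
Proof. by apply: imset_inj; apply: can_inj (@ordSK n). Qed.

Lemma mem_shiftset n (J : {set 'I_n}) i : (ordS i \in shiftset J) = (i \in J).
Proof. by rewrite mem_imset //; apply: (can_inj (@ordSK n)). Qed.

Lemma shiftsetD1 n (J : {set 'I_n}) i : shiftset (J :\ i) = shiftset J :\ ordS i.
Proof.
apply/setP=> k; rewrite -[k](ord_predK k) !inE !mem_shiftset !inE.
by rewrite (inj_eq (can_inj (@ordSK n))).
Qed.

Lemma card_ord_lt n k : k <= n -> #|[set i : 'I_n | i < k]| = k.
Proof. by move=> kn; rewrite -sum1dep_card (big_ord_narrow kn) sum1_card card_ord. Qed.

Lemma last_notin_DesT m la mu (T : SYT m.+1 la mu) : ord_max \notin DesT T.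
Proof. by rewrite DesTE ltnn. Qed.

Section CyclicFamily.
Import GRing.Theory Num.Theory.
Local Open Scope ring_scope.
Variables (m : nat) (la mu : seq nat).
Hypotheses (pla : is_partition la) (pmu : is_partition mu) (m_gt0 : (0 < m)%N).
Local Notation n := m.+1.
Local Notation Tab := (SYT n la mu).
Local Notation V := {ffun Tab -> rat^o}.

Definition gen (k : nat) : 'End(V) := linfun (@tau n la mu (inord k)).
Local Notation comp := (@comp_lfun rat V V V).
Definition rotf : 'End(V) := cox comp \1%VF gen 0 m.
Definition rotb : 'End(V) := rcox comp \1%VF gen 0 m.

Let inordK' k : (k < m)%N -> (inord k : 'I_n) = k :> nat.
Proof. by move=> km; rewrite inordK // ltnS ltnW. Qed.

Lemma genK k : (k < m)%N -> (gen k \o gen k = \1)%VF.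
Proof.
move=> km; apply/lfunP=> f; rewrite comp_lfunE id_lfunE /gen !lfunE /= tau_inv //.
by rewrite inordK'.
Qed.

Lemma gen_braid k : (k.+1 < m)%N -> (gen k \o gen k.+1 \o gen k = gen k.+1 \o gen k \o gen k.+1)%VF.
Proof.
move=> km; apply/lfunP=> f; rewrite !comp_lfunE !lfunE /=.
by apply: tau_braid => //; rewrite !inordK' //; lia.
Qed.

Lemma gen_comm k l : (k.+1 < l < m)%N -> (gen k \o gen l = gen l \o gen k)%VF.
Proof.
move=> kl; apply/lfunP=> f; rewrite !comp_lfunE !lfunE /=.
by apply: tau_comm => //; rewrite !inordK' //; lia.
Qed.

Lemma rotfK : (rotf \o rotb = \1)%VF.
Proof.
by apply: (cox_rcox (m := m)) genK _ _ _ => //; [exact: comp_lfunA|exact: comp_lfun1l].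
Qed.

Lemma rotbK : (rotb \o rotf = \1)%VF.
Proof.
by apply: (rcox_cox (m := m)) genK _ _ _ => //; [exact: comp_lfunA|exact: comp_lfun1l].
Qed.

(* the last generator is forced by the requirement that [rotf] rotate the family *)
Definition cgen (i : 'I_n) : 'End(V) :=
  if (i < m)%N then gen i else (rotf \o gen m.-1 \o rotb)%VF.

(** Below the last two indices this is the braid shift, at [m.-1] the definition of the added
    generator, and at the wrap-around [cox_close]. *)
Lemma rot_cgen i : (rotf \o cgen i = cgen (ordS i) \o rotf)%VF.
Proof.
have A := @comp_lfunA rat V V V V; have L := @comp_lfun1l rat V V; have R := @comp_lfun1r rat V V.
case: (ltnP i m) => im; last first.
  have iE : i = m :> nat by have := ltn_ord i; lia.
  have -> : ordS i = ord0 by apply: ord_inj; rewrite /= iE modnn.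
  rewrite /cgen ltnNge im /= m_gt0.
  have C := cox_close A L R gen_braid gen_comm m_gt0; rewrite -/rotf in C.
  by rewrite !comp_lfunA -C -!comp_lfunA rotfK comp_lfun1r.
have e : ordS i = i.+1 :> nat by rewrite val_ordS.
rewrite /cgen im; case: (ltnP i.+1 m) => im'.
  have C := cox_shift A L R gen_braid gen_comm im'; rewrite -/rotf in C.
  by rewrite e im' C.
rewrite e ltnNge im' /= -!comp_lfunA rotbK comp_lfun1r.
by have -> : m.-1 = i by lia.
Qed.

Definition Ufix (I : {set 'I_n}) : {vspace V} := (\bigcap_(i in ~: I) fixedSpace (cgen i))%VS.

Lemma memU (I : {set 'I_n}) v : reflect (forall i, i \notin I -> cgen i v = v) (v \in Ufix I).
Proof.
rewrite memvE; apply: (iffP subv_bigcapP) => H i.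
  move=> iI; have := H i; rewrite inE iI => /(_ isT); rewrite -memvE => /fixedSpaceP//.
by rewrite inE => iI; rewrite -memvE; apply/fixedSpaceP; apply: H.
Qed.

Lemma rotbfv v : rotb (rotf v) = v.
Proof. by have := congr1 (fun f : 'End(V) => f v) rotbK; rewrite comp_lfunE id_lfunE. Qed.

Lemma rotfbv v : rotf (rotb v) = v.
Proof. by have := congr1 (fun f : 'End(V) => f v) rotfK; rewrite comp_lfunE id_lfunE. Qed.

Lemma lker_rotf : lker rotf == 0%VS.
Proof. by apply/lker0P; apply: can_inj rotbfv. Qed.

Lemma rot_cgenv i v : rotf (cgen i v) = cgen (ordS i) (rotf v).
Proof. by have := congr1 (fun f : 'End(V) => f v) (rot_cgen i); rewrite !comp_lfunE. Qed.

Lemma mem_rotU I v : (rotf v \in Ufix (shiftset I)) = (v \in Ufix I).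
Proof.
apply/memU/memU => H i iI.
  by apply: (can_inj rotbfv); rewrite rot_cgenv H // mem_shiftset.
rewrite -[i](ord_predK i) -rot_cgenv H // -mem_shiftset.
by rewrite ord_predK.
Qed.

Lemma rotU I : (rotf @: Ufix I = Ufix (shiftset I))%VS.
Proof.
apply/vspaceP=> v; rewrite -[v](rotfbv) mem_rotU.
apply/memv_imgP/idP => [[u uI /(can_inj rotbfv)->//]|h].
by exists (rotb v).
Qed.

Lemma Ufix_mono (I I' : {set 'I_n}) : I \subset I' -> (Ufix I <= Ufix I')%VS.
Proof.
move=> sI; apply/subvP=> v /memU H; apply/memU=> i iI; apply: H.
by apply: contra iI; apply: (subsetP sI).
Qed.

Lemma memU_last (I : {set 'I_n}) v : ord_max \in I ->
  reflect (forall k : 'I_n, k \notin I -> (k.+1 < n)%N -> tau k v = v) (v \in Ufix I).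
Proof.
move=> lI; apply: (iffP (memU _ _)) => H k kI.
  by move=> lk; have := H k kI; rewrite /cgen -ltnS lk lfunE /= inord_val.
have lk : (k.+1 < n)%N.
  rewrite ltnS ltn_neqAle -ltnS ltn_ord andbT; apply: contra kI => /eqP e.
  by rewrite (_ : k = ord_max) //; apply: ord_inj.
by rewrite /cgen -ltnS lk lfunE /= inord_val H.
Qed.

Definition bmap (y : V) : V := \sum_T y T *: bvec T.

Lemma bmap_linear : linear bmap.
Proof.
move=> c y z; rewrite /bmap scaler_sumr -big_split; apply: eq_bigr => T _ /=.
by rewrite !ffunE scalerDl scalerA.
Qed.

HB.instance Definition _ := GRing.isLinear.Build rat V V _ bmap bmap_linear.

Definition blin : 'End(V) := linfun bmap.

(** Apart from [bvec T] itself, only vectors [bvec T'] with [T'] of smaller [rowpot] contribute at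
    [T], so the value at a support element of least potential survives. *)
Lemma bmap_inj y : bmap y = 0 -> y = 0.
Proof.
move=> E; apply/ffunP=> T; rewrite [RHS]ffunE; apply/eqP; apply: contraT.
have [N] := ubnP (rowpot (val T)); elim: N T => // N IH T /ltnSE leN yT.
have := congr1 (fun f : V => f T) E; rewrite sum_ffunE (bigD1 T) //= big1.
  rewrite addr0 !ffunE agree_refl => /eqP.
  by rewrite mulf_eq0 (negPf yT) (negPf (wt_neq0 pla pmu (valP T))).
move=> T' T'T; rewrite !ffunE; case: ifP => ag; last by rewrite scaler0.
case: (eqVneq (y T') 0) => [->|yT']; first by rewrite scale0r.
exfalso; have lt := agree_rowpot pla pmu (subxx _) ag; rewrite eq_sym T'T in lt.
have /negP := IH T' (leq_trans (lt isT) leN) yT'; exact.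
Qed.

Lemma lker_blin : lker blin == 0%VS.
Proof.
rewrite -subv0; apply/subvP=> v; rewrite memv_ker lfunE /= => /eqP/bmap_inj->.
exact: mem0v.
Qed.

Definition DesIn (I : {set 'I_n}) : {set Tab} := [set T | DesT T \subset I].

Lemma bvec_mem (T : Tab) (I : {set 'I_n}) : ord_max \in I -> DesT T \subset I -> bvec T \in Ufix I.
Proof.
move=> lI sI; apply/(memU_last _ lI) => k kI lk; apply: bvec_fix => //.
by apply: contra kI; apply: (subsetP sI).
Qed.

Definition restr (S : {set Tab}) (v : V) : V := [ffun T => if T \in S then v T else 0].

Lemma restr_linear S : linear (restr S).
Proof.
move=> c y z; apply/ffunP=> T; rewrite !ffunE; case: ifP => //.
by rewrite scaler0 addr0.
Qed.

HB.instance Definition _ S := GRing.isLinear.Build rat V V _ (restr S) (restr_linear S).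

(** The vectors [bvec T] with [DesT T] inside [I] are independent and fixed; conversely restriction
    to these tableaux is injective on the fixed space by [fix_vanish], so the dimensions agree. *)
Lemma Ufix_last (I : {set 'I_n}) : ord_max \in I -> Ufix I = (blin @: Esp (DesIn I))%VS.
Proof.
move=> lI; apply/esym/eqP; rewrite eqEdim; apply/andP; split.
  apply/subvP=> _ /memv_imgP[y /EspP yE ->]; rewrite lfunE /=.
  apply: memv_suml => T _; case: (boolP (T \in DesIn I)) => TI.
    by apply: memvZ; apply: bvec_mem => //; rewrite inE in TI.
  by rewrite yE // scale0r mem0v.
rewrite limg_dim_eq; last by rewrite (eqP lker_blin) capv0.
rewrite -(@limg_dim_eq _ _ _ (linfun (restr (DesIn I))) (Ufix I)); last first.
  apply/eqP; rewrite -subv0; apply/subvP=> v /memv_capP[/(memU_last _ lI) vI].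
  rewrite memv_ker lfunE /= => /eqP r0.
  rewrite (fix_vanish pla pmu vI) ?mem0v // => T TI.
  by have := congr1 (fun f : V => f T) r0; rewrite !ffunE inE TI.
apply: dimvS; apply/subvP=> _ /memv_imgP[v _ ->]; rewrite lfunE /=.
by apply/EspP=> T TI; rewrite ffunE (negPf TI).
Qed.

Lemma memU_coord (I : {set 'I_n}) v : ord_max \in I ->
  (v \in Ufix I) = (blin^-1%VF v \in Esp (DesIn I)).
Proof.
move=> lI; rewrite Ufix_last // -{1}[v](lker0_lfunVK lker_blin) .
apply/memv_imgP/idP => [[u uE /(lker0P lker_blin)->//]|h].
by exists (blin^-1%VF v).
Qed.

(** All sets here contain the last index, so in [bvec] coordinates the spaces are coordinate
    subspaces, for which distributivity is clear. *)
Lemma Ufix_dist_last (j : 'I_n) (Y J : {set 'I_n}) :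
  ord_max \in Y -> j != ord_max -> j \notin J -> ord_max \notin J -> J \subset Y ->
  (Ufix (Y :\ j) :&: \sum_(i in J) Ufix (Y :\ i) <= \sum_(i in J) Ufix (Y :\ i :\ j))%VS.
Proof.
move=> lY jl jJ lJ sJ; apply/subvP=> x /memv_capP[].
rewrite memU_coord ?inE ?lY 1?eq_sym ?jl // => /EspP xj /memv_sumP[x_ x_in xE].
have x_E i : i \in J -> forall T, ~~ (DesT T \subset Y :\ i) -> blin^-1%VF (x_ i) T = 0.
  move=> iJ T TY; have := x_in _ iJ; rewrite memU_coord; last first.
    by rewrite !inE lY andbT; apply: contra lJ => /eqP->.
  by move/EspP; apply; rewrite inE.
rewrite -[x](lker0_lfunVK lker_blin) lfunE /=.
apply: memv_suml => T _.
case: (eqVneq (blin^-1%VF x T) 0) => [->|xT]; first by rewrite scale0r mem0v.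
apply: memvZ.
have Tj : DesT T \subset Y :\ j.
  by apply: contraTT xT => h; rewrite xj ?eqxx // inE.
have [i iJ Ti] : exists2 i, i \in J & DesT T \subset Y :\ i.
  apply/exists_inP; apply: contraTT xT => /exists_inPn H.
  rewrite negbK xE linear_sum sum_ffunE big1 // => i iJ.
  by apply: x_E => //; apply: H.
apply: (subvP (sumv_sup i iJ (subvv _))); apply: bvec_mem.
  by rewrite !inE lY eq_sym jl andbT; apply: contra lJ => /eqP->.
apply/subsetP=> k kT; have := subsetP Tj k kT; have := subsetP Ti k kT.
by rewrite !inE => /andP[-> _] /andP[-> ->].
Qed.

Lemma shiftsetS (A B : {set 'I_n}) : (shiftset A \subset shiftset B) = (A \subset B).
Proof.
apply/subsetP/subsetP=> H k.
  by rewrite -mem_shiftset => /H; rewrite mem_shiftset.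
by rewrite -[k](ord_predK k) !mem_shiftset => /H.
Qed.

(** [rotf] carries the family to its shift, so [l] can be rotated up to the last index. *)
Lemma Ufix_dist (l j : 'I_n) (Y J : {set 'I_n}) :
  l \in Y -> j != l -> j \notin J -> l \notin J -> J \subset Y ->
  (Ufix (Y :\ j) :&: \sum_(i in J) Ufix (Y :\ i) <= \sum_(i in J) Ufix (Y :\ i :\ j))%VS.
Proof.
have [k kE] : exists k, (l + k)%N = m by exists (m - l)%N; have := ltn_ord l; lia.
elim: k l j Y J kE => [|k IH] l j Y J kE.
  have -> : l = ord_max by apply: ord_inj; rewrite /=; lia.
  exact: Ufix_dist_last.
move=> lY jl jJ lJ sJ.
have el : ordS l = l.+1 :> nat by rewrite val_ordS //; lia.
have oS : injective (@ordS n) := can_inj (@ordSK n).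
have kE' : (ordS l + k)%N = m by lia.
have := IH (ordS l) (ordS j) (shiftset Y) (shiftset J) kE'.
rewrite !mem_shiftset shiftsetS (inj_eq oS) => /(_ lY jl jJ lJ sJ).
have big_shift (F : 'I_n -> {vspace V}) :
    (\sum_(i in shiftset J) F i = \sum_(i in J) F (ordS i))%VS.
  by rewrite big_imset //= => x y _ _; apply: oS.
have -> : (\sum_(i in shiftset J) Ufix (shiftset Y :\ i) =
           rotf @: \sum_(i in J) Ufix (Y :\ i))%VS.
  by rewrite big_shift limg_sum; apply: eq_bigr => i _; rewrite rotU shiftsetD1.
have -> : (\sum_(i in shiftset J) Ufix (shiftset Y :\ i :\ ordS j) =
           rotf @: \sum_(i in J) Ufix (Y :\ i :\ j))%VS.
  by rewrite big_shift limg_sum; apply: eq_bigr => i _; rewrite rotU !shiftsetD1.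
by rewrite -shiftsetD1 -rotU -lker0_img_cap ?lker_rotf // limg_ker0 ?lker_rotf.
Qed.

Lemma qdim_shift J : qdim Ufix (shiftset J) = qdim Ufix J.
Proof.
have oS : injective (@ordS n) := can_inj (@ordSK n).
have rotB : (rotf @: Ubelow Ufix J = Ubelow Ufix (shiftset J))%VS.
  rewrite /Ubelow limg_sum big_imset /= => [|x y _ _]; last exact: oS.
  by apply: eq_bigr => i _; rewrite rotU shiftsetD1.
rewrite /qdim -rotB -rotU !limg_dim_eq //; by rewrite (eqP lker_rotf) capv0.
Qed.

Hypothesis noarc : forall k (T : Tab), (k < n)%N -> DesT T != [set i : 'I_n | (i < k)%N].

(** A tableau with descents in this cyclic arc misses some [i < k], because its descent set is not
    the whole initial segment; its basis vector then already lies in the space for the arc without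
    [i]. *)
Lemma Ufix_arc (k : nat) : (k < n)%N ->
  (Ufix (ord_max |: [set i : 'I_n | (i < k)%N]) <= Ubelow Ufix (ord_max |: [set i : 'I_n | (i < k)%N]))%VS.
Proof.
set J := ord_max |: _ => kn; have lJ : ord_max \in J by rewrite !inE eqxx.
rewrite {1}Ufix_last //; apply/subvP=> _ /memv_imgP[y /EspP yE ->]; rewrite lfunE /=.
apply: memv_suml => T _; case: (eqVneq (y T) 0) => [->|yT]; first by rewrite scale0r mem0v.
apply: memvZ; have TJ : DesT T \subset J.
  by apply: contraTT yT => TJ; rewrite yE ?eqxx // inE.
have [i ik iT] : exists2 i : 'I_n, (i < k)%N & i \notin DesT T.
  apply/exists_inP; apply: contraT => /exists_inPn H; case/negP: (noarc T kn).
  rewrite eqEsubset; apply/andP; split; apply/subsetP=> i.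
    move=> iT; have := subsetP TJ i iT; rewrite !inE => /orP[/eqP E|//].
    by rewrite E (negPf (last_notin_DesT T)) in iT.
  by rewrite inE => /H; rewrite negbK.
have il : i != ord_max by rewrite -val_eqE /=; move: kn; rewrite ltnS; lia.
have iJ : i \in J by rewrite !inE ik orbT.
apply: (subvP (sub_Ubelow Ufix iJ)); apply: bvec_mem.
  by rewrite !inE eq_sym il eqxx.
apply/subsetP=> z zT; rewrite inE (subsetP TJ) // andbT inE.
by apply: contra iT => /eqP<-.
Qed.

Lemma Ufix_set0 : Ufix set0 = 0%VS.
Proof.
apply/eqP; rewrite -subv0; apply: (@subv_trans _ _ (Ufix [set ord_max])); first exact: Ufix_mono (sub0set _).
rewrite Ufix_last ?inE //; apply/subvP=> _ /memv_imgP[y /EspP yE ->]; rewrite lfunE /=.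
rewrite /bmap big1 ?mem0v // => T _; rewrite yE ?scale0r // inE.
apply: contra (noarc T (ltn0Sn m)) => TJ; rewrite eqEsubset; apply/andP; split; apply/subsetP=> i.
  by move=> iT; have := subsetP TJ i iT; rewrite inE => /eqP E; rewrite E (negPf (last_notin_DesT T)) in iT.
by rewrite inE.
Qed.

(** [qdim_add] at the last index gives a difference of dimensions which, in the adapted basis,
    counts the tableaux with descents in [ord_max |: J] that miss no element of [J]. The last index
    is never a descent, so these have descent set [J]. *)
Lemma qdim_rec (J : {set 'I_n}) : ord_max \notin J ->
  (qdim Ufix J + qdim Ufix (ord_max |: J) = #|[set T : Tab | DesT T == J]|)%N.
Proof.
move=> lJ.
have [B BJ UB] : exists2 B : {set 'I_n}, #|B| = #|J| & (Ufix B <= Ubelow Ufix B)%VS.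
  case: (posnP #|J|) => [J0|J0].
    by exists set0; rewrite ?cards0 ?J0 // Ufix_set0 sub0v.
  have kn : (#|J|.-1 < n)%N.
    by rewrite prednK // (leq_trans (max_card _)) // card_ord.
  (* The arc contains the last index, so only [#|J| - 1] initial indices are added to reach the size
     of [J]. *)
  exists (ord_max |: [set i : 'I_n | (i < #|J|.-1)%N]); last exact: Ufix_arc.
  rewrite cardsU1 inE /= -leqNgt -ltnS kn -[RHS](prednK J0); congr (_ + _)%N.
  by rewrite card_ord_lt // ltnW.
rewrite (qdim_add Ufix_mono Ufix_dist BJ UB lJ).
have E : Unear Ufix J ord_max = (blin @: Esp (\bigcup_(i in J) DesIn ((ord_max |: J) :\ i)))%VS.
  apply/eqP; rewrite eqEsubv; apply/andP; split.
    apply/subv_sumP=> i iJ; rewrite Ufix_last; last first.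
      by rewrite !inE eqxx andbT; apply: contra lJ => /eqP->.
    apply: limgS; apply/subvP=> y /EspP yE; apply/EspP=> T TN; apply: yE.
    by apply: contra TN => TI; apply/bigcupP; exists i.
  apply/subvP=> _ /memv_imgP[y /EspP yE ->]; rewrite lfunE /=.
  apply: memv_suml => T _; case: (eqVneq (y T) 0) => [->|yT]; first by rewrite scale0r mem0v.
  apply: memvZ; have /bigcupP[i iJ] : T \in \bigcup_(i in J) DesIn ((ord_max |: J) :\ i).
    by apply: contraTT yT => TN; rewrite yE ?eqxx.
  rewrite inE => TI; apply: (subvP (sumv_sup i iJ (subvv _))); apply: bvec_mem => //.
  by rewrite !inE eqxx andbT; apply: contra lJ => /eqP->.
rewrite E Ufix_last ?inE ?eqxx // !limg_dim_eq; try by rewrite (eqP lker_blin) capv0.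
rewrite !dim_Esp; set A := DesIn _; set C := \bigcup_(i in J) _.
have sCA : C \subset A.
  apply/subsetP=> T /bigcupP[i iJ]; rewrite !inE => h; apply: subset_trans h _; exact: subsetDl.
rewrite -(cardsID C A) (setIidPr sCA) addKn; congr #|pred_of_set _|.
apply/setP=> T; rewrite !inE; apply/andP/eqP => [[TC TA]|TE].
  apply/eqP; rewrite eqEsubset; apply/andP; split; apply/subsetP=> i.
    move=> iT; have := subsetP TA i iT; rewrite !inE => /orP[/eqP iE|//].
    by rewrite iE (negPf (last_notin_DesT T)) in iT.
  move=> iJ; apply: contraT => iT; case/bigcupP: TC; exists i => //.
  rewrite inE; apply/subsetP=> z zT; rewrite inE (subsetP TA) // andbT inE.
  by apply: contra iT => /eqP<-.
rewrite TE; split; last exact: subsetUr.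
apply/negP=> /bigcupP[i iJ]; rewrite inE TE => /subsetP/(_ i iJ).
by rewrite !inE eqxx.
Qed.

Lemma qdim_set0 : qdim Ufix set0 = 0%N.
Proof. by rewrite /qdim Ufix_set0 dimv0. Qed.

Lemma qdim_setT : qdim Ufix setT = 0%N.
Proof.
have lJ : (ord_max : 'I_n) \notin ~: [set ord_max] by rewrite !inE eqxx.
have := qdim_rec lJ; rewrite setUCr.
suff -> : [set T : Tab | DesT T == ~: [set ord_max]] = set0.
  by rewrite cards0 => /eqP; rewrite addn_eq0 => /andP[_ /eqP].
apply/setP=> T; rewrite !inE; apply/negbTE; apply: contra (noarc T (ltnSn m)) => /eqP->.
apply/eqP/setP=> i; rewrite !inE ltn_neqAle -ltnS ltn_ord andbT.
by rewrite -val_eqE.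
Qed.

End CyclicFamily.

(** * Cyclic descent extensions for shapes containing a 2x2 square *)

(** Elements of a fibre are matched with those of the translated fibre by their position in the
    enumeration; the identity outside [A] makes this a permutation of the whole type. *)
Lemma equidistributed_perm (X Y : finType) (A : {set X}) (c : X -> Y) (s : Y -> Y) :
    injective s ->
    (forall y, #|[set x in A | c x == s y]| = #|[set x in A | c x == y]|) ->
  exists psi : {perm X}, forall x, x \in A -> psi x \in A /\ c (psi x) = s (c x).
Proof.
move=> s_inj eqc; pose fib y := [set x in A | c x == y].
pose f x := if x \in A then nth x (enum (fib (s (c x)))) (index x (enum (fib (c x)))) else x.
have fib_x x : x \in A -> x \in enum (fib (c x)) by move=> xA; rewrite mem_enum !inE xA eqxx.
have idx x : x \in A -> index x (enum (fib (c x))) < size (enum (fib (s (c x)))).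
  by move=> xA; rewrite -cardE eqc cardE index_mem fib_x.
have fA x : x \in A -> f x \in A /\ c (f x) = s (c x).
  move=> xA; have := mem_nth x (idx x xA); rewrite mem_enum !inE /f xA.
  by case/andP=> -> /eqP->.
have f_inj : injective f.
  move=> x y; case: (boolP (x \in A)) => xA; case: (boolP (y \in A)) => yA.
  - move=> E; have cE : c x = c y by apply: s_inj; rewrite -(fA x xA).2 -(fA y yA).2 E.
    move: E; rewrite /f xA yA -cE => E.
    have iy := idx y yA; rewrite -cE in iy.
    have /eqP := E; rewrite (set_nth_default x y) // nth_uniq ?enum_uniq ?idx // => /eqP E'.
    have xx := fib_x x xA; have yy := fib_x y yA; rewrite -cE in yy.
    by rewrite -(nth_index x xx) E' nth_index.
  - by move=> E; have [] := fA x xA; rewrite E /f (negPf yA) (negPf yA).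
  - by move=> E; have [] := fA y yA; rewrite -E /f (negPf xA) (negPf xA).
  - by rewrite /f (negPf xA) (negPf yA).
by exists (perm f_inj) => x xA; rewrite permE; apply: fA.
Qed.

Lemma card_index_lt (X : finType) (F : {set X}) k : k <= #|F| ->
  #|[set x in F | index x (enum F) < k]| = k.
Proof.
move=> kF; have -> : [set x in F | index x (enum F) < k] = [set x in take k (enum F)].
  apply/setP=> x; rewrite !inE; case: (boolP (x \in F)) => xF /=.
    by rewrite in_take // mem_enum.
  by apply/esym/negbTE; apply: contra xF => /mem_take; rewrite mem_enum.
rewrite cardsE; have /card_uniqP-> : uniq (take k (enum F)) by rewrite take_uniq // enum_uniq.
by rewrite size_takel // -cardE.
Qed.

Section CyclicExtension.
Variables (m : nat) (la mu : seq nat).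
Local Notation n := m.+1.
Local Notation Tab := (SYT n la mu).
Local Notation dcount J := (#|[set T : Tab | DesT T == J]|).

(** Only counts matter: among the tableaux with descent set [J], an arbitrary [a (ord_max |: J)] of
    them receive the last index, and the bijection then comes from equidistribution. *)
Lemma cyclic_ext_of_count (a : {set 'I_n} -> nat) :
    (forall J, a (shiftset J) = a J) -> a set0 = 0 -> a setT = 0 ->
    (forall J : {set 'I_n}, ord_max \notin J -> a J + a (ord_max |: J) = dcount J) ->
  exists (cD : Tab -> {set 'I_n}) (psi : {perm Tab}), cyclic_descent_ext cD psi.
Proof.
move=> a_shift a0 aT a_rec.
pose F D := [set T : Tab | DesT T == D].
pose cD (T : Tab) := if index T (enum (F (DesT T))) < a (ord_max |: DesT T)
  then ord_max |: DesT T else DesT T.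
have DesE T : cD T :\ ord_max = DesT T.
  rewrite /cD; case: ifP => _; first by rewrite setU1K ?last_notin_DesT.
  by apply/setDidPl; rewrite disjoint_sym disjoints1 last_notin_DesT.
have cnt J : #|[set T | cD T == J]| = a J.
  case: (boolP (ord_max \in J)) => lJ.
    have JE := setD1K lJ; set D := J :\ ord_max in JE.
    have lD : ord_max \notin D by rewrite !inE eqxx.
    have le : a J <= #|F D| by rewrite -(a_rec D lD) JE leq_addl.
    rewrite -[RHS](card_index_lt le); congr #|pred_of_set _|; apply/setP=> T; rewrite !inE.
    apply/eqP/andP => [E|[/eqP TD h]].
      have DE : DesT T = D by rewrite -DesE E.
      move: E; rewrite /cD DE eqxx JE; case: ifP => // _ E.
      by rewrite E lJ in lD.
    by rewrite /cD TD JE h.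
  have le : a (ord_max |: J) <= #|F J| by rewrite -(a_rec J lJ) leq_addl.
  have -> : [set T | cD T == J] = F J :\: [set T in F J | index T (enum (F J)) < a (ord_max |: J)].
    apply/setP=> T; rewrite !inE; apply/eqP/andP => [E|[/negP h /eqP TJ]].
      have DE : DesT T = J.
        by rewrite -DesE E; apply/setDidPl; rewrite disjoint_sym disjoints1.
      rewrite DE eqxx; split=> //; apply/negP=> /= h; move: E; rewrite /cD DE h => E.
      by rewrite -E !inE eqxx in lJ.
    by rewrite /cD TJ ifN //; apply/negP=> h'; apply: h; rewrite TJ eqxx.
  rewrite cardsD (setIidPr _); last by apply/subsetP=> T; rewrite inE => /andP[].
  by rewrite card_index_lt // -(a_rec J lJ) addnK.
have s_inj := @shiftset_inj n.
have [|psi psiE] := @equidistributed_perm Tab _ setT cD (@shiftset n) s_inj.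
  move=> J; rewrite -[LHS]/(#|[set T in setT | cD T == shiftset J]|).
  rewrite (_ : [set T in _ | _] = [set T | cD T == shiftset J]); last by apply/setP=> T; rewrite !inE.
  rewrite (_ : [set T in _ | _] = [set T | cD T == J]); last by apply/setP=> T; rewrite !inE.
  by rewrite !cnt a_shift.
exists cD, psi => T; split.
- rewrite -DesE; apply/setP=> i; rewrite !inE andbC; congr (_ && _).
  by rewrite ltnS ltn_neqAle -ltnS ltn_ord andbT -val_eqE.
- by have [] := psiE T (in_setT _).
- apply/negP=> E; have := cnt set0; rewrite a0 => /eqP; rewrite cards_eq0 => /eqP/setP/(_ T).
  by rewrite !inE E.
- apply/negP=> E; have := cnt setT; rewrite aT => /eqP; rewrite cards_eq0 => /eqP/setP/(_ T).
  by rewrite !inE E.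
Qed.

(** The numerical content of an extension, in the form used by [cyclic_count_unique]. *)
Lemma cyclic_ext_count (cD : Tab -> {set 'I_n}) psi : cyclic_descent_ext cD psi ->
  [/\ forall J, #|[set T | cD T == shiftset J]| = #|[set T | cD T == J]|,
      #|[set T | cD T == set0]| = 0 &
      forall J : {set 'I_n}, ord_max \notin J ->
        #|[set T | cD T == J]| + #|[set T | cD T == ord_max |: J]| = dcount J].
Proof.
move=> ext; have s_inj := @shiftset_inj n.
split.
- move=> J; rewrite -(card_imset [set T | cD T == J] (@perm_inj _ psi)); congr #|pred_of_set _|.
  apply/setP=> T; rewrite -[T](permKV psi) mem_imset; last exact: perm_inj.
  by rewrite !inE; have [_ -> _ _] := ext (psi^-1 T)%g; rewrite (inj_eq s_inj).
- apply/eqP; rewrite cards_eq0; apply/eqP/setP=> T; rewrite !inE.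
  by have [_ _ /negPf-> _] := ext T.
move=> J lJ; rewrite -cardsUI (_ : _ :&: _ = set0) ?cards0 ?addn0; last first.
  apply/setP=> T; rewrite !inE; apply/negP=> /andP[/eqP-> /eqP E].
  by rewrite E !inE eqxx in lJ.
congr #|pred_of_set _|; apply/setP=> T; rewrite !inE; have [<- _ _ _] := ext T.
have -> : [set i in cD T | i.+1 < n] = cD T :\ ord_max.
  apply/setP=> i; rewrite !inE andbC; congr (_ && _).
  by rewrite ltnS ltn_neqAle -ltnS ltn_ord andbT -val_eqE.
apply/orP/eqP => [[/eqP->|/eqP->]|<-].
- by apply/setDidPl; rewrite disjoint_sym disjoints1.
- by rewrite setU1K.
case: (boolP (ord_max \in cD T)) => h; first by right; rewrite setD1K.
by left; apply/eqP/esym/setDidPl; rewrite disjoint_sym disjoints1.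
Qed.

End CyclicExtension.

(** * Tableaux whose descents form an initial segment *)

Section DescentRuns.
Variables (n : nat) (la mu : seq nat) (T : SYT n la mu).

Lemma row_nondes (p q : 'I_n) : p <= q ->
  (forall i : 'I_n, p <= i < q -> i \notin DesT T) -> (val T q).1 <= (val T p).1.
Proof.
move=> pq H; have [N NE] : exists N, q = p + N :> nat by exists (q - p); lia.
elim: N q NE pq H => [|N IH] q NE pq H; first by rewrite (_ : q = p) //; apply: ord_inj; lia.
have rn : p + N < n by have := ltn_ord q; lia.
set r := Ordinal rn; have lr : r.+1 < n by have := ltn_ord q; rewrite /=; lia.
have qr : q = ordS r by apply: ord_inj; rewrite val_ordS //=; lia.
apply: leq_trans (IH r erefl _ _); rewrite /= ?leq_addr //; last first.
  by move=> i pi; apply: H; lia.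
have hr : p <= r < q by rewrite /=; lia.
by have := H r hr; rewrite DesTE lr -qr /= -leqNgt.
Qed.

Lemma row_des (p q : 'I_n) : p < q ->
  (forall i : 'I_n, p <= i < q -> i \in DesT T) -> (val T p).1 < (val T q).1.
Proof.
move=> pq H; have [N NE] : exists N, q = p + N.+1 :> nat by exists (q - p.+1); lia.
elim: N q NE {pq} H => [|N IH] q NE H.
  have := H p; rewrite leqnn NE addn1 ltnSn DesTE => /(_ isT)/andP[lp].
  by rewrite (_ : q = ordS p) //; apply: ord_inj; rewrite val_ordS // NE addn1.
have rn : p + N.+1 < n by have := ltn_ord q; lia.
set r := Ordinal rn.
apply: (ltn_trans (IH r erefl _)); first by move=> i /= pi; apply: H; lia.
have hr : p <= r < q by rewrite /=; lia.
have := H r hr; rewrite DesTE => /andP[lr].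
by rewrite (_ : q = ordS r) //; apply: ord_inj; rewrite val_ordS //=; lia.
Qed.

End DescentRuns.

(** The shape contains the 2x2 square at the corner; let [z], [a], [e] be the entries of its cells
    (0,0), (0,1), (1,1). If the descents are the indices below [k], then either all steps from [z]
    to [a] are descents, although both lie in row 0, or no step from [a] to [e] is one, although [e]
    lies lower. *)
Lemma nonhook_noarc n la k (T : SYT n la [::]) : is_partition la -> 1 < nth 0 la 1 ->
  DesT T != [set i : 'I_n | i < k].
Proof.
move=> pla l1; apply/eqP=> E.
have l0 : 1 < nth 0 la 0 by apply: leq_trans l1 _; apply: nth_partition.
have s1 : 1 < size la by rewrite ltnNge; apply: contraL l1 => /(nth_default 0)->.
have sT := valP T.
have cell r c : r <= 1 -> c <= 1 -> inskew la [::] r c.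
  by case: r => [|[|]] // _; case: c => [|[|]] // _; rewrite /inskew /= ?s1 ?(ltnW s1) /=; lia.
have [z [z1 z2]] := syt_onto pla sT (cell 0 0 isT isT).
have [a [a1 a2]] := syt_onto pla sT (cell 0 1 isT isT).
have [e [e1 e2]] := syt_onto pla sT (cell 1 1 isT isT).
have za : z < a by apply: (syt_row_lt sT); rewrite ?z1 ?a1 ?z2 ?a2.
have ae : a < e by apply: (syt_col_lt sT); rewrite ?e1 ?a1 ?e2 ?a2.
case: (leqP a k) => ak.
  have : (val T z).1 < (val T a).1.
    by apply: row_des za _ => i zia; rewrite E inE; lia.
  by rewrite z1 a1.
have : (val T e).1 <= (val T a).1.
  by apply: row_nondes (ltnW ae) _ => i aie; rewrite E inE; lia.
by rewrite a1 e1.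
Qed.

Lemma nonhook_cyclic_ext n la : 1 < n -> is_partition la -> 1 < nth 0 la 1 ->
  exists (cD : SYT n la [::] -> {set 'I_n}) (psi : {perm SYT n la [::]}), cyclic_descent_ext cD psi.
Proof.
case: n => // m m0 pla l1; have m_gt0 : 0 < m by [].
have pmu : is_partition [::] by [].
have noarc k (T : SYT m.+1 la [::]) : k < m.+1 -> DesT T != [set i : 'I_m.+1 | i < k].
  by move=> _; apply: nonhook_noarc.
apply: (@cyclic_ext_of_count _ _ _ (qdim (@Ufix m la [::]))).
- exact: qdim_shift.
- exact: qdim_set0.
- exact: qdim_setT.
- exact: qdim_rec.
Qed.

(** * Hooks *)

Lemma blk_rank n (D : {set 'I_n}) : blk D =1 rank D (fun i j : 'I_n => i < j).
Proof. by []. Qed.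

Lemma blk_lt n (D : {set 'I_n}) (i j : 'I_n) : i \in D -> i < j -> blk D i < blk D j.
Proof.
rewrite !blk_rank; apply: (@rank_lt _ _ (fun i j : 'I_n => i < j)) => [k|b a c]; first exact: ltnn.
exact: ltn_trans.
Qed.

Lemma blk_lt_card n (D : {set 'I_n}) (i : 'I_n) : i \in D -> blk D i < #|D|.
Proof. by rewrite blk_rank; apply: rank_bound => k; apply: ltnn. Qed.

Lemma blk_onto n (D : {set 'I_n}) k : k < #|D| -> exists2 i, i \in D & blk D i = k.
Proof.
apply: (@rank_onto _ _ (fun i j : 'I_n => i < j)) => [i|b a c|i j _ _ ij]; first exact: ltnn.
  exact: ltn_trans.
by rewrite -neq_ltn; apply: contra ij => /eqP/ord_inj->.
Qed.

Section HookTableaux.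
Variables (m p q : nat) (e : bool).
Local Notation n := m.+1.
(** Leg [p], arm [q]. The inner shape [nseq e 1] removes the corner when [e] holds, so straight
    hooks and their disconnected cuts are treated together. *)
Definition hook_la := q.+1 :: nseq p 1.
Local Notation la := hook_la.
Local Notation mu := (nseq e 1).
Local Notation Tab := (SYT n la mu).

Lemma hook_partition : is_partition la.
Proof.
rewrite /is_partition /= all_nseq orbT andbT.
by case: p => //= k; elim: k => //= k ->.
Qed.

Lemma hook_mu_partition : is_partition mu. Proof. by case: e. Qed.

Lemma inskew_hook r c :
  inskew la mu r c = ((r == 0) && (e <= c <= q)) || ((0 < r <= p) && (c == 0)).
Proof.
rewrite /inskew /= size_nseq; case: r => [|r] /=.
  by rewrite orbF; case: e.
rewrite ltnS !nth_nseq.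
have -> : (r.+1 < e) = false by case: (e).
by case: (ltnP r p) => //= _; case: c.
Qed.

Definition colset (T : Tab) : {set 'I_n} := [set i | 0 < (val T i).1].

Lemma colset_cell (T : Tab) i : inskew la mu (val T i).1 (val T i).2.
Proof. exact: syt_cellb (valP T) i. Qed.

Lemma colsetP (T : Tab) i : i \in colset T -> (val T i).2 = 0 :> nat.
Proof. by rewrite inE; have := colset_cell T i; rewrite inskew_hook => h h'; lia. Qed.

Lemma colsetN (T : Tab) i : i \notin colset T -> (val T i).1 = 0 :> nat.
Proof. by rewrite inE; lia. Qed.

(** If [i+1] lies in the leg, then [i] lies in the first row or higher up in the leg. *)
Lemma DesT_hook (T : Tab) i : (i \in DesT T) = (i.+1 < n) && (ordS i \in colset T).
Proof.
rewrite DesTE; case: (boolP (i.+1 < n)) => //= lin.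
case: (boolP (ordS i \in colset T)) => h; last by rewrite (colsetN h).
have e1 := val_ordS lin.
case: (boolP (i \in colset T)) => h'; last by rewrite (colsetN h'); move: h; rewrite inE => ->.
rewrite ltnNge; apply/negP=> le.
have : ordS i < i; last by rewrite e1; lia.
apply: (syt_mono hook_partition hook_mu_partition (valP T)) => //; first by rewrite !colsetP.
by rewrite eq_sym ordS_neq.
Qed.

Lemma colset0 (T : Tab) : ~~ e -> ord0 \notin colset T.
Proof.
move=> /negPf ne; apply/negP=> h.
have c0 : inskew la mu 0 0 by rewrite inskew_hook ne.
have [i [i1 i2]] := syt_onto hook_partition (valP T) c0.
suff : i < (ord0 : 'I_n) by rewrite ltn0.
apply: (syt_col_lt (valP T)); rewrite ?i2 ?colsetP // i1.
by move: h; rewrite inE.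
Qed.

(** The map [s] preserves the leg and is increasing on the leg and on the first row. So [s i < i]
    would give [s (s i) < s i], against the induction hypothesis at [s i]. *)
Lemma colset_le (T T' : Tab) (s : 'I_n -> 'I_n) :
  colset T = colset T' -> (forall i, val T' (s i) = val T i) -> forall i : 'I_n, i <= s i.
Proof.
move=> ST sE i; have [N] := ubnP i; elim: N i => // N IH i /ltnSE iN.
rewrite leqNgt; apply/negP=> si.
have IHs := IH _ (leq_trans si iN).
have inj : s (s i) != s i.
  apply/eqP=> E; have := sE (s i); rewrite E sE => /(syt_inj (valP T)) E'.
  by rewrite -E' ltnn in si.
suff : s (s i) < s i by rewrite ltnNge IHs.
have memE j : (s j \in colset T') = (j \in colset T) by rewrite !inE sE.
have cl j k : (j \in colset T) = (k \in colset T) -> k < j -> s k != s j -> s k < s j.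
  move=> jk kj skj; case: (boolP (j \in colset T)) => hj.
    have hk : k \in colset T by rewrite -jk.
    apply: (syt_mono hook_partition hook_mu_partition (valP T')) => //; last by rewrite !sE !colsetP.
    rewrite !sE leqNgt; apply/negP=> r.
    by have := @syt_col_lt _ _ _ _ (valP T) j k; rewrite !colsetP // => /(_ erefl r); lia.
  have hk : k \notin colset T by rewrite -jk.
  apply: (syt_mono hook_partition hook_mu_partition (valP T')) => //; first by rewrite !sE !colsetN.
  rewrite !sE leqNgt; apply/negP=> r.
  by have := @syt_row_lt _ _ _ _ (valP T) j k; rewrite !colsetN // => /(_ erefl r); lia.
by apply: cl => //; rewrite -memE -ST.
Qed.

Lemma colset_inj : injective colset.
Proof.
move=> T T' ST.
have tr (T1 T2 : Tab) : exists s : 'I_n -> 'I_n, forall i, val T2 (s i) = val T1 i.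
  have [_ onto _ _ _] := sytP _ _ (valP T2).
  have sx i : exists j, val T2 j == val T1 i.
    by have [j jE] := onto _ (syt_cellb (valP T1) i); exists j; apply/eqP.
  by exists (fun i => xchoose (sx i)) => i; apply/eqP/(xchooseP (sx i)).
have [s sE] := tr T T'; have [t tE] := tr T' T.
have ts i : t (s i) = i by apply: (syt_inj (valP T)); rewrite tE sE.
apply: val_inj; apply/ffunP=> i; rewrite -sE; congr (val T' _); apply: ord_inj.
by apply/eqP; rewrite eqn_leq (colset_le ST sE) /= -{2}(ts i) (colset_le (esym ST) tE).
Qed.

Lemma card_colset (T : Tab) : #|colset T| = p.
Proof.
pose f (i : 'I_n) := (val T i).1.
have f_inj : {in colset T &, injective f}.
  move=> i j hi hj E; apply: (syt_inj (valP T)); apply: cell_eq; first exact: (congr1 val E).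
  by rewrite !colsetP.
rewrite -(card_in_imset f_inj).
have -> : [set f i | i in colset T] = [set r : 'I_(Kb la) | 0 < r <= p].
  apply/setP=> r; rewrite inE; apply/imsetP/idP => [[i hi ->]|hr].
    by have := colset_cell T i; rewrite inskew_hook; move: hi; rewrite inE /f; lia.
  have rc : inskew la mu r 0 by rewrite inskew_hook hr orbT.
  have [i [i1 i2]] := syt_onto hook_partition (valP T) rc.
  by exists i; [rewrite inE i1; lia|apply: ord_inj].
have pK : p < Kb la by rewrite /Kb /= sumn_nseq; lia.
have -> : [set r : 'I_(Kb la) | 0 < r <= p] = [set r : 'I_(Kb la) | r < p.+1] :\ ord0.
  by apply/setP=> r; rewrite !inE -val_eqE /= ltnS lt0n.
by have := cardsD1 ord0 [set r : 'I_(Kb la) | r < p.+1]; rewrite card_ord_lt // inE /= => -[H]; exact: (esym H).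
Qed.

Hypothesis nE : n + e = p + q + 1.

(** Leg and first row are filled increasingly, each entry being placed by its rank [blk] in [S] or
    in the complement. *)
Lemma colset_onto (S : {set 'I_n}) : #|S| = p -> (~~ e -> ord0 \notin S) ->
  exists T : Tab, colset T = S.
Proof.
move=> Sp S0; have pla := hook_partition.
pose g : {ffun 'I_n -> cellT la} :=
  [ffun i => if i \in S then mkcell la (blk S i).+1 0 else mkcell la 0 (e + blk (~: S) i)].
have cS : #|~: S| = q.+1 - e by have := cardsC S; rewrite card_ord; lia.
have inS i : i \in S -> inskew la mu (blk S i).+1 0.
  by move=> iS; have := blk_lt_card iS; rewrite inskew_hook; lia.
have inN i : i \notin S -> inskew la mu 0 (e + blk (~: S) i).
  move=> iS; have := @blk_lt_card _ (~: S) i; rewrite inE iS => /(_ isT).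
  rewrite inskew_hook; lia.
have gS1 i : i \in S -> (g i).1 = (blk S i).+1 :> nat by move=> iS; rewrite ffunE iS (mkcell1 pla (inS i iS)).
have gS2 i : i \in S -> (g i).2 = 0 :> nat by move=> iS; rewrite ffunE iS (mkcell2 pla (inS i iS)).
have gN1 i : i \notin S -> (g i).1 = 0 :> nat by move=> iS; rewrite ffunE (negPf iS) (mkcell1 pla (inN i iS)).
have gN2 i : i \notin S -> (g i).2 = e + blk (~: S) i :> nat.
  by move=> iS; rewrite ffunE (negPf iS) (mkcell2 pla (inN i iS)).
have rowlt i j : (g i).1 = (g j).1 :> nat -> (g i).2 < (g j).2 -> i < j.
  case: (boolP (i \in S)) => iS; case: (boolP (j \in S)) => jS.
  - by rewrite !gS2.
  - by rewrite (gS1 i) // (gN1 j).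
  - by rewrite (gS1 j) // (gN1 i).
  rewrite !gN2 // => _ lt; rewrite ltnNge; apply/negP=> ji.
  by have := blk_le (~: S) ji; lia.
have collt i j : (g i).2 = (g j).2 :> nat -> (g i).1 < (g j).1 -> i < j.
  case: (boolP (i \in S)) => iS; case: (boolP (j \in S)) => jS.
  - rewrite !gS1 // => _ lt; rewrite ltnNge; apply/negP=> ji.
    by have := blk_le S ji; lia.
  - by rewrite (gS1 i) // (gN1 j).
  (* The corner is the only first-row cell above the leg; it holds the least entry outside [S],
     which is [ord0] by the assumption on [S]. *)
  - rewrite (gS2 j) // (gN2 i) // => E _.
    have e0 : ~~ e by move: E; case: (e).
    rewrite ltnNge; apply/negP=> ji.
    have j0 : 0 < j by rewrite lt0n; apply: contra (S0 e0) => /eqP j0; rewrite -(_ : j = ord0) //; apply: ord_inj.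
    have := @blk_lt _ (~: S) ord0 i; rewrite inE (S0 e0) /= => /(_ isT); lia.
  - by rewrite !gN1.
have sg : is_syt n la mu g.
  apply/sytP; split=> //.
  - move=> i; rewrite /cellb; case: (boolP (i \in S)) => iS; first by rewrite gS1 // gS2 // inS.
    by rewrite gN1 // gN2 // inN.
  - move=> x; rewrite /cellb inskew_hook => /orP[/andP[/eqP x1 x2]|/andP[x1 /eqP x2]].
      have : x.2 - e < #|~: S| by rewrite cS; lia.
      case/blk_onto=> i; rewrite inE => iS iE; exists i; apply: cell_eq.
        by rewrite gN1.
      by rewrite gN2 // iE; lia.
    have : x.1.-1 < #|S| by rewrite Sp; lia.
    case/blk_onto=> i iS iE; exists i; apply: cell_eq; last by rewrite gS2.
    by rewrite gS1 // iE; lia.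
  - move=> i j E; apply: ord_inj.
    have E1 : (g i).1 = (g j).1 :> nat by rewrite E.
    have E2 : (g i).2 = (g j).2 :> nat by rewrite E.
    case: (boolP (i \in S)) => iS; case: (boolP (j \in S)) => jS.
    + move: E1; rewrite !gS1 // => -[E1]; case: (ltngtP i j) => // ij.
        by have := blk_lt iS ij; lia.
      by have := blk_lt jS ij; lia.
    + by move: E1; rewrite (gS1 i) // (gN1 j).
    + by move: E1; rewrite (gS1 j) // (gN1 i).
    move: E2; rewrite !gN2 // => E2; case: (ltngtP i j) => // ij.
      by have := @blk_lt _ (~: S) i j; rewrite inE iS => /(_ isT ij); lia.
    by have := @blk_lt _ (~: S) j i; rewrite inE jS => /(_ isT ij); lia.
exists (Sub g sg : Tab); apply/setP=> i; rewrite inE /=.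
by case: (boolP (i \in S)) => iS; [rewrite gS1|rewrite gN1].
Qed.

Lemma card_colset_eq (S : {set 'I_n}) :
  #|[set T : Tab | colset T == S]| = (#|S| == p) && (e || (ord0 \notin S)).
Proof.
case: (boolP (_ && _)) => [/andP[/eqP Sp S0]|h].
  have [|T TS] := colset_onto Sp; first by move=> /negPf ne; rewrite ne in S0.
  rewrite (_ : [set _ | _] = [set T]) ?cards1 //; apply/setP=> T'; rewrite !inE -TS.
  by rewrite (inj_eq colset_inj).
apply/eqP; rewrite cards_eq0; apply/eqP/setP=> T; rewrite !inE; apply/negP=> /eqP TS.
case/negP: h; rewrite -TS card_colset eqxx /=.
by case: (boolP (~~ e)) => [/(colset0 T)->|]; rewrite ?orbT // negbK => ->.
Qed.

End HookTableaux.

Lemma ordS_max m : ordS (ord_max : 'I_m.+1) = ord0.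
Proof. by apply: ord_inj; rewrite /= modnn. Qed.

Lemma card_shiftset n (J : {set 'I_n}) : #|shiftset J| = #|J|.
Proof. by apply: card_imset; apply: can_inj (@ordSK n). Qed.

(** The corner of a straight hook holds the least entry, so its leg is exactly the shift of its
    descent set. *)
Lemma hook_descent_count m p q (J : {set 'I_m.+1}) :
  m = p + q -> ord_max \notin J ->
  #|[set T : SYT m.+1 (hook_la p q) [::] | DesT T == J]| = (#|J| == p).
Proof.
move=> mE lJ; have nE : m.+1 + false = p + q + 1 by rewrite mE; lia.
rewrite -(card_shiftset J).
have := @card_colset_eq m p q false nE (shiftset J).
rewrite -ordS_max mem_shiftset lJ andbT => <-; apply: eq_card => T.
rewrite !inE; apply/eqP/eqP => E.
  apply/setP=> i; rewrite -[i](ord_predK i) mem_shiftset -E (DesT_hook (e := false)).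
  case: (ltnP (ord_pred i).+1 m.+1) => //= h.
  have -> : ord_pred i = ord_max by apply: ord_inj; have := ltn_ord (ord_pred i); rewrite /=; lia.
  by rewrite ordS_max; apply/negbTE/(@colset0 m p q false).
apply/setP=> i; rewrite (DesT_hook (e := false)) E mem_shiftset.
case: (ltnP i.+1 m.+1) => //= h; apply/esym/negbTE.
by have -> : i = ord_max by apply: ord_inj; have := ltn_ord i; rewrite /=; lia.
Qed.

(** Without the corner the leg may be any [p]-subset, also one containing [ord0]. Rotated back by
    one it serves as cyclic descent set, and the family of all [p]-subsets is invariant under
    rotation. *)
Lemma cut_hook_cyclic_ext m p q : m.+1 = p + q -> 0 < p -> 0 < q ->
  exists cD : SYT m.+1 (hook_la p q) [:: 1] -> {set 'I_m.+1},
    (exists psi, cyclic_descent_ext cD psi) /\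
    (forall J, #|[set T | cD T == J]| = (#|J| == p)).
Proof.
move=> mE p0 q0; have nE : m.+1 + true = p + q + 1 by rewrite mE.
pose cD (T : SYT m.+1 (hook_la p q) [:: 1]) : {set 'I_m.+1} :=
  [set i | ordS i \in @colset m p q true T].
have cDE T J : (cD T == J) = (@colset m p q true T == shiftset J).
  apply/eqP/eqP => [<-|E]; last by apply/setP=> i; rewrite inE E mem_shiftset.
  by apply/setP=> i; rewrite -[i](ord_predK i) mem_shiftset [in RHS]inE.
have cnt J : #|[set T | cD T == J]| = (#|J| == p).
  have := @card_colset_eq m p q true nE (shiftset J).
  rewrite card_shiftset andbT => <-; apply: eq_card => T.
  by rewrite !inE cDE.
have ccD T : #|cD T| = p.
  apply/eqP; have := cnt (cD T); case: eqP => // _ /eqP; rewrite cards_eq0 => /eqP/setP/(_ T).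
  by rewrite !inE eqxx.
exists cD; split=> //.
have [|psi psiE] := @equidistributed_perm _ _ setT cD _ (@shiftset_inj m.+1).
  move=> J.
  rewrite (_ : [set T in _ | _] = [set T | cD T == shiftset J]); last by apply/setP=> T; rewrite !inE.
  rewrite (_ : [set T in _ | _] = [set T | cD T == J]); last by apply/setP=> T; rewrite !inE.
  by rewrite !cnt card_shiftset.
exists psi => T; split.
- by apply/setP=> i; rewrite (DesT_hook (e := true)) !inE andbC.
- by have [] := psiE T (in_setT _).
- by apply/eqP=> E; have := ccD T; rewrite E cards0; lia.
- by apply/eqP=> E; have := ccD T; rewrite E cardsT card_ord; lia.
Qed.

(** * Standardization *)

Lemma count_mem_ord n (w : seq nat) v : size w = n ->
  count_mem v w = #|[set i : 'I_n | nth 0 w i == v]|.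
Proof.
by move=> sw; rewrite -sum1_count (big_nth 0) big_mkord sw -sum1dep_card.
Qed.

Lemma maxw_bound (w : seq nat) x : x \in w -> x < maxw w.
Proof.
rewrite /maxw ltnS; elim: w => //= y w IH; rewrite inE leq_max => /orP[/eqP->|/IH->].
  by rewrite leqnn.
by rewrite orbT.
Qed.

Section Standardization.
Variables (m : nat) (la : seq nat) (w : seq nat).
Local Notation n := m.+1.
Hypotheses (pla : is_partition la) (sw : size w = n) (srt : sorted leq w).
Local Notation Tab := (SYT n la [::]).
Local Notation cell x := (cellb la [::] x).

Let pmu : is_partition [::] := isT.

Definition ascents : {set 'I_n} := [set i : 'I_n | (i.+1 < n) && (nth 0 w i < nth 0 w i.+1)].

Lemma Fcoef_ascents (D : {set 'I_n}) : (forall i : 'I_n, i \in D -> i.+1 < n) ->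
  Fcoef D w = (D \subset ascents).
Proof.
move=> Dn; rewrite /Fcoef sw eqxx srt /=; congr nat_of_bool.
apply/forallP/subsetP => H i.
  by move=> iD; have := H i; rewrite (Dn _ iD) iD inE (Dn _ iD).
by apply/implyP=> /andP[lin /H]; rewrite inE lin.
Qed.

Lemma DesT_ltn (T : Tab) (i : 'I_n) : i \in DesT T -> i.+1 < n.
Proof. by rewrite DesTE => /andP[]. Qed.

Lemma blk_ascents (i j : 'I_n) : nth 0 w i = nth 0 w j -> blk ascents i = blk ascents j.
Proof.
wlog ij : i j / i <= j => [H|].
  by case: (leqP i j) => [/H//|/ltnW/H h E]; apply/esym/h/esym.
move=> E; apply/eqP; rewrite eqn_leq blk_le //=; apply: subset_leq_card.
apply/subsetP=> d; rewrite !inE => /andP[/andP[ld dw] dj]; rewrite ld dw /=.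
rewrite ltnNge; apply/negP=> id.
have : nth 0 w i <= nth 0 w d by apply: sorted_nth => //; rewrite sw.
have : nth 0 w d.+1 <= nth 0 w j by apply: sorted_nth => //; rewrite sw.
lia.
Qed.

Definition entry (T : Tab) (x : cellT la) : 'I_n := odflt ord0 [pick i | val T i == x].

Lemma entryK (T : Tab) i : entry T (val T i) = i.
Proof.
rewrite /entry; case: pickP => [j /eqP/(syt_inj (valP T))//|/(_ i)].
by rewrite eqxx.
Qed.

Lemma val_entry (T : Tab) x : cell x -> val T (entry T x) = x.
Proof.
move=> cx; have [_ onto _ _ _] := sytP _ _ (valP T).
by have [i <-] := onto _ cx; rewrite entryK.
Qed.

(** The inverse of standardization; off the shape it takes the value 0 that [is_ssyt] prescribes. *)
Definition unstd (T : Tab) : {ffun cellT la -> 'I_(maxw w)} :=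
  [ffun x => if cell x then inord (nth 0 w (entry T x)) : 'I_(foldr maxn 0 w).+1
             else ord0 : 'I_(foldr maxn 0 w).+1].

Lemma unstdE (T : Tab) x : cell x -> unstd T x = nth 0 w (entry T x) :> nat.
Proof.
move=> cx; rewrite ffunE cx inordK //; apply: maxw_bound; apply: mem_nth.
by rewrite sw.
Qed.

Lemma unstd_val (T : Tab) i : unstd T (val T i) = nth 0 w i :> nat.
Proof. by rewrite unstdE ?entryK //; apply: syt_cellb (valP T) i. Qed.

(** Equal letters lie in one block of [ascents], which fills a horizontal strip, so the columns are
    strict. *)
Lemma unstd_ssyt (T : Tab) : DesT T \subset ascents -> is_ssyt la w (unstd T).
Proof.
move=> sD; have sT := valP T; apply/and4P; split.
- by apply/forallP=> x; apply/implyP=> /negPf nx; rewrite ffunE nx.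
- apply/forallP=> x; apply/forallP=> y; apply/implyP=> /and4P[cx cy /eqP xy c].
  rewrite -(val_entry T cx) -(val_entry T cy) !unstd_val.
  apply: sorted_nth; rewrite ?sw //; apply: ltnW.
  by apply: (syt_row_lt sT); rewrite !val_entry // xy.
- apply/forallP=> x; apply/forallP=> y; apply/implyP=> /and4P[cx cy /eqP xy c].
  rewrite -(val_entry T cx) -(val_entry T cy) !unstd_val.
  have lt : entry T x < entry T y by apply: (syt_col_lt sT); rewrite !val_entry // xy.
  rewrite ltn_neqAle sorted_nth ?sw // 1?ltnW // andbT; apply/eqP=> E.
  have [r _] := syt_strip pla pmu sD lt (blk_ascents E).
  by move: r; rewrite !val_entry // leqNgt c.
- apply/forallP=> v; rewrite (count_mem_ord _ sw) -(card_imset _ (syt_inj sT)).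
  apply/eqP; congr #|pred_of_set _|; apply/setP=> x; rewrite inE.
  apply/andP/imsetP => [[cx /eqP E]|[i iv ->]].
    exists (entry T x); last by rewrite val_entry.
    by rewrite inE -unstdE // E.
  split; first exact: syt_cellb sT i.
  by apply/eqP/ord_inj; rewrite unstd_val; move: iv; rewrite inE => /eqP.
Qed.

Lemma unstd_inj : {in [set T : Tab | DesT T \subset ascents] &, injective unstd}.
Proof.
move=> T T'; rewrite !inE => sD sD' E; apply/esym; apply: (agree_unique pla pmu sD sD').
apply/agreeP=> i j gE; apply: blk_ascents.
by rewrite -(unstd_val T) -(unstd_val T') -E gE.
Qed.

(** Standardization numbers the cells by value, ties from left to right; strict columns make this a
    total order. *)
Lemma unstd_onto f : is_ssyt la w f -> exists2 T : Tab, DesT T \subset ascents & unstd T = f.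
Proof.
case/and4P=> /forallP f0 /forallP fr /forallP fc /forallP fw.
have {}fr x y : cell x -> cell y -> x.1 = y.1 :> nat -> x.2 < y.2 -> f x <= f y.
  move=> cx cy xy c; have /forallP/(_ y)/implyP := fr x; apply.
  by rewrite cx cy c andbT; apply/eqP/ord_inj.
have {}fc x y : cell x -> cell y -> x.2 = y.2 :> nat -> x.1 < y.1 -> f x < f y.
  move=> cx cy xy c; have /forallP/(_ y)/implyP := fc x; apply.
  by rewrite cx cy c andbT; apply/eqP/ord_inj.
pose C := [set x : cellT la | cell x].
pose lt (x y : cellT la) := (f x < f y) || ((f x == f y :> nat) && (x.2 < y.2)).
have lt_irr : irreflexive lt by move=> x; rewrite /lt !ltnn andbF.
have lt_trans : transitive lt by move=> y x z; rewrite /lt; lia.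
have lt_total : {in C &, forall x y, x != y -> lt x y || lt y x}.
  move=> x y; rewrite !inE => cx cy xy; rewrite /lt.
  case: (ltngtP (f x) (f y)) => //= E; case: (ltngtP x.2 y.2) => //= E2.
  case: (ltngtP x.1 y.1) => E1.
  - by have := fc _ _ cx cy E2 E1; rewrite E ltnn.
  - by have := fc _ _ cy cx (esym E2) E1; rewrite E ltnn.
  by rewrite (cell_eq E1 E2) eqxx in xy.
(* The prescribed multiplicities of the values add up to the length of [w]. *)
have cardC : #|C| = n.
  rewrite -sw -sum1_size.
  rewrite -sum1_card (partition_big f predT) //=.
  transitivity (\sum_(v < maxw w) count_mem (val v) w).
    apply: eq_bigr => v _; rewrite -(eqP (fw v)) -sum1_card; apply: eq_bigl => x.
    by rewrite !inE.
  rewrite (eq_bigr (fun v : 'I_(maxw w) => \sum_(x <- w | x == v) 1)); last by move=> v _; rewrite sum1_count.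
  rewrite (exchange_big_dep predT) //= [LHS]big_seq [RHS]big_seq; apply: eq_bigr => x xw.
  by rewrite (big_pred1 (Ordinal (maxw_bound xw))).
have rank_ex (i : 'I_n) : exists x, (x \in C) && (rank C lt x == i).
  have [|x xC xE] := @rank_onto _ C lt lt_irr lt_trans lt_total i; first by rewrite cardC.
  by exists x; rewrite xC xE eqxx.
pose g : {ffun 'I_n -> cellT la} := [ffun i => xchoose (rank_ex i)].
have gC i : g i \in C by rewrite ffunE; have /andP[] := xchooseP (rank_ex i).
have gr i : rank C lt (g i) = i by rewrite ffunE; have /andP[_ /eqP] := xchooseP (rank_ex i).
have gcell i : cell (g i) by have := gC i; rewrite inE.
have glt i j : lt (g i) (g j) = (i < j).
  by rewrite -(rank_ltE lt_irr lt_trans lt_total) // !gr.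
have sg : is_syt n la [::] g.
  apply/sytP; split=> //.
  - move=> x cx; have xC : x \in C by rewrite inE.
    have rn : rank C lt x < n by rewrite -cardC rank_bound.
    exists (Ordinal rn); apply: (rank_inj lt_irr lt_trans lt_total (gC _) xC).
    by rewrite gr.
  - by move=> i j E; apply: ord_inj; rewrite -gr E gr.
  - move=> i j E c; rewrite -glt /lt c andbT; have := fr _ _ (gcell i) (gcell j) E c; lia.
  - by move=> i j E c; rewrite -glt /lt (fc _ _ (gcell i) (gcell j) E c).
have fg i : f (g i) = nth 0 w i :> nat.
  (* Both sequences are sorted and have the same letter multiplicities. *)
  suff E : [seq nat_of_ord (f (g i)) | i <- enum 'I_n] = w.
    have := congr1 (fun s => nth 0 s i) E.
    by rewrite /= (nth_map i) ?size_enum_ord // nth_ord_enum.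
  apply: (sorted_eq leq_trans anti_leq) => //.
    rewrite sorted_map; have := iota_ltn_sorted 0 n; rewrite -val_enum_ord sorted_map.
    apply: sub_sorted => a b /=; rewrite -glt /lt; lia.
  apply/allP=> v _; apply/eqP; rewrite (@count_mem_ord n); last by rewrite size_map size_enum_ord.
  case: (ltnP v (maxw w)) => vw; last first.
    rewrite (count_memPn _); last by apply/negP=> /maxw_bound; lia.
    apply/eqP; rewrite cards_eq0; apply/eqP/setP=> j; rewrite !inE.
    rewrite (nth_map j) ?size_enum_ord // nth_ord_enum.
    by have := ltn_ord (f (g j)); lia.
  have /eqP := fw (Ordinal vw); rewrite /= => <-.
  rewrite -(card_imset _ (syt_inj sg)); congr #|pred_of_set _|; apply/setP=> x; rewrite !inE.
  apply/imsetP/andP => [[j]|[cx /eqP fx]].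
    rewrite inE (nth_map j) ?size_enum_ord // nth_ord_enum => /eqP E ->; split=> //.
    by apply/eqP/ord_inj.
  have [_ onto _ _ _] := sytP _ _ sg; have [j gi] := onto _ cx.
  exists j => //; rewrite inE (nth_map j) ?size_enum_ord // nth_ord_enum gi fx /=.
  by rewrite eqxx.
pose T : Tab := Sub g sg; exists T; last first.
  apply/ffunP=> x; apply: ord_inj; case: (boolP (cell x)) => cx.
    have vT := val_entry T cx; rewrite unstdE // -fg -[g]/(val T) vT //.
  by rewrite ffunE (negPf cx) /=; have /implyP/(_ cx)/eqP := f0 x.
apply/subsetP=> i; rewrite DesTE inE => /andP[lin r]; rewrite lin /=.
have e := val_ordS lin; rewrite -e -!fg -[g]/(val T).
have lt_i : lt (g i) (g (ordS i)) by rewrite glt e.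
move: lt_i; rewrite /lt => /orP[//|/andP[/eqP E c]].
(* Tied values at a descent are impossible: the cell in the row of [i] and the column of [i+1]
   separates them strictly. *)
have [k [k1 k2]] : exists k, (g k).1 = (g i).1 :> nat /\ (g k).2 = (g (ordS i)).2 :> nat.
  apply: (syt_onto pla sg).
  apply: (inskew_convex pla pmu (syt_cellb sg i) (syt_cellb sg (ordS i))).
    by rewrite leqnn ltnW.
  by rewrite leqnn andbT ltnW.
have a1 : f (g i) <= f (g k) by apply: fr => //; rewrite ?k2.
have a2 : f (g k) < f (g (ordS i)) by apply: fc => //; rewrite ?k1.
exact: leq_ltn_trans a2.
Qed.

Lemma schur_coefE : schur_coef la w = \sum_(T : Tab) Fcoef (DesT T) w.
Proof.
rewrite /schur_coef; have -> : [set f | is_ssyt la w f] =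
    unstd @: [set T : Tab | DesT T \subset ascents].
  apply/setP=> f; rewrite inE; apply/idP/imsetP => [/unstd_onto[T sD <-]|[T]].
    by exists T; rewrite ?inE.
  by rewrite inE => sD ->; apply: unstd_ssyt.
rewrite card_in_imset; last exact: unstd_inj.
rewrite -sum1dep_card big_mkcond; apply: eq_bigr => T _.
by rewrite Fcoef_ascents; [case: ifP|exact: DesT_ltn].
Qed.

End Standardization.

(** * Robinson-Schensted insertion *)

Inductive knuth : seq nat -> seq nat -> Prop :=
| knuth_refl u : knuth u u
| knuth_sym u v : knuth u v -> knuth v u
| knuth_trans u v w : knuth u v -> knuth v w -> knuth u w
| knuth_yzx s t x y z : x < y <= z -> knuth (s ++ [:: y; z; x] ++ t) (s ++ [:: y; x; z] ++ t)
| knuth_xzy s t x y z : x <= y < z -> knuth (s ++ [:: x; z; y] ++ t) (s ++ [:: z; x; y] ++ t).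

Lemma knuth_cat s t u v : knuth u v -> knuth (s ++ u ++ t) (s ++ v ++ t).
Proof.
elim=> {u v} [u|u v _ IH|u v w _ IH1 _ IH2|a b x y z h|a b x y z h].
- exact: knuth_refl.
- exact: knuth_sym.
- exact: knuth_trans IH1 IH2.
- by have := knuth_yzx (s ++ a) (b ++ t) h; rewrite -!catA.
- by have := knuth_xzy (s ++ a) (b ++ t) h; rewrite -!catA.
Qed.

Lemma knuth_catl s u v : knuth u v -> knuth (s ++ u) (s ++ v).
Proof. by move=> h; have := knuth_cat s [::] h; rewrite !cats0. Qed.

Lemma knuth_catr t u v : knuth u v -> knuth (u ++ t) (v ++ t).
Proof. exact: (@knuth_cat [::]). Qed.

Definition bumpi (r : seq nat) x := find (fun y => x < y) r.
Definition rowins (r : seq nat) x := set_nth 0 r (bumpi r x) x.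

(** Row insertion, returning also the index of the row that gains a cell. *)
Fixpoint tabins (t : seq (seq nat)) x : seq (seq nat) * nat :=
  if t is r :: t' then
    if bumpi r x < size r then
      let res := tabins t' (nth 0 r (bumpi r x)) in (rowins r x :: res.1, res.2.+1)
    else (rowins r x :: t', 0)
  else ([:: [:: x]], 0).

Definition dom (r s : seq nat) :=
  (size s <= size r) && all (fun i => nth 0 r i < nth 0 s i) (iota 0 (size s)).

Fixpoint tab (t : seq (seq nat)) : bool :=
  if t is r :: t' then [&& r != [::], sorted leq r, dom r (head [::] t') & tab t'] else true.

Lemma domP r s : reflect (size s <= size r /\ forall i, i < size s -> nth 0 r i < nth 0 s i) (dom r s).
Proof.
apply: (iffP andP) => -[h H]; split=> //.
  by move=> i si; move/allP: H; apply; rewrite mem_iota.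
by apply/allP=> i; rewrite mem_iota; apply: H.
Qed.

Lemma bumpi_size r x : bumpi r x <= size r. Proof. exact: find_size. Qed.

Lemma bumpi_before r x i : i < bumpi r x -> nth 0 r i <= x.
Proof. by move=> h; rewrite leqNgt (before_find 0 h). Qed.

Lemma bumpi_nth r x : bumpi r x < size r -> x < nth 0 r (bumpi r x).
Proof. by rewrite -has_find => /(nth_find 0). Qed.

Lemma bumpi_le r x i : i < size r -> x < nth 0 r i -> bumpi r x <= i.
Proof. by move=> ir xi; rewrite leqNgt; apply/negP=> /bumpi_before; lia. Qed.

Lemma size_rowins r x : size (rowins r x) = maxn (bumpi r x).+1 (size r).
Proof. by rewrite size_set_nth. Qed.

Lemma nth_rowins r x i : nth 0 (rowins r x) i = if i == bumpi r x then x else nth 0 r i.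
Proof. by rewrite nth_set_nth. Qed.

Lemma sorted_rowins r x : sorted leq r -> sorted leq (rowins r x).
Proof.
move=> srt; apply/(sortedP 0) => i; rewrite size_rowins !nth_rowins => h.
have bs := bumpi_size r x.
case: (eqVneq i (bumpi r x)) => [iE|ib].
  rewrite gtn_eqF; last by rewrite iE.
  have ir : i.+1 < size r by lia.
  have := bumpi_nth (_ : bumpi r x < size r); rewrite -iE => /(_ _) H.
  apply: ltnW; apply: leq_trans (H _) (sorted_nth srt (leqnSn i) ir); lia.
case: (eqVneq i.+1 (bumpi r x)) => [iE|ib'].
  by apply: bumpi_before; lia.
apply: sorted_nth => //; lia.
Qed.

Lemma rowins_neq0 r x : rowins r x != [::].
Proof. by rewrite -size_eq0 size_rowins; lia. Qed.

(** Bumping paths move weakly left, because the entry below the bumped one is larger. *)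
Lemma bumpi_dom r s x : dom r s -> bumpi r x < size r ->
  bumpi s (nth 0 r (bumpi r x)) <= bumpi r x.
Proof.
move=> /domP[_ H] br; case: (ltnP (bumpi r x) (size s)) => h.
  by apply: bumpi_le => //; apply: H.
exact: leq_trans (bumpi_size _ _) h.
Qed.

Lemma dom_rowins r s x : sorted leq r -> dom r s -> bumpi r x < size r ->
  dom (rowins r x) (rowins s (nth 0 r (bumpi r x))).
Proof.
move=> srt drs br; have le := bumpi_dom drs br; have xl := bumpi_nth br.
case/domP: drs => sz H; apply/domP; rewrite !size_rowins; split; first by lia.
move=> i hi; rewrite !nth_rowins; case: (eqVneq i (bumpi s _)) => [iE|ib].
  case: (eqVneq i (bumpi r x)) => // ir.
  by apply: leq_ltn_trans xl; apply: bumpi_before; rewrite ltn_neqAle ir iE.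
have is' : i < size s by have := bumpi_size s (nth 0 r (bumpi r x)); lia.
case: (eqVneq i (bumpi r x)) => [ir|ir]; last exact: H.
by apply: ltn_trans xl _; rewrite -ir; apply: H.
Qed.

Lemma dom_append r s x : dom r s -> size r <= bumpi r x -> dom (rowins r x) s.
Proof.
move=> /domP[sz H] br; apply/domP; rewrite size_rowins; split; first by lia.
move=> i hi; rewrite nth_rowins ltn_eqF; first exact: H.
by lia.
Qed.

Lemma head_tabins t x : head [::] (tabins t x).1 = rowins (head [::] t) x.
Proof. by case: t => //= r t; case: ifP. Qed.

Lemma tab_tabins t x : tab t -> tab (tabins t x).1.
Proof.
elim: t x => //= r t IH x /and4P[r0 srt drt tt]; case: ifP => br /=.
  by rewrite rowins_neq0 sorted_rowins // IH // head_tabins dom_rowins.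
rewrite rowins_neq0 sorted_rowins // tt dom_append //.
by rewrite leqNgt br.
Qed.

Definition sh (t : seq (seq nat)) i := size (nth [::] t i).

Lemma sh_tabins t x i : sh (tabins t x).1 i = sh t i + (i == (tabins t x).2).
Proof.
rewrite /sh; elim: t x i => [|r t IH] x i /=; first by case: i => [|[|]].
case: ifP => br /=; case: i => [|i] //=; rewrite ?eqSS ?IH //.
- by rewrite size_rowins; lia.
- by rewrite size_rowins; have := bumpi_size r x; lia.
by rewrite addn0.
Qed.

Lemma tab_sh t i : tab t -> sh t i.+1 <= sh t i.
Proof.
rewrite /sh; elim: t i => [|r t IH] i //=.
case/and4P=> _ _ /domP[h _] /IH{}IH; case: i => [|i] //=.
Qed.

(** The row bumping lemma: for [x <= x'] the second path runs strictly to the right of the first and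
    ends no lower; otherwise it runs weakly to the left and ends strictly lower. *)
Lemma tabins_mono t x x' : tab t ->
  ((tabins (tabins t x).1 x').2 <= (tabins t x).2) = (x <= x').
Proof.
elim: t x x' => [|r t IH] x x' /=.
  by rewrite /bumpi /=; case: (ltnP x' x).
case/and4P=> r0 srt drt tt; have bs := bumpi_size r x.
case: (leqP x x') => xx.
  have lt : bumpi r x < bumpi (rowins r x) x'.
    rewrite ltnNge; apply/negP=> le.
    have b1 : bumpi (rowins r x) x' < size (rowins r x) by rewrite size_rowins; lia.
    have := bumpi_nth b1; rewrite nth_rowins; case: eqP => [_|/eqP ne]; first by lia.
    have : nth 0 r (bumpi (rowins r x) x') <= x by apply: bumpi_before; rewrite ltn_neqAle ne.
    by lia.
  case: ifP => br /=; case: ifP => br' //=; last first.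
    by move: br'; rewrite size_rowins; have := bumpi_size (rowins r x) x'; rewrite size_rowins; lia.
  rewrite ltnS IH //; move: br'; rewrite size_rowins nth_rowins => br'.
  rewrite gtn_eqF //; apply: sorted_nth => //; lia.
have le : bumpi (rowins r x) x' <= bumpi r x.
  by apply: bumpi_le; [rewrite size_rowins; lia|rewrite nth_rowins eqxx].
have br' : bumpi (rowins r x) x' < size (rowins r x) by rewrite size_rowins; lia.
case: ifP => br /=; rewrite br' //=.
rewrite ltnS IH //; apply/negbTE; rewrite -ltnNge.
apply: leq_ltn_trans (bumpi_nth br); rewrite nth_rowins; case: eqP => // /eqP ne.
by apply: bumpi_before; rewrite ltn_neqAle ne.
Qed.

Lemma sorted_rconsl (s : seq nat) x : sorted leq (rcons s x) -> sorted leq s.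
Proof. by case: s => //= y s; rewrite rcons_path => /andP[]. Qed.

(** The letter [x] travels left across a row segment, each exchange being witnessed by the letter on
    the left of the exchanged pair. *)
Lemma knuth_slide_left s b z x : sorted leq (z :: b) -> x < z ->
  knuth (s ++ z :: rcons b x) (s ++ z :: x :: b).
Proof.
elim/last_ind: b => [|b v IH] srt xz; first exact: knuth_refl.
have srt' : sorted leq (z :: b) by apply: (@sorted_rconsl _ v).
apply: knuth_trans (_ : knuth _ (s ++ rcons (z :: rcons b x) v)) _.
  have [s' [y [E xy yv]]] : exists s' y, [/\ s ++ z :: b = rcons s' y, x < y & y <= v].
    case/lastP: b srt {IH srt'} => [|b y].
      rewrite /= andbT => zv; exists s, z; split=> //; by rewrite cats1.
    move=> srt; exists (s ++ z :: b), y; split; first by rewrite -rcons_cons -rcons_cat.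
      have /allP/(_ y) := order_path_min leq_trans srt.
      by rewrite mem_rcons inE mem_rcons inE eqxx orbT => /(_ isT); apply: leq_trans.
    by move: srt; rewrite /= rcons_path last_rcons => /andP[].
  have -> : s ++ z :: rcons (rcons b v) x = s' ++ [:: y; v; x] ++ [::].
    by rewrite -!rcons_cons -!rcons_cat E -!cats1 -!catA.
  have -> : s ++ rcons (z :: rcons b x) v = s' ++ [:: y; x; v] ++ [::].
    by rewrite -!rcons_cons -!rcons_cat E -!cats1 -!catA.
  by apply: knuth_yzx; rewrite xy.
have := knuth_catr [:: v] (IH srt' xz); rewrite -!catA /= !cats1.
by rewrite -rcons_cons.
Qed.

(** The larger letter [z] travels left, each exchange being witnessed by the letter on the right of
    the exchanged pair. *)
Lemma knuth_slide_right a t z x : sorted leq (rcons a x) -> x < z ->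
  knuth (a ++ z :: x :: t) (z :: a ++ x :: t).
Proof.
elim/last_ind: a x t => [|a u IH] x t srt xz; first exact: knuth_refl.
have ux : u <= x.
  by move: srt; case: (a) => [|y a'] /=; rewrite ?andbT // rcons_path last_rcons => /andP[].
have srt' : sorted leq (rcons a u) by apply: sorted_rconsl srt.
apply: knuth_trans (_ : knuth _ (a ++ [:: z; u; x] ++ t)) _.
  by rewrite -cats1 -catA; apply: knuth_xzy; rewrite ux.
rewrite cat_rcons; apply: (IH u (x :: t)) => //.
exact: leq_ltn_trans xz.
Qed.

(** The new letter slides left until it stands right behind the entry [z] that it bumps; then [z]
    slides to the front of the row. *)
Lemma knuth_rowins r x : sorted leq r -> bumpi r x < size r ->
  knuth (rcons r x) (nth 0 r (bumpi r x) :: rowins r x).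
Proof.
move=> srt br; set j := bumpi r x in br *; set z := nth 0 r j.
have rE : r = take j r ++ z :: drop j.+1 r by rewrite -drop_nth // cat_take_drop.
have insE : rowins r x = take j r ++ x :: drop j.+1 r.
  rewrite /rowins -/j set_nthE br //.
have xz : x < z := bumpi_nth br.
have srtz : sorted leq (z :: drop j.+1 r) by rewrite -drop_nth // drop_sorted.
rewrite {1}rE insE rcons_cat rcons_cons.
apply: knuth_trans (knuth_slide_left _ srtz xz) _.
apply: knuth_slide_right => //.
have -> : rcons (take j r) x = take j.+1 (rowins r x).
  rewrite insE take_cat size_takel; last exact: ltnW.
  by rewrite ltnNge leqnSn /= subSnn /= take0 cats1.
by apply: take_sorted; apply: sorted_rowins.
Qed.

Lemma rowins_append r x : size r <= bumpi r x -> rowins r x = rcons r x.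
Proof.
move=> h; have -> : rowins r x = set_nth 0 r (size r) x.
  by rewrite /rowins; congr set_nth; apply/eqP; rewrite eqn_leq h bumpi_size.
by rewrite set_nthE ltnn subnn cats1.
Qed.

Fixpoint to_word (t : seq (seq nat)) : seq nat := if t is r :: t' then to_word t' ++ r else [::].

Lemma knuth_tabins t x : tab t -> knuth (rcons (to_word t) x) (to_word (tabins t x).1).
Proof.
elim: t x => [|r t IH] x /=; first by move=> _; apply: knuth_refl.
case/and4P=> _ srt _ tt; case: ifP => br /=; last first.
  rewrite rowins_append ?rcons_cat; first exact: knuth_refl.
  by rewrite leqNgt br.
rewrite rcons_cat; apply: knuth_trans (knuth_catl _ (knuth_rowins srt br)) _.
by rewrite -cat_rcons; apply: knuth_catr; apply: IH.
Qed.

Definition rsP (t : seq (seq nat)) (u : seq nat) := foldl (fun t x => (tabins t x).1) t u.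
(** The recording tableau, kept as the word of the rows in which cells appear. *)
Fixpoint rsQ (t : seq (seq nat)) (u : seq nat) : seq nat :=
  if u is x :: u' then (tabins t x).2 :: rsQ (tabins t x).1 u' else [::].

Lemma rsP_rcons t u x : rsP t (rcons u x) = (tabins (rsP t u) x).1.
Proof. by rewrite /rsP -cats1 foldl_cat. Qed.

Lemma rsQ_rcons t u x : rsQ t (rcons u x) = rcons (rsQ t u) (tabins (rsP t u) x).2.
Proof. by elim: u t => //= y u IH t; rewrite IH. Qed.

Lemma size_rsQ t u : size (rsQ t u) = size u.
Proof. by elim: u t => //= y u IH t; rewrite IH. Qed.

Lemma take_rsQ t u i : take i (rsQ t u) = rsQ t (take i u).
Proof. by elim: u t i => [|y u IH] t [|i] //=; rewrite IH. Qed.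

Lemma tab_rsP u : tab (rsP [::] u).
Proof. by elim/last_ind: u => // u x IH; rewrite rsP_rcons tab_tabins. Qed.

Lemma sh_rsP u i : sh (rsP [::] u) i = count_mem i (rsQ [::] u).
Proof.
elim/last_ind: u => [|u x IH]; first by rewrite /sh nth_nil.
by rewrite rsP_rcons sh_tabins rsQ_rcons -cats1 count_cat IH /= addn0 eq_sym.
Qed.

Lemma knuth_rsP u : knuth u (to_word (rsP [::] u)).
Proof.
elim/last_ind: u => [|u x IH]; first exact: knuth_refl.
rewrite rsP_rcons; apply: knuth_trans (knuth_tabins _ (tab_rsP u)).
by rewrite -!cats1; apply: knuth_catr.
Qed.

(** Lattice words: by [yam_rows] and [rows_onto] they are the row words of standard tableaux. *)
Definition yam (ks : seq nat) := forall i k, count_mem k.+1 (take i ks) <= count_mem k (take i ks).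

Lemma yam_rsQ u : yam (rsQ [::] u).
Proof. by move=> i k; rewrite take_rsQ -!sh_rsP tab_sh // tab_rsP. Qed.

Lemma rsQ_des u i : i.+1 < size u ->
  (nth 0 (rsQ [::] u) i < nth 0 (rsQ [::] u) i.+1) = (nth 0 u i.+1 < nth 0 u i).
Proof.
elim/last_ind: u => // u x IH; rewrite size_rcons ltnS => iu.
rewrite rsQ_rcons !nth_rcons size_rsQ iu.
case: (ltngtP i.+1 (size u)) (iu) => // h _; first exact: IH.
move: h; case/lastP: u {IH iu} => // u y; rewrite size_rcons => -[->].
rewrite rsQ_rcons rsP_rcons !nth_rcons size_rsQ ltnn eqxx.
by rewrite ltnNge tabins_mono ?tab_rsP // -ltnNge.
Qed.

(** Reverse bumping is determined: [x] occupies the last position of the new row whose entry is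
    smaller than the bumped value. *)
Lemma rowins_bump_inj r r' x x' : sorted leq r -> sorted leq r' ->
    bumpi r x < size r -> bumpi r' x' < size r' ->
    nth 0 r (bumpi r x) = nth 0 r' (bumpi r' x') -> rowins r x = rowins r' x' ->
  r = r' /\ x = x'.
Proof.
move=> srt srt' br br'.
move yE : (nth 0 r (bumpi r x)) => y; move y'E : (nth 0 r' (bumpi r' x')) => y' E; rewrite -E in y'E.
move RE : (rowins r x) => R /esym RE'.
have lo s z : rowins s z = R -> bumpi s z < size s -> nth 0 s (bumpi s z) = y ->
    [/\ size s = size R, nth 0 R (bumpi s z) = z & z < y].
  move=> <- b <-; split; [by rewrite size_rowins; lia|by rewrite nth_rowins eqxx|exact: bumpi_nth].
have hi s z i : sorted leq s -> rowins s z = R -> bumpi s z < size s -> nth 0 s (bumpi s z) = y ->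
    bumpi s z < i -> i < size R -> y <= nth 0 R i.
  move=> ss <- b <-; rewrite size_rowins nth_rowins => bi is'; rewrite gtn_eqF //.
  apply: sorted_nth => //; first exact: ltnW.
  by lia.
have [s1 n1 l1] := lo _ _ RE br yE; have [s2 n2 l2] := lo _ _ RE' br' y'E.
have jE : bumpi r x = bumpi r' x'.
  case: (ltngtP (bumpi r x) (bumpi r' x')) => // lt.
    by have := hi _ _ _ srt RE br yE lt; rewrite n2 -s2 => /(_ br'); lia.
  by have := hi _ _ _ srt' RE' br' y'E lt; rewrite n1 -s1 => /(_ br); lia.
split; last by rewrite -n1 -n2 jE.
apply: (@eq_from_nth _ 0); first by rewrite s1 s2.
move=> i _; have := nth_rowins r x i; have := nth_rowins r' x' i; rewrite RE RE' jE.
by case: eqP => [-> _ _|_ <- //]; rewrite -{1}jE yE y'E.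
Qed.

Lemma tabins_inj t t' x x' : tab t -> tab t' -> tabins t x = tabins t' x' -> t = t' /\ x = x'.
Proof.
have nil r y z : r != [::] -> size r <= bumpi r y -> rowins r y <> [:: z].
  move=> r0 b /(congr1 size); rewrite size_rowins /=; move: r0 b; case: r => //= a r _; lia.
elim: t t' x x' => [|r t IH] [|r' t'] x x' //=.
- by move=> _ _ [->].
- move=> _ /and4P[r0 _ _ _]; case: ifP => //= br [E _].
  by case: (nil r' x' x r0) => //; rewrite leqNgt br.
- move=> /and4P[r0 _ _ _] _; case: ifP => //= br [E _].
  by case: (nil r x x' r0) => //; rewrite leqNgt br.
case/and4P=> r0 srt _ tt /and4P[r0' srt' _ tt'].
case: ifP => br; case: ifP => br' // => -[E1 E2]; last first.
  move: br br' E1 => /negbT; rewrite -leqNgt => br /negbT; rewrite -leqNgt => br'.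
  by rewrite !rowins_append // => /rcons_inj[-> ->]; rewrite E2.
move=> E3; have [tE yE] : t = t' /\ nth 0 r (bumpi r x) = nth 0 r' (bumpi r' x').
  by apply: IH => //; move: E2 E3; case: (tabins t _) => a b; case: (tabins t' _) => c d /= -> ->.
by have [-> ->] := rowins_bump_inj srt srt' br br' yE E1; rewrite tE.
Qed.

(* [y] replaces the rightmost entry of [r] smaller than it. *)
Lemma rowins_surj r y j : sorted leq r -> j < size r -> nth 0 r j < y ->
  exists x r', [/\ sorted leq r', bumpi r' x < size r', nth 0 r' (bumpi r' x) = y, rowins r' x = r
                 & j <= bumpi r' x].
Proof.
move=> srt jr jy; pose P i := (i < size r) && (nth 0 r i < y).
have Pj : P j by rewrite /P jr.
have exP : exists i, P i by exists j.
have ubP i : P i -> i <= size r by move=> /andP[/ltnW].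
case: (ex_maxnP exP ubP) => p /andP[pr py] pmax.
have hi i : p < i -> i < size r -> y <= nth 0 r i.
  move=> pi ir; rewrite leqNgt; apply/negP=> iy.
  by have := pmax i; rewrite /P ir iy => /(_ isT); lia.
pose x := nth 0 r p; pose r' := set_nth 0 r p y.
have sr' : size r' = size r by rewrite size_set_nth; lia.
have nr' i : nth 0 r' i = if i == p then y else nth 0 r i by rewrite nth_set_nth.
have bE : bumpi r' x = p.
  apply/eqP; rewrite eqn_leq bumpi_le ?sr' ?nr' ?eqxx //=.
  rewrite leqNgt; apply/negP=> lt.
  have b1 : bumpi r' x < size r' by rewrite sr'; apply: ltn_trans pr.
  have h : nth 0 r (bumpi r' x) <= x := sorted_nth srt (ltnW lt) pr.
  by have := bumpi_nth b1; rewrite nr' ltn_eqF // ltnNge h.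
exists x, r'; rewrite bE sr' nr' eqxx; split=> //; last exact: pmax.
  apply/(sortedP 0) => i; rewrite sr' !nr' => ir.
  case: (eqVneq i p) => [ip|ip].
    by rewrite gtn_eqF ?ip //; apply: hi; rewrite -?ip.
  case: (eqVneq i.+1 p) => [ip'|ip'].
    by apply: leq_trans (sorted_nth srt (leqnSn i) ir) _; rewrite ip' ltnW.
  exact: sorted_nth.
apply: (@eq_from_nth _ 0); first by rewrite size_rowins bE sr'; lia.
by move=> i _; rewrite nth_rowins bE nr'; case: eqP => // ->.
Qed.

(** Reverse insertion starting from the end of row [k], a removable corner by the size condition. *)
Lemma tabins_surj t k : tab t -> sh t k.+1 < sh t k ->
  exists t' x, tab t' /\ tabins t' x = (t, k).
Proof.
elim: k t => [|k IH] [|r t] //=; rewrite /sh ?nth_nil //=.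
  case/and4P=> r0 srt /domP[_ H] tt; rewrite nth0 => lt.
  case/lastP: r r0 srt H lt => // r x _ srt H; rewrite size_rcons ltnS => lt.
  have ax : bumpi r x = size r.
    apply/eqP; rewrite eqn_leq bumpi_size leqNgt; apply/negP=> b.
    have := bumpi_nth b; have := @sorted_nth _ (bumpi r x) (size r) srt (ltnW b).
    by rewrite size_rcons !nth_rcons b ltnn eqxx => /(_ (ltnSn _)); lia.
  case: (eqVneq r [::]) => [rE|r0].
    exists [::], x; split=> //; case: t tt lt {H} => [|s t]; first by rewrite rE.
    by rewrite rE /= => /and4P[]; case: s.
  exists (r :: t), x; split; last by rewrite /= ax ltnn rowins_append // ax.
  rewrite /= r0 (sorted_rconsl srt) tt andbT; apply/domP; split=> // i it.
  by have := H i it; rewrite nth_rcons (leq_trans it lt).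
case/and4P=> r0 srt drt tt lt; have [t' [y [tt' E]]] := IH t tt lt.
have hE : head [::] t = rowins (head [::] t') y by have := head_tabins t' y; rewrite E.
set s := head [::] t' in hE; set j := bumpi s y in hE.
move/domP: drt; rewrite hE => -[sz H].
have jr : j < size r by apply: leq_trans sz; rewrite size_rowins leq_maxl.
have jy : nth 0 r j < y.
  by have := H j; rewrite nth_rowins eqxx; apply; rewrite size_rowins leq_maxl.
(* The bound [jb] keeps columns strict: [y] returns weakly right of its position [j] in the lower
   row, where the entries of [s] exceed it. *)
have [x [r' [srt' b yE rE jb]]] := rowins_surj srt jr jy.
exists (r' :: t'), x; split; last by rewrite /= b yE E rE.
have sr : size r = size r' by rewrite -rE size_rowins; lia.
rewrite /= tt' srt' andbT -size_eq0 -lt0n; rewrite andTb -sr (leq_ltn_trans _ jr) //=.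
apply/domP; rewrite -/s -sr; split.
  by apply: leq_trans sz; rewrite size_rowins leq_maxr.
move=> i hi; case: (eqVneq i (bumpi r' x)) => [iE|ib].
  rewrite iE yE; have js : j < size s by rewrite iE in hi; apply: leq_ltn_trans hi.
  apply: leq_trans (bumpi_nth js) _; apply: sorted_nth; rewrite -?iE //; last by rewrite iE.
  by case: (t') tt' @s {E hE hi js sz H j jr jy jb} => //= ? ? /and4P[].
have rr : nth 0 r i = nth 0 r' i by rewrite -rE nth_rowins (negPf ib).
have := H i; rewrite nth_rowins size_rowins -rr; case: eqP => [iE|_ h]; last first.
  by apply: h; rewrite leq_max hi orbT.
have js : j < size s by rewrite /j -iE.
move=> h; apply: ltn_trans (h _) _; first by rewrite leq_max hi orbT.
by rewrite iE; apply: bumpi_nth.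
Qed.

Lemma rs_inj u u' : rsP [::] u = rsP [::] u' -> rsQ [::] u = rsQ [::] u' -> u = u'.
Proof.
move=> EP EQ; have : size u = size u' by rewrite -(size_rsQ [::] u) EQ size_rsQ.
elim/last_ind: u u' EP EQ => [|u x IH] u'; first by case: u'.
case/lastP: u' => [|u' x']; first by rewrite size_rcons.
rewrite !rsP_rcons !rsQ_rcons !size_rcons => EP /rcons_inj[EQ Ek] [sz].
have [|tE ->] := @tabins_inj _ _ x x' (tab_rsP u) (tab_rsP u').
  by move: EP Ek; case: (tabins _ _) => a b; case: (tabins _ _) => c d /= -> ->.
by rewrite (IH u').
Qed.

(** The last letter of a lattice word names a row ending in a removable corner, so it can be peeled
    off by reverse insertion. *)
Lemma rs_surj t ks : tab t -> yam ks -> (forall i, sh t i = count_mem i ks) ->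
  exists u, rsP [::] u = t /\ rsQ [::] u = ks.
Proof.
elim/last_ind: ks t => [|ks k IH] t tt yks shE.
  exists [::]; split=> //; case: t tt shE => //= r t /and4P[r0 _ _ _] /(_ 0).
  by rewrite /sh /=; case: r r0.
have cE i : count_mem i (rcons ks k) = count_mem i ks + (i == k).
  by rewrite -cats1 count_cat /= addn0 eq_sym.
have yks' : yam ks.
  move=> i l; have [ik|ki] := leqP i (size ks).
    by have := yks i l; rewrite -cats1 takel_cat.
  have := yks (size ks) l; rewrite -cats1 takel_cat // take_size.
  by rewrite take_oversize // ltnW.
have [|t' [x [tt' E]]] := @tabins_surj t k tt.
  rewrite !shE !cE eqxx gtn_eqF // addn0 addn1 ltnS.
  by have := yks' (size ks) k; rewrite take_size.
have [|u [uP uQ]] := IH t' tt' yks'.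
  by move=> i; have := sh_tabins t' x i; rewrite E /= shE cE => /addIn.
by exists (rcons u x); rewrite rsP_rcons rsQ_rcons uP uQ E.
Qed.

(** * Knuth classes of skew tableaux *)

Lemma knuth_size u v : knuth u v -> size u = size v.
Proof. by elim=> // [u' v' w' _ -> _ ->|s t x y z _|s t x y z _] //; rewrite !size_cat. Qed.

Section CellWords.
Variables (n : nat) (la mu : seq nat).
Local Notation Tab := (SYT n la mu).
Local Notation K := (Kb la).

(* Cells are read row by row from the bottom, left to right in each row. *)
Definition code (x : cellT la) : nat := (K - x.1) * K + x.2.

Lemma code_lt (x y : cellT la) :
  (code x < code y) = (y.1 < x.1) || ((y.1 == x.1 :> nat) && (x.2 < y.2)).
Proof.
rewrite /code; have x1 := ltn_ord x.1; have y1 := ltn_ord y.1.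
have x2 := ltn_ord x.2; have y2 := ltn_ord y.2.
have step a b c d : a < b -> c < K -> a * K + c < b * K + d.
  move=> ab cK; apply: (@leq_trans (a.+1 * K)); first by rewrite mulSn addnC ltn_add2r.
  by apply: leq_trans (leq_addr _ _); rewrite leq_mul2r ab orbT.
case: (ltngtP y.1 x.1) => h /=.
- by apply: step => //; lia.
- by apply/negbTE; rewrite -leqNgt; apply: ltnW; apply: step => //; lia.
by rewrite h ltn_add2l.
Qed.

Lemma code_inj : injective code.
Proof.
move=> x y E; have := code_lt x y; have := code_lt y x; rewrite E ltnn => h1 h2.
apply: cell_eq; lia.
Qed.

Definition word (g : {ffun 'I_n -> cellT la}) : seq nat := [seq code (g i) | i <- enum 'I_n].

Lemma size_word g : size (word g) = n.
Proof. by rewrite size_map size_enum_ord. Qed.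

Lemma nth_word g (i : 'I_n) : nth 0 (word g) i = code (g i).
Proof. by rewrite (nth_map i) ?size_enum_ord // nth_ord_enum. Qed.

Lemma word_inj : injective word.
Proof.
move=> g h E; apply/ffunP=> i; apply: code_inj.
by rewrite -!nth_word E.
Qed.

Hypotheses (pla : is_partition la) (pmu : is_partition mu).

(** Consecutive entries in one row have consecutive codes. In one column, a cell coded in between
    lies to the right of the lower or to the left of the upper one; the fourth corner of the
    resulting rectangle would hold an entry for which [j = i - 1] or [j = i + 2] leaves no room. *)
Lemma sw_between (T : Tab) (i j : 'I_n) : i.+1 < n -> (j.+1 == i) || (j == i.+2 :> nat) ->
    (code (val T i) < code (val T j) < code (val T (ordS i))) ||
    (code (val T (ordS i)) < code (val T j) < code (val T i)) ->
  is_syt n la mu (sw i (val T)).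
Proof.
move=> lin ij; set g := val T => btw; have sg : is_syt n la mu g := valP T.
have e := val_ordS lin; rewrite (is_syt_sw pla pmu sg lin); apply/andP; split; apply/eqP=> E.
  have c := syt_row_adj pla pmu sg E e.
  by move: btw; rewrite !code_lt E c; lia.
have r := syt_col_adj pla pmu sg E e.
have {btw} : ((g j).1 == (g i).1.+1 :> nat) && ((g i).2 < (g j).2) ||
             ((g j).1 == (g i).1 :> nat) && ((g j).2 < (g i).2).
  by move: btw; rewrite !code_lt E r; lia.
case/orP=> /andP[/eqP rj cj].
  have lt : i.+1 < j.
    by rewrite -e; apply: (syt_row_lt sg); rewrite ?rj ?r -?E.
  have [k [k1 k2]] : exists k, (g k).1 = (g i).1 :> nat /\ (g k).2 = (g j).2 :> nat.
    apply: (syt_onto pla sg); apply: (inskew_convex pla pmu (syt_cellb sg i) (syt_cellb sg j)); lia.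
  have ik : i < k by apply: (syt_row_lt sg); rewrite ?k1 ?k2.
  have kj : k < j by apply: (syt_col_lt sg); rewrite ?k1 ?k2 ?rj.
  have kE : k = ordS i by apply: ord_inj; rewrite e; lia.
  by move: k1; rewrite kE r; lia.
have lt : j < i by apply: (syt_row_lt sg).
have [k [k1 k2]] : exists k, (g k).1 = (g i).1.+1 :> nat /\ (g k).2 = (g j).2 :> nat.
  apply: (syt_onto pla sg).
  apply: (inskew_convex pla pmu (syt_cellb sg j) (syt_cellb sg (ordS i))); lia.
have jk : j < k by apply: (syt_col_lt sg); rewrite ?k1 ?k2 ?rj.
have ki : k < ordS i by apply: (syt_row_lt sg); rewrite ?k1 ?k2 ?r // -E.
have kE : k = i by apply: ord_inj; lia.
by move: k1; rewrite kE; lia.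
Qed.

Lemma word_sw g (i : 'I_n) (k : nat) : i.+1 < n -> k < n ->
  nth 0 (word (sw i g)) k =
  nth 0 (word g) (if k == i then i.+1 else if k == i.+1 then i : nat else k).
Proof.
move=> lin kn; have e := val_ordS lin; rewrite -[k]/(nat_of_ord (Ordinal kn)) nth_word.
case: (eqVneq (Ordinal kn) i) => [E|ki]; first by rewrite E eqxx swL -e nth_word.
have -> : (Ordinal kn == i :> nat) = false by apply/negbTE; apply: contra ki => /eqP/ord_inj->.
case: (eqVneq (Ordinal kn) (ordS i)) => [E|ki']; first by rewrite E e eqxx swR nth_word.
have -> : (Ordinal kn == i.+1 :> nat) = false.
  by apply/negbTE; apply: contra ki'; rewrite -e => /eqP/ord_inj->.
by rewrite swD // nth_word.
Qed.

Definition is_word (w : seq nat) := exists T : Tab, word (val T) = w.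

Lemma is_word_neq w i j : is_word w -> i < n -> j < n -> i != j -> nth 0 w i != nth 0 w j.
Proof.
case=> T <- ir jr; apply: contra; rewrite -[i]/(nat_of_ord (Ordinal ir)) -[j]/(nat_of_ord (Ordinal jr)).
by rewrite !nth_word => /eqP/code_inj/(syt_inj (valP T)) ->.
Qed.

(** A Knuth move exchanges neighbours whose codes enclose that of a third adjacent letter, as
    [sw_between] requires; the letters being distinct, weak inequalities become strict. *)
Lemma is_word_swap s a b c t w' : is_word (s ++ [:: a; b; c] ++ t) ->
  (w' = s ++ [:: b; a; c] ++ t /\ ((a <= c <= b) || (b <= c <= a))) \/
  (w' = s ++ [:: a; c; b] ++ t /\ ((b <= a <= c) || (c <= a <= b))) -> is_word w'.
Proof.
move=> isw; have [T TE] := isw.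
have sz : size s + (3 + size t) = n by rewrite -(size_word (val T)) TE !size_cat.
have p0 : size s < n by lia. have p1 : (size s).+1 < n by lia. have p2 : (size s).+2 < n by lia.
have nE k : nth 0 (s ++ [:: a; b; c] ++ t) (size s + k) = nth 0 ([:: a; b; c] ++ t) k.
  by rewrite nth_cat ltnNge leq_addr addKn.
have ab : a != b.
  by have := is_word_neq isw p0 p1; rewrite -[size s]addn0 -addnS !nE; apply; lia.
have ac : a != c.
  by have := is_word_neq isw p0 p2; rewrite -[size s]addn0 -!addnS !nE; apply; lia.
have bc : b != c.
  by have := is_word_neq isw p1 p2; rewrite -[size s]addn0 -!addnS !nE; apply; lia.
have codeE k (kn : size s + k < n) : code (val T (Ordinal kn)) = nth 0 ([:: a; b; c] ++ t) k.
  by rewrite -nth_word TE nE.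
have q0 : size s + 0 < n by lia. have q1 : size s + 1 < n by lia. have q2 : size s + 2 < n by lia.
have S0 : ordS (Ordinal q0) = Ordinal q1 by apply: ord_inj; rewrite val_ordS /=; lia.
have S1 : ordS (Ordinal q1) = Ordinal q2 by apply: ord_inj; rewrite val_ordS /=; lia.
have fin (i : 'I_n) : i.+1 < n -> is_syt n la mu (sw i (val T)) -> size w' = n ->
    (forall k, k < n -> nth 0 w' k = nth 0 (s ++ [:: a; b; c] ++ t)
       (if k == i then i.+1 else if k == i.+1 then i : nat else k)) -> is_word w'.
  move=> lin ss szw H; exists (Sub _ ss : Tab); apply: (@eq_from_nth _ 0); rewrite size_word ?szw //.
  by move=> k kn; rewrite H // -TE -word_sw.
case=> -[wE btw]; subst w'.
  apply: (fin (Ordinal q0)); rewrite /= ?size_cat /=; try lia.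
    apply: (@sw_between T _ (Ordinal q2)); rewrite /= ?S0 ?codeE /=; lia.
  move=> k kn; case: (ltnP k (size s)) => ks.
    by rewrite !ltn_eqF; try lia; rewrite !nth_cat ks.
  have -> : k = size s + (k - size s) by lia.
  rewrite -addnS !eqn_add2l.
  case: (k - size s) => [|[|[|l]]] /=; by rewrite nE nth_cat ltnNge leq_addr addKn.
apply: (fin (Ordinal q1)); rewrite /= ?size_cat /=; try lia.
  apply: (@sw_between T _ (Ordinal q0)); rewrite /= ?S1 ?codeE /=; lia.
move=> k kn; case: (ltnP k (size s)) => ks.
  by rewrite !ltn_eqF; try lia; rewrite !nth_cat ks.
have -> : k = size s + (k - size s) by lia.
rewrite -addnS !eqn_add2l.
case: (k - size s) => [|[|[|l]]] /=; by rewrite nE nth_cat ltnNge leq_addr addKn.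
Qed.

Lemma knuth_is_word u v : knuth u v -> is_word u <-> is_word v.
Proof.
elim=> {u v} [u|u v _ IH|u v w _ IH1 _ IH2|s t x y z h|s t x y z h]; try tauto.
  split=> isw; apply: (is_word_swap isw); right; split=> //; lia.
split=> isw; apply: (is_word_swap isw); left; split=> //; lia.
Qed.

End CellWords.

(** * Straight tableaux as lattice words *)

Lemma count_take n (ks : seq nat) i k : size ks = n -> i <= n ->
  count_mem k (take i ks) = #|[set j : 'I_n | (j < i) && (nth 0 ks j == k)]|.
Proof.
move=> sk ik; rewrite (@count_mem_ord i); last by rewrite size_takel // sk.
have inj : injective (widen_ord ik) by move=> a b /(congr1 val) /= /ord_inj.
rewrite -(card_imset _ inj); congr #|pred_of_set _|; apply/setP=> j; rewrite inE.
apply/imsetP/andP => [[a + ->]|[ji jk]].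
  by rewrite inE nth_take // => -> /=.
by exists (Ordinal ji); [rewrite inE nth_take|apply: ord_inj].
Qed.

Section StraightTableaux.
Variables (n : nat) (nu : seq nat).
Hypothesis pnu : is_partition nu.
Local Notation Tab := (SYT n nu [::]).
Let pmu : is_partition [::] := isT.

Lemma inskew_straight r c : inskew nu [::] r c = (c < nth 0 nu r).
Proof.
rewrite /inskew nth_nil /=; case: (ltnP r (size nu)) => //= h.
by rewrite nth_default.
Qed.

Definition rows (Q : Tab) : seq nat := [seq nat_of_ord (val Q i).1 | i <- enum 'I_n].

Lemma size_rows Q : size (rows Q) = n.
Proof. by rewrite size_map size_enum_ord. Qed.

Lemma nth_rows Q (i : 'I_n) : nth 0 (rows Q) i = (val Q i).1.
Proof. by rewrite (nth_map i) ?size_enum_ord // nth_ord_enum. Qed.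

Lemma Q_cell (Q : Tab) i : (val Q i).2 < nth 0 nu (val Q i).1.
Proof. by rewrite -inskew_straight; apply: syt_cellb (valP Q) i. Qed.

Lemma card_row_prefix (Q : Tab) k c : c <= nth 0 nu k ->
  #|[set j | ((val Q j).1 == k :> nat) && ((val Q j).2 < c)]| = c.
Proof.
move=> ck; have cK : c <= Kb nu by apply: leq_trans ck _; apply: leqW; apply: sumn_nth_leq.
rewrite -{2}(card_ord_lt cK).
have inj : {in [set j | ((val Q j).1 == k :> nat) && ((val Q j).2 < c)] &, injective (fun j => (val Q j).2)}.
  move=> i j; rewrite !inE => /andP[/eqP i1 _] /andP[/eqP j1 _] E; apply: (syt_inj (valP Q)).
  by apply: cell_eq; rewrite ?i1 ?j1 ?E.
rewrite -(card_in_imset inj); congr #|pred_of_set _|; apply/setP=> x; rewrite inE.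
apply/imsetP/idP => [[j]|xc]; first by rewrite inE => /andP[_ h] ->.
have cell : inskew nu [::] k x by rewrite inskew_straight; apply: leq_trans ck.
have [j [j1 j2]] := syt_onto pnu (valP Q) cell.
by exists j; [rewrite inE j1 eqxx j2|apply: ord_inj].
Qed.

Lemma count_rows (Q : Tab) k : count_mem k (rows Q) = nth 0 nu k.
Proof.
rewrite (count_mem_ord _ (size_rows Q)) -[RHS](card_row_prefix Q (leqnn _)).
apply: eq_card => j; rewrite !inE nth_rows; case: eqP => //= E.
by rewrite -E Q_cell.
Qed.

Lemma Q_col (Q : Tab) (i : 'I_n) : (val Q i).2 = count_mem (nat_of_ord (val Q i).1) (take i (rows Q)) :> nat.
Proof.
rewrite (count_take _ (size_rows Q)); last exact: ltnW.
rewrite -[LHS](card_row_prefix Q (ltnW (Q_cell Q i))); apply: eq_card => j; rewrite !inE nth_rows andbC.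
case: eqP => [E|]; rewrite ?andbF ?andbT //; apply/idP/idP => h; first exact: (syt_row_lt (valP Q)).
rewrite ltnNge leq_eqVlt; apply/negP=> /orP[/eqP E2|E2].
  by have := syt_inj (valP Q) (cell_eq E (esym E2)) => ij; rewrite ij ltnn in h.
by have := syt_row_lt (valP Q) (esym E) E2; lia.
Qed.

Lemma rows_inj : injective rows.
Proof.
move=> Q Q' E; apply: val_inj; apply/ffunP=> i.
have r : (val Q i).1 = (val Q' i).1 :> nat by rewrite -!nth_rows E.
by apply: cell_eq => //; rewrite !Q_col E r.
Qed.

(** Each entry of row [k+1] is sent to the smaller entry directly above it, injectively. *)
Lemma yam_rows Q : yam (rows Q).
Proof.
move=> i k; wlog in_ : i / i <= n => [H|].
  case: (leqP i n) => [|/ltnW ni]; first exact: H.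
  by have := H n (leqnn _); rewrite !take_oversize ?size_rows.
rewrite !(count_take _ (size_rows Q)) //.
have up j : exists j', ((val Q j).1 == k.+1 :> nat) ==>
    [&& (val Q j').1 == k :> nat, (val Q j').2 == (val Q j).2 & j' < j].
  case: (eqVneq (nat_of_ord (val Q j).1) k.+1) => [E|]; last by exists j.
  have cell : inskew nu [::] k (val Q j).2.
    rewrite inskew_straight; apply: leq_trans (Q_cell Q j) _; rewrite E; exact: nth_partition.
  have [j' [j1 j2]] := syt_onto pnu (valP Q) cell.
  exists j'; rewrite j1 eqxx -val_eqE /= j2 eqxx /=.
  by apply: (syt_col_lt (valP Q)); rewrite ?j1 ?j2 ?E.
pose f j := xchoose (up j); have fE j := implyP (xchooseP (up j)).
have f_inj : {in [set j : 'I_n | (j < i) && (nth 0 (rows Q) j == k.+1)] &, injective f}.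
  move=> a b; rewrite !inE !nth_rows => /andP[_ a1] /andP[_ b1] E.
  have /and3P[_ /eqP a2 _] := fE a a1; have /and3P[_ /eqP b2 _] := fE b b1.
  apply: (syt_inj (valP Q)); apply: cell_eq; first by rewrite (eqP a1) (eqP b1).
  by rewrite -a2 -b2 -/(f a) -/(f b) E.
rewrite -(card_in_imset f_inj); apply: subset_leq_card; apply/subsetP=> _ /imsetP[j + ->].
rewrite !inE !nth_rows => /andP[ji j1]; have /and3P[-> _ h] := fE j j1.
by rewrite andbT; apply: ltn_trans ji.
Qed.

Lemma yam_le (ks : seq nat) i k l : yam ks -> k <= l ->
  count_mem l (take i ks) <= count_mem k (take i ks).
Proof.
move=> y kl; have -> : l = k + (l - k) by lia.
elim: (l - k) => [|d IH]; first by rewrite addn0.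
by rewrite addnS; apply: leq_trans (y _ _) IH.
Qed.

(** Entry [i] goes into the row named by the [i]-th letter, at the first free column; the lattice
    condition makes the columns increase. *)
Lemma rows_onto ks : size ks = n -> yam ks -> (forall k, count_mem k ks = nth 0 nu k) ->
  exists Q : Tab, rows Q = ks.
Proof.
move=> sk y cE.
pose col (i : nat) := count_mem (nth 0 ks i) (take i ks).
have colS i : i < n -> count_mem (nth 0 ks i) (take i.+1 ks) = (col i).+1.
  by move=> ik; rewrite (take_nth 0) ?sk // -cats1 count_cat /= eqxx addn0 addn1.
have mono i j k : i <= j -> count_mem k (take i ks) <= count_mem k (take j ks).
  move=> ij; rewrite -[take i ks](take_takel _ ij).
  by rewrite -{2}(cat_take_drop i (take j ks)) count_cat leq_addr.
have tot i k : count_mem k (take i ks) <= nth 0 nu k.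
  by rewrite -cE -{2}(cat_take_drop i ks) count_cat leq_addr.
have cell (i : 'I_n) : inskew nu [::] (nth 0 ks i) (col i).
  by rewrite inskew_straight -colS.
pose g : {ffun 'I_n -> cellT nu} := [ffun i : 'I_n => mkcell nu (nth 0 ks i) (col i)].
have g1 i : (g i).1 = nth 0 ks i :> nat by rewrite ffunE (mkcell1 pnu (cell i)).
have g2 i : (g i).2 = col i :> nat by rewrite ffunE (mkcell2 pnu (cell i)).
have colt (i j : 'I_n) : nth 0 ks i = nth 0 ks j -> i < j -> col i < col j.
  by move=> E ij; rewrite -colS // /col -E; apply: mono.
have sg : is_syt n nu [::] g.
  apply/sytP; split.
  - by move=> i; rewrite /cellb g1 g2 cell.
  - move=> x; rewrite /cellb inskew_straight => xc.
    suff [i ik iE] : exists2 i : 'I_n, nth 0 ks i = x.1 & col i = x.2.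
      by exists i; apply: cell_eq; rewrite ?g1 ?g2.
    have : x.2 < #|[set j : 'I_n | nth 0 ks j == x.1]| by rewrite -(count_mem_ord _ sk) cE.
    case/blk_onto=> i; rewrite inE => /eqP i1 i2; exists i => //.
    rewrite -i2 /col (count_take _ sk) ?(ltnW (ltn_ord i)) // i1; apply: eq_card => j.
    by rewrite !inE andbC.
  - move=> i j E; apply: ord_inj.
    have E1 : nth 0 ks i = nth 0 ks j by rewrite -!g1 E.
    have E2 : col i = col j by rewrite -!g2 E.
    case: (ltngtP i j) => // ij; first by have := colt i j E1 ij; lia.
    by have := colt j i (esym E1) ij; lia.
  - move=> i j; rewrite !g1 !g2 => E c; rewrite ltnNge leq_eqVlt; apply/negP=> /orP[/eqP/ord_inj ij|ij].
      by rewrite ij ltnn in c.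
    by have := colt j i (esym E) ij; lia.
  - move=> i j; rewrite !g1 !g2 => c r.
    have : (col j).+1 <= count_mem (nth 0 ks i) (take j.+1 ks).
      by rewrite -colS //; apply: yam_le => //; apply: ltnW.
    rewrite -c => h; rewrite ltnNge leq_eqVlt; apply/negP=> /orP[/eqP/ord_inj ij|ij].
      by rewrite ij ltnn in r.
    by have := mono j.+1 i (nth 0 ks i) ij; rewrite -/(col i); lia.
exists (Sub g sg : Tab); apply: (@eq_from_nth _ 0); first by rewrite size_rows sk.
by move=> i; rewrite size_rows => ik; rewrite -[i]/(nat_of_ord (Ordinal ik)) nth_rows /= g1.
Qed.

Lemma DesT_rows (Q : Tab) (i : 'I_n) :
  (i \in DesT Q) = (i.+1 < n) && (nth 0 (rows Q) i < nth 0 (rows Q) i.+1).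
Proof.
rewrite DesTE; case: (boolP (i.+1 < n)) => //= lin.
by rewrite nth_rows -(val_ordS lin) nth_rows.
Qed.

End StraightTableaux.

Definition shape (t : seq (seq nat)) : seq nat := map size t.

Lemma nth_shape t i : nth 0 (shape t) i = sh t i.
Proof.
rewrite /shape /sh; case: (ltnP i (size t)) => h; first by rewrite (nth_map [::]).
by rewrite !nth_default // size_map.
Qed.

Lemma shape_partition t : tab t -> is_partition (shape t).
Proof.
move=> tt; apply/andP; split.
  by apply/(sortedP 0) => i _; rewrite !nth_shape; apply: tab_sh.
elim: t tt => //= r t IH /and4P[r0 _ _ /IH->].
by case: r r0.
Qed.

Lemma size_to_word t : size (to_word t) = sumn (shape t).
Proof. by elim: t => //= r t IH; rewrite size_cat IH addnC. Qed.

(** * Robinson-Schensted decomposition of skew tableaux *)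

Section SkewPositivity.
Variables (n : nat) (la mu : seq nat).
Hypotheses (pla : is_partition la) (pmu : is_partition mu).
Local Notation Tab := (SYT n la mu).

Definition tabP (T : Tab) := rsP [::] (word (val T)).

(** The Knuth class of a tableau word consists of tableau words, so every recording tableau occurs.
    Codes decrease from each row to the next lower one, so descents of [T] are drops of its word,
    which are descents of the recording tableau. *)
Lemma rs_fibre (T0 : Tab) (D : {set 'I_n}) :
  #|[set T : Tab | (tabP T == tabP T0) && (DesT T == D)]| =
  #|[set Q : SYT n (shape (tabP T0)) [::] | DesT Q == D]|.
Proof.
set P := tabP T0; set nu := shape P.
have tP : tab P := tab_rsP _.
have pnu : is_partition nu := shape_partition tP.
have qx (T : Tab) : exists Q : SYT n nu [::], (tabP T == P) ==> (rows Q == rsQ [::] (word (val T))).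
  case: (eqVneq (tabP T) P) => [E|nE].
    have [|||Q QE] := @rows_onto n nu pnu (rsQ [::] (word (val T))).
    - by rewrite size_rsQ size_word.
    - exact: yam_rsQ.
    - by move=> k; rewrite nth_shape -E sh_rsP.
    by exists Q; rewrite QE eqxx.
  (* A default value off the fibre: the recording tableau of [T0]. *)
  have [|||Q QE] := @rows_onto n nu pnu (rsQ [::] (word (val T0))).
  - by rewrite size_rsQ size_word.
  - exact: yam_rsQ.
  - by move=> k; rewrite nth_shape sh_rsP.
  by exists Q.
pose f T := xchoose (qx T).
have fE T : tabP T = P -> rows (f T) = rsQ [::] (word (val T)).
  by move=> /eqP E; apply/eqP; exact: (implyP (xchooseP (qx T)) E).
have f_inj : {in [set T : Tab | (tabP T == P) && (DesT T == D)] &, injective f}.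
  move=> T T'; rewrite !inE => /andP[/eqP E _] /andP[/eqP E' _] F.
  apply: val_inj; apply: word_inj; apply: rs_inj; first by rewrite -/(tabP T) -/(tabP T') E E'.
  by rewrite -fE // -fE // F.
have Des_f T : tabP T = P -> DesT (f T) = DesT T.
  move=> E; apply/setP=> i; rewrite DesT_rows fE // DesTE.
  case: (boolP (i.+1 < n)) => //= lin.
  rewrite rsQ_des ?size_word // -(val_ordS lin) !nth_word code_lt.
  case: (boolP (_ < _)) => //= _; apply/negbTE/negP=> /andP[/eqP r c].
  by have := syt_row_lt (valP T) (esym r) c; rewrite (val_ordS lin); lia.
rewrite -(card_in_imset f_inj); congr #|pred_of_set _|; apply/setP=> Q; rewrite inE.
apply/imsetP/idP => [[T]|QD]; first by rewrite inE => /andP[/eqP E /eqP <-] ->; rewrite Des_f.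
have [|u [uP uQ]] := rs_surj tP (yam_rows pnu Q).
  by move=> k; rewrite count_rows // nth_shape.
have [T TE] : is_word n la mu u.
  apply: (proj2 (knuth_is_word n pla pmu (knuth_rsP u))); rewrite uP.
  by apply: (proj1 (knuth_is_word n pla pmu (knuth_rsP _))); exists T0.
have TP : tabP T = P by rewrite /tabP TE.
have QE : Q = f T by apply: (rows_inj pnu); rewrite fE // TE.
by exists T => //; rewrite inE TP eqxx -(Des_f T TP) -QE.
Qed.

Lemma skew_decomposition : exists L : seq (seq nat),
  all (fun nu => is_partition nu && (sumn nu == n)) L /\
  forall D : {set 'I_n}, #|[set T : Tab | DesT T == D]| =
    \sum_(nu <- L) #|[set Q : SYT n nu [::] | DesT Q == D]|.
Proof.
(* One summand for each Knuth class, represented by its insertion tableau. *)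
pose Ps := undup [seq tabP T | T : Tab]; exists [seq shape P | P <- Ps]; split.
  apply/allP=> _ /mapP[P + ->]; rewrite mem_undup => /mapP[T _ ->].
  rewrite shape_partition ?tab_rsP //= -size_to_word.
  by rewrite -(knuth_size (knuth_rsP (word (val T)))) size_word.
move=> D; rewrite big_map.
rewrite -sum1dep_card; under eq_bigl do rewrite -[_ == _]andTb.
have -> : \sum_(T : Tab | true && (DesT T == D)) 1 =
    \sum_(P <- Ps) \sum_(T : Tab | (DesT T == D) && (tabP T == P)) 1.
  rewrite (exchange_big_dep (fun T : Tab => DesT T == D)) //=; last by move=> P T _ /andP[].
  apply: eq_bigr => T TD; rewrite (eq_bigl (pred1 (tabP T))); last by move=> P /=; rewrite TD eq_sym.
  by rewrite sum1_count count_uniq_mem ?undup_uniq // mem_undup map_f // mem_enum.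
rewrite !big_seq; apply: eq_bigr => P; rewrite mem_undup => /mapP[T0 _ ->].
rewrite -rs_fibre -sum1dep_card; apply: eq_bigl => T; by rewrite andbC.
Qed.

End SkewPositivity.

(** * Descent distributions *)

Lemma sum_by_fibre (X Y : finType) (A : {set X}) (c : X -> Y) (F : Y -> nat) :
  \sum_(x in A) F (c x) = \sum_y #|[set x in A | c x == y]| * F y.
Proof.
rewrite (partition_big c predT) //=; apply: eq_bigr => y _.
rewrite -sum_nat_const; apply: eq_big => [x|x]; first by rewrite inE.
by case/andP=> _ /eqP->.
Qed.

(** Inversion on the Boolean lattice, by induction on the size of [D]. *)
Lemma subset_sum_inj (X : finType) (Z : {set X}) (g h : {set X} -> nat) :
    (forall D : {set X}, D \subset Z -> \sum_(E : {set X} | E \subset D) g E = \sum_(E : {set X} | E \subset D) h E) ->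
  forall D : {set X}, D \subset Z -> g D = h D.
Proof.
move=> H D; have [N] := ubnP #|D|; elim: N D => // N IH D /ltnSE leN DZ.
have := H D DZ; rewrite (bigD1 D) //= [RHS](bigD1 D) //=.
rewrite [X in _ + X = _](eq_bigr h) => [/addIn//|E /andP[ED nE]].
have pED : E \proper D by rewrite properEneq nE.
by apply: IH; [exact: leq_trans (proper_card pED) leN|exact: subset_trans DZ].
Qed.

Lemma disjoint_last m (D : {set 'I_m.+1}) : ord_max \notin D -> D :\ ord_max = D.
Proof. by move=> lD; apply/setDidPl; rewrite disjoint_sym disjoints1. Qed.

Lemma cyclic_count_unique m (f g : {set 'I_m.+1} -> nat) :
    (forall J, f (shiftset J) = f J) -> (forall J, g (shiftset J) = g J) ->
    f set0 = g set0 ->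
    (forall D : {set 'I_m.+1}, ord_max \notin D ->
       f D + f (ord_max |: D) = g D + g (ord_max |: D)) ->
  f =1 g.
Proof.
move=> fS gS fg0 rec J; have [N] := ubnP #|J|; elim: N J => // N IH J /ltnSE leN.
case: (set_0Vmem J) => [->//|[i iJ]].
(* An inner induction rotates an element of [J] to the last index, where the recursion passes to a
   smaller set. *)
have [k kE] : exists k, i + k = m by exists (m - i); have := ltn_ord i; lia.
elim: k i J kE iJ leN => [|k IHk] i J kE iJ leN.
  have iE : i = ord_max by apply: ord_inj; rewrite /=; lia.
  rewrite iE in iJ; have JE := setD1K iJ; rewrite -JE; set D := J :\ ord_max in JE *.
  have lD : ord_max \notin D by rewrite !inE eqxx.
  have cD : #|D| < N by apply: leq_trans leN; rewrite (cardsD1 ord_max J) iJ.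
  by have := rec D lD; rewrite (IH D cD) => /addnI.
have e : ordS i = i.+1 :> nat by rewrite val_ordS //; lia.
by rewrite -fS -gS; apply: (IHk (ordS i)); rewrite ?mem_shiftset ?card_shiftset // e; lia.
Qed.

(** * Cyclic descent counts of permutations *)

Section Permutations.
Variable m : nat.
Local Notation n := m.+1.
Hypothesis m_gt0 : 0 < m.

Lemma Des_cDes (p : {perm 'I_n}) : Des p = cDes p :\ ord_max.
Proof.
apply/setP=> i; rewrite !inE; congr (_ && _).
by rewrite ltnS ltn_neqAle -ltnS ltn_ord andbT -val_eqE.
Qed.

Lemma last_notin_Des (p : {perm 'I_n}) : ord_max \notin Des p.
Proof. by rewrite inE ltnn. Qed.

Lemma ordS_neq_id (i : 'I_n) : ordS i != i.
Proof.
case: (ltnP i.+1 n) => h; first by rewrite eq_sym ordS_neq.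
have -> : i = ord_max by apply: ord_inj; have := ltn_ord i; rewrite /=; lia.
by rewrite ordS_max -val_eqE /=; lia.
Qed.

Lemma cDes_neq0 (p : {perm 'I_n}) : cDes p != set0.
Proof.
(* The largest value is followed cyclically by another, hence smaller, value because [n > 1]. *)
apply/set0Pn; exists (p^-1 ord_max)%g; rewrite inE permKV ltn_neqAle -ltnS ltn_ord andbT.
rewrite -[X in _ != X]/(nat_of_ord ord_max) (inj_eq (@ord_inj _)).
rewrite -{2}(permKV p ord_max) (inj_eq perm_inj); exact: ordS_neq_id.
Qed.

Lemma cDes_neqT (p : {perm 'I_n}) : cDes p != setT.
Proof.
apply/eqP=> /setP/(_ (p^-1 ord0)%g); rewrite !inE permKV ltn0.
by [].
Qed.

Variable A : {set {perm 'I_n}}.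
Definition ccount (J : {set 'I_n}) := #|[set p in A | cDes p == J]|.

Lemma ccount0 : ccount set0 = 0.
Proof.
by apply/eqP; rewrite cards_eq0; apply/eqP/setP=> p; rewrite !inE (negPf (cDes_neq0 p)) andbF.
Qed.

Lemma ccountT : ccount setT = 0.
Proof.
by apply/eqP; rewrite cards_eq0; apply/eqP/setP=> p; rewrite !inE (negPf (cDes_neqT p)) andbF.
Qed.

Lemma Des_count (D : {set 'I_n}) : ord_max \notin D ->
  #|[set p in A | Des p == D]| = ccount D + ccount (ord_max |: D).
Proof.
move=> lD; rewrite /ccount -cardsUI (_ : _ :&: _ = set0) ?cards0 ?addn0; last first.
  apply/setP=> p; rewrite !inE; apply/negP=> /andP[/andP[_ /eqP-> ] /andP[_ /eqP E]].
  by rewrite E !inE eqxx in lD.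
congr #|pred_of_set _|; apply/setP=> p; rewrite !inE -andb_orr Des_cDes; congr (_ && _).
apply/eqP/orP => [<-|[/eqP->|/eqP->]].
- case: (boolP (ord_max \in cDes p)) => h; first by right; rewrite setD1K.
  by left; rewrite disjoint_last.
- by rewrite disjoint_last.
by rewrite setU1K.
Qed.

Lemma cDes_invariantP : cDes_invariant A <-> (forall J, ccount (shiftset J) = ccount J).
Proof.
split=> [[psi [phi [psiA phiA psiK phiK psiD]]] J|H].
  have inj : {in [set p in A | cDes p == J] &, injective psi}.
    by move=> p q; rewrite !inE => /andP[pA _] /andP[qA _] /(congr1 phi); rewrite !psiK.
  rewrite /ccount -[RHS](card_in_imset inj); congr #|pred_of_set _|; apply/setP=> p; rewrite !inE.
  apply/andP/imsetP => [[pA /eqP pJ]|[q + ->]].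
    exists (phi p); last by rewrite phiK.
    rewrite inE phiA //=; apply/eqP; apply: (@shiftset_inj n).
    by rewrite -psiD ?phiA // phiK.
  by rewrite inE => /andP[qA /eqP qJ]; rewrite psiA // psiD // qJ.
have [psi psiE] := equidistributed_perm (@shiftset_inj n) H.
have psiA : psi @: A = A.
  apply/eqP; rewrite eqEcard card_imset ?leqnn ?andbT; last exact: perm_inj.
  by apply/subsetP=> _ /imsetP[p pA ->]; have [] := psiE p pA.
exists psi, (psi^-1)%g; split.
- by move=> p pA; have [] := psiE p pA.
- move=> p; rewrite -{1}psiA => /imsetP[q qA ->]; by rewrite permK.
- by move=> p _; apply: permK.
- by move=> p _; apply: permKV.
- by move=> p pA; have [] := psiE p pA.
Qed.

End Permutations.

(** * Schur-positivity in terms of descent counts *)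

Section DescentWords.
Variable m : nat.
Local Notation n := m.+1.

(** Test words: for [D] without the last index, the strict ascents are exactly [D], so the
    coefficient at [dword D] sums over the subsets of [D]. *)
Definition dword (D : {set 'I_n}) : seq nat := [seq blk D i | i <- enum 'I_n].

Lemma size_dword D : size (dword D) = n.
Proof. by rewrite size_map size_enum_ord. Qed.

Lemma nth_dword D (i : 'I_n) : nth 0 (dword D) i = blk D i.
Proof. by rewrite (nth_map i) ?size_enum_ord // nth_ord_enum. Qed.

Lemma sorted_dword D : sorted leq (dword D).
Proof.
apply/(sortedP 0) => i; rewrite size_dword => lin.
rewrite -[i.+1]/(nat_of_ord (Ordinal lin)) -[i]/(nat_of_ord (Ordinal (ltnW lin))) !nth_dword.
by apply: blk_le.
Qed.

Lemma Fcoef_dword (D E : {set 'I_n}) : ord_max \notin D -> ord_max \notin E ->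
  Fcoef E (dword D) = (E \subset D).
Proof.
have ltl (F : {set 'I_n}) (i : 'I_n) : ord_max \notin F -> i \in F -> i.+1 < n.
  move=> lF iF; rewrite ltnS ltn_neqAle -ltnS ltn_ord andbT; apply: contra lF => /eqP im.
  by rewrite -(_ : i = ord_max) //; apply: ord_inj.
move=> lD lE; rewrite Fcoef_ascents ?size_dword ?sorted_dword //; last by move=> i; apply: ltl.
congr (nat_of_bool (_ \subset _)).
suff -> : ascents m (dword D) = D by [].
apply/setP=> i; rewrite inE; case: (boolP (i.+1 < n)) => lin /=.
  by rewrite -(val_ordS lin) !nth_dword blk_ordS // -{1}[blk D i]add0n ltn_add2r lt0b.
by apply/esym/negbTE; apply: contra lin; apply: ltl.
Qed.

Definition dcount (la mu : seq nat) (D : {set 'I_n}) := #|[set T : SYT n la mu | DesT T == D]|.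

Lemma dcount_last la mu (D : {set 'I_n}) : ord_max \in D -> dcount la mu D = 0.
Proof.
move=> lD; apply/eqP; rewrite cards_eq0; apply/eqP/setP=> T; rewrite !inE; apply/negP=> /eqP E.
by have := last_notin_DesT T; rewrite E lD.
Qed.

Lemma schur_coef_dcount la w : is_partition la -> size w = n -> sorted leq w ->
  schur_coef la w = \sum_(D : {set 'I_n}) dcount la [::] D * Fcoef D w.
Proof.
move=> pla sw srt; rewrite (schur_coefE pla sw srt).
have := sum_by_fibre setT (@DesT n la [::]) (fun D => Fcoef D w).
rewrite (eq_bigl predT) => [->|T]; last by rewrite inE.
by apply: eq_bigr => D _; congr (_ * _); apply: eq_card => T; rewrite !inE.
Qed.

(** Coefficients at the words [dword D] give equal sums over subsets of [D]; Boolean inversion turns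
    these into equal descent counts. *)
Lemma schur_positiveP (A : {set {perm 'I_n}}) : schur_positive A <->
  exists L : seq (seq nat), all (fun la => is_partition la && (sumn la == n)) L /\
    forall D, #|[set p in A | Des p == D]| = \sum_(la <- L) dcount la [::] D.
Proof.
have FA w : \sum_(p in A) Fcoef (Des p) w = \sum_D #|[set p in A | Des p == D]| * Fcoef D w.
  exact: (sum_by_fibre A (@Des n) (fun D => Fcoef D w)).
have FL (L : seq (seq nat)) w : all (fun la => is_partition la && (sumn la == n)) L ->
    size w = n -> sorted leq w ->
    \sum_(la <- L) schur_coef la w = \sum_D (\sum_(la <- L) dcount la [::] D) * Fcoef D w.
  move=> /allP LP sw srt; under [RHS]eq_bigr do rewrite big_distrl.
  rewrite exchange_big /= !big_seq; apply: eq_bigr => la /LP/andP[pla _].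
  exact: schur_coef_dcount.
split=> -[L [LP H]]; exists L; split=> //; last first.
  by move=> w sw srt; rewrite FA FL //; apply: eq_bigr => D _; rewrite H.
move=> D; case: (boolP (ord_max \in D)) => lD.
  rewrite big1 => [|la _]; last exact: dcount_last.
  apply/eqP; rewrite cards_eq0; apply/eqP/setP=> p; rewrite !inE; apply/negP=> /andP[_ /eqP E].
  by have := last_notin_Des p; rewrite E lD.
apply: (@subset_sum_inj _ (~: [set ord_max]) (fun D => #|[set p in A | Des p == D]|)
          (fun D => \sum_(la <- L) dcount la [::] D)); last first.
  by apply/subsetP=> i iD; rewrite !inE; apply: contraNneq lD => <-.
move=> {lD} {}D DZ; have lD : ord_max \notin D.
  by apply/negP=> /(subsetP DZ); rewrite !inE eqxx.
have := H (dword D) (size_dword D) (sorted_dword D).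
rewrite FA FL ?size_dword ?sorted_dword //.
have conv (f : {set 'I_n} -> nat) : (forall E : {set 'I_n}, ord_max \in E -> f E = 0) ->
    \sum_E f E * Fcoef E (dword D) = \sum_(E : {set 'I_n} | E \subset D) f E.
  move=> f0; rewrite [RHS]big_mkcond; apply: eq_bigr => E _.
  case: (boolP (ord_max \in E)) => lE; first by rewrite f0 //; case: ifP.
  by rewrite Fcoef_dword //; case: ifP => _; rewrite ?muln1 ?muln0.
rewrite !conv // => E lE; first by rewrite big1 // => la _; apply: dcount_last.
apply/eqP; rewrite cards_eq0; apply/eqP/setP=> p; rewrite !inE; apply/negP=> /andP[_ /eqP pE].
by have := last_notin_Des p; rewrite pE lE.
Qed.

End DescentWords.

(** * The equivalence *)

Lemma straight_skew n la : is_partition la -> sumn la = n -> is_skew n la [::].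
Proof.
move=> pla sla; rewrite /is_skew pla sla subn0 eqxx andbT /=.
by apply/allP=> i _; rewrite nth_nil.
Qed.

Lemma nonhook_not_ribbon la : is_partition la -> 1 < nth 0 la 1 -> ~~ connected_ribbon la [::].
Proof.
move=> pla l1; rewrite /connected_ribbon negb_and negbK; apply/orP; right.
have l0 : 1 < nth 0 la 0 by apply: leq_trans l1 _; apply: nth_partition.
by apply/existsP; exists ord0; apply/existsP; exists ord0; rewrite !inskew_straight /=; lia.
Qed.

Lemma cut_hook_skew n p q : n = p + q -> is_skew n (hook_la p q) [:: 1].
Proof.
move=> nE; rewrite /is_skew hook_partition; apply/and5P; split=> //; last first.
  by rewrite /= sumn_nseq; lia.
by apply/allP=> i; rewrite mem_iota; case: i => // i _; rewrite /= nth_nil.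
Qed.

(** With the corner removed, no cell of the first row is adjacent to a cell of the leg. *)
Lemma cut_hook_not_ribbon p q : 0 < p -> 0 < q -> ~~ connected_ribbon (hook_la p q) [:: 1].
Proof.
move=> p0 q0; rewrite /connected_ribbon negb_and; apply/orP; left; apply/negP.
have ih r c : inskew (hook_la p q) [:: 1] r c =
    ((r == 0) && (1 <= c <= q)) || ((0 < r <= p) && (c == 0)) := @inskew_hook p q true r c.
have c1 : inskew (hook_la p q) [:: 1] 0 1 by rewrite ih q0.
have c2 : inskew (hook_la p q) [:: 1] 1 0 by rewrite ih p0 orbT.
have pla := hook_partition p q.
set x := mkcell (hook_la p q) 0 1; set y := mkcell (hook_la p q) 1 0.
move=> /forallP/(_ x)/forallP/(_ y)/implyP.
rewrite (cellb_mkcell pla c1) (cellb_mkcell pla c2) => /(_ isT) con.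
have cl : closed (adjc (hook_la p q) [:: 1]) [pred z : cellT (hook_la p q) | z.1 == 0 :> nat].
  by move=> a b /and3P[]; rewrite /cellb !ih !inE; lia.
have := closed_connect cl con; rewrite !inE (mkcell1 pla c1) (mkcell1 pla c2).
by [].
Qed.

Lemma cut_hook_descent_count m p q (D : {set 'I_m.+1}) : m.+1 = p + q -> 0 < p -> 0 < q ->
  ord_max \notin D -> dcount (hook_la p q) [:: 1] D = (#|D| == p) + (#|D|.+1 == p).
Proof.
move=> mE p0 q0 lD; have [cD [[psi ext] cnt]] := cut_hook_cyclic_ext mE p0 q0.
have [_ _ rec] := cyclic_ext_count ext.
by rewrite /dcount -rec // !cnt cardsU1 lD.
Qed.

Lemma hookP la : is_partition la -> 0 < sumn la -> nth 0 la 1 <= 1 ->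
  la = hook_la (size la).-1 (head 0 la).-1.
Proof.
case: la => // x la pla _ l1; have /= /andP[_ /andP[x0 pos]] := pla.
rewrite /hook_la /= prednK //; congr (_ :: _); apply: (@eq_from_nth _ 0); first by rewrite size_nseq.
move=> i il; rewrite nth_nseq il; have := @nth_partition (x :: la) 1 i.+1 pla isT; rewrite /=.
by have := allP pos _ (mem_nth 0 il) => /= h1 h2; move: l1; rewrite /=; lia.
Qed.

(** [cyclic_schur_positive] asks for a single family over all shapes. Gluing along a finite list by
    deciding equality of shapes avoids a choice axiom. *)
Lemma glue_shapes n (Pr : forall s : seq nat * seq nat, (SYT n s.1 s.2 -> {set 'I_n}) -> Prop)
    (L : seq (seq nat * seq nat)) :
    (forall s, s \in L -> exists cD, Pr s cD) ->
  exists cD : forall la mu, SYT n la mu -> {set 'I_n}, forall s, s \in L -> Pr s (cD s.1 s.2).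
Proof.
elim: L => [|s L IH] H; first by exists (fun _ _ _ => set0).
have [|cD cDP] := IH; first by move=> s' s'L; apply: H; rewrite inE s'L orbT.
have [c cP] := H s (mem_head _ _).
pose d (s' : seq nat * seq nat) : SYT n s'.1 s'.2 -> {set 'I_n} :=
  match @eqP _ s s' with
  | ReflectT e => ecast z (SYT n z.1 z.2 -> {set 'I_n}) e c
  | ReflectF _ => cD s'.1 s'.2
  end.
exists (fun la mu => d (la, mu)) => s' s'L.
have -> : d (s'.1, s'.2) = d s' by case: s' {s'L}.
rewrite /d; case: eqP => [e|ne]; first by case: _ / e.
by apply: cDP; move: s'L; rewrite inE eq_sym (introF eqP ne).
Qed.

Section Equivalence.
Variable m : nat.
Local Notation n := m.+1.
Hypothesis m_gt0 : 0 < m.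
Variable A : {set {perm 'I_n}}.

Lemma skew_list_decomposition (L : seq (seq nat * seq nat)) :
    all (fun s => is_skew n s.1 s.2) L ->
  exists L' : seq (seq nat), all (fun la => is_partition la && (sumn la == n)) L' /\
    forall D : {set 'I_n}, \sum_(s <- L) dcount s.1 s.2 D = \sum_(la <- L') dcount la [::] D.
Proof.
elim: L => [|[la mu] L IH] /=; first by move=> _; exists [::]; split=> // D; rewrite !big_nil.
case/andP=> /and5P[pla pmu _ _ _] /IH[L' [L'P L'E]].
have [L2 [L2P L2E]] := skew_decomposition n pla pmu.
exists (L2 ++ L'); rewrite all_cat L2P L'P; split=> // D.
by rewrite big_cons big_cat /= -L'E {1}/dcount L2E.
Qed.

Lemma cyclic_schur_positive_forward :
  cyclic_schur_positive A -> schur_positive A /\ cDes_invariant A.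
Proof.
case=> L [cD [LP ext cnt]].
have extE s : s \in L -> [/\ forall J, #|[set T | cD s.1 s.2 T == shiftset J]| = #|[set T | cD s.1 s.2 T == J]|,
      #|[set T | cD s.1 s.2 T == set0]| = 0 &
      forall J : {set 'I_n}, ord_max \notin J ->
        #|[set T | cD s.1 s.2 T == J]| + #|[set T | cD s.1 s.2 T == ord_max |: J]| = dcount s.1 s.2 J].
  by move=> /ext[psi]; apply: cyclic_ext_count.
split; last first.
  apply/cDes_invariantP => J; rewrite /ccount !cnt !big_seq; apply: eq_bigr => s sL.
  by have [-> _ _] := extE s sL.
apply/schur_positiveP.
have [|L' [L'P L'E]] := @skew_list_decomposition L.
  by apply/allP=> s /(allP LP)/andP[].
exists L'; split=> // D; rewrite -L'E; case: (boolP (ord_max \in D)) => lD.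
  rewrite big1 => [|s _]; last exact: dcount_last.
  apply/eqP; rewrite cards_eq0; apply/eqP/setP=> p; rewrite !inE; apply/negP=> /andP[_ /eqP E].
  by have := last_notin_Des p; rewrite E lD.
rewrite Des_count // /ccount !cnt -big_split !big_seq; apply: eq_bigr => s sL /=.
by have [_ _ ->] := extE s sL.
Qed.

Definition arc k : {set 'I_n} := [set i : 'I_n | i < k].

(** Under rotation invariance this identifies the count at [ord_max |: arc k] with the count at the
    next arc. *)
Lemma shift_arc k : k < n -> shiftset (ord_max |: arc k) = arc k.+1.
Proof.
move=> kn; apply/setP=> i; rewrite -[i](ord_predK i) mem_shiftset; move: (ord_pred i) => j.
rewrite !inE; case: (ltnP j.+1 n) => h.
  rewrite val_ordS // ltnS; case: eqP => // E; by rewrite E /= ltnn in h.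
have -> : j = ord_max by apply: ord_inj; have := ltn_ord j; rewrite /=; lia.
by rewrite eqxx ordS_max.
Qed.

Definition is_hook (la : seq nat) := nth 0 la 1 <= 1.

Lemma cyclic_schur_positive_backward :
  schur_positive A -> cDes_invariant A -> cyclic_schur_positive A.
Proof.
case/schur_positiveP=> L0 [L0P L0E] /cDes_invariantP inv.
pose c k := ccount A (arc k).
have c0 : c 0 = 0.
  by rewrite /c (_ : arc 0 = set0) ?ccount0 //; apply/setP=> i; rewrite !inE.
have cn : c n = 0.
  by rewrite /c (_ : arc n = setT) ?ccountT //; apply/setP=> i; rewrite !inE ltn_ord.
pose Lh := [seq la <- L0 | is_hook la]; pose Ln := [seq la <- L0 | ~~ is_hook la].
have splitE (F : seq nat -> nat) : \sum_(la <- L0) F la = \sum_(la <- Lh) F la + \sum_(la <- Ln) F la.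
  by rewrite (bigID is_hook) /= !big_filter.
have LnP la : la \in Ln -> [/\ is_partition la, sumn la = n & 1 < nth 0 la 1].
  by rewrite mem_filter -ltnNge => /andP[h /(allP L0P)/andP[-> /eqP->]].
pose h k := count (fun la => (size la).-1 == k) Lh.
have hookE (D : {set 'I_n}) : ord_max \notin D -> \sum_(la <- Lh) dcount la [::] D = h #|D|.
  move=> lD; rewrite /h -sum1_count [RHS]big_mkcond !big_seq; apply: eq_bigr => la.
  rewrite mem_filter => /andP[hla /(allP L0P)/andP[pla /eqP sla]].
  have laE : la = hook_la (size la).-1 (head 0 la).-1 by apply: hookP => //; rewrite sla.
  have mE : m = (size la).-1 + (head 0 la).-1.
    by move: sla; rewrite {1}laE /= sumn_nseq; lia.
  by rewrite {1}laE [LHS](hook_descent_count mE lD) eq_sym; case: eqP.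
have card_arc k : k <= n -> #|arc k| = k by apply: card_ord_lt.
have rec_c k : k < n -> h k = c k + c k.+1.
  move=> kn; have lk : ord_max \notin arc k by rewrite inE /= -leqNgt.
  rewrite /c -(shift_arc kn) inv -Des_count // L0E splitE hookE // card_arc; last exact: ltnW.
  rewrite [X in _ = _ + X]big1_seq ?addn0 // => la /andP[_ /LnP[pla _ l1]].
  apply/eqP; rewrite cards_eq0; apply/eqP/setP=> T; rewrite !inE; apply/negbTE.
  exact: nonhook_noarc.
pose cuts := [seq nseq (c p) (hook_la p (n - p), [:: 1]) | p <- iota 1 m].
pose L := [seq (la, [::]) | la <- Ln] ++ flatten cuts.
have LP s : s \in L -> (exists2 la, la \in Ln & s = (la, [::])) \/
    (exists p, 0 < p < n /\ s = (hook_la p (n - p), [:: 1])).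
  rewrite mem_cat => /orP[/mapP[la laL ->]|/flattenP[t /mapP[p + ->]]]; first by left; exists la.
  by rewrite mem_iota mem_nseq => pm /andP[_ /eqP->]; right; exists p; split=> //; lia.
have [|cD cDP] := @glue_shapes n (fun s cD => exists psi, cyclic_descent_ext cD psi) L.
  move=> s /LP[[la /LnP[pla _ l1] ->]|[p [pn ->]]] /=; first exact: nonhook_cyclic_ext.
  have [||| cD [ext _]] := @cut_hook_cyclic_ext m p (n - p); try lia.
  by exists cD.
exists L, cD; split=> //.
  apply/allP=> s /LP[[la /LnP[pla sla l1] ->]|[p [pn ->]]] /=.
    by rewrite straight_skew //= nonhook_not_ribbon.
  rewrite cut_hook_skew ?cut_hook_not_ribbon //; lia.
(* Both sides are rotation invariant and vanish at the empty set, so only ordinary descent counts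
   remain to be compared. *)
apply: cyclic_count_unique => [|J||D lD]; first exact: inv.
- rewrite !big_seq; apply: eq_bigr => s /cDP[psi /cyclic_ext_count[-> _ _]] //.
- rewrite -[LHS]/(ccount A set0) ccount0 // big1_seq // => s /andP[_ /cDP[psi /cyclic_ext_count[_ -> _]]] //.
rewrite -(Des_count A lD) L0E splitE hookE // -big_split /=.
rewrite [RHS](eq_big_seq (fun s => dcount s.1 s.2 D)); last first.
  by move=> s /cDP[psi /cyclic_ext_count[_ _ ->]].
rewrite big_cat big_map /= addnC; congr (_ + _).
have Dm : #|D| < n.
  have := cardsC D; rewrite card_ord; have : 0 < #|~: D| by apply/card_gt0P; exists ord_max; rewrite inE.
  lia.
rewrite big_flatten big_map /= (eq_big_seq (fun p => c p * ((#|D| == p) + (#|D|.+1 == p)))); last first.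
  move=> p; rewrite mem_iota => pm.
  rewrite big_nseq iter_addn_0 mulnC cut_hook_descent_count //; lia.
rewrite rec_c //.
have -> : iota 1 m = index_iota 1 n by rewrite /index_iota subn1.
under eq_bigr do rewrite mulnDr; rewrite big_split /=.
(* The range omits [p = 0] and [p = n]; there [c] vanishes, as no cyclic descent set is empty or
   full. *)
have pick k : k <= n -> \sum_(1 <= p < n) c p * (k == p) = c k.
  move=> kn; case: (boolP ((0 < k) && (k < n))) => [kr|kr].
    rewrite (bigD1_seq k) ?iota_uniq ?mem_index_iota //= eqxx muln1 big1 ?addn0 // => p.
    by rewrite eq_sym => /negPf->; rewrite muln0.
  have -> : c k = 0.
    have [->|->] : k = 0 \/ k = n by lia.
    - exact: c0.
    - exact: cn.
  rewrite big_nat big1 // => p pn; have /negPf-> : k != p by lia.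
  by rewrite muln0.
by rewrite !pick // ltnW.
Qed.

End Equivalence.

Unset Implicit Arguments.

Theorem theorem3p4 (n : nat) (hn : 2 <= n) (A : {set {perm 'I_n}}) :
  cyclic_schur_positive A <-> schur_positive A /\ cDes_invariant A.
Proof.
case: n hn A => // m m_gt0 A; split; first exact: cyclic_schur_positive_forward.
by case; apply: cyclic_schur_positive_backward.
Qed.
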